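(* Let $w$ be a strictly positive analytic weight on the unit circle $\mathbb T_1$ with associated constant $\rho<1$, and fix $r$ with $\rho<r<1$. Assume that there exists $0\le\rho'<\rho$ such that $D_{\rm e}$ can be continued to the exterior of the circle $\mathbb T_{\rho'}$ as a meromorphic function whose only singularities are on the circle $\mathbb T_\rho$. Denote by $a_1,\dots,a_u$ the (finitely many) poles of $D_{\rm e}$ on $\mathbb T_\rho$, and assume that the dominant poles of $D_{\rm e}$ are $a_1,\dots,a_\ell$, $\ell\le u$, and their multiplicity is $m$. Put $\widehat D_{\rm e}(a_k)=\lim_{z\to a_k}D_{\rm e}(z)(z-a_k)^m$, $k=1,\dots,\ell$. (i) Let $\varepsilon>0$. Then for $\rho'<|z|\le r-\varepsilon$, $z\notin\bigcup_{k=1}^uB_\varepsilon(a_k)$, and $n\in\mathbb N$, $$\Phi_n(z)=\frac{D_{\rm e}(z)}{\tau}z^n+\frac1{\tau D_{\rm i}(z)}\sum_{k=1}^\ell\binom n{m-1}a_k^{n-m+1}\frac{D_{\rm i}(a_k)\widehat D_{\rm e}(a_k)}{a_k-z}+h_n(z).$$ There exist a constant $0<C<+\infty$ independent of $n$ and $\varepsilon$, and a constant $0<\delta=\delta(\varepsilon)<1$, such that $$|h_n(z)|\le\begin{cases}C\left(\rho^n\delta^n+r^{3n}\right), & \text{if } m=1,\\[4pt] \dfrac{C}{\varepsilon^{m-1}}\,n^{m-2}\rho^n, & \text{if } m\ge2.\end{cases}$$ (ii) Furthermore, for every compact set $K\subset\mathbb D_\rho$ there exist a constant $C=C(K)<\infty$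 and a constant $0<\delta<1$ such that for $z\in K$ and $n\in\mathbb N$, $$\left|\frac{\tau D_{\rm i}(z)}{a_1^{n-m+1}}\binom n{m-1}^{-1}\Phi_n(z)-\sum_{k=1}^\ell\frac{D_{\rm i}(a_k)\widehat D_{\rm e}(a_k)}{a_k-z}e^{2\pi i(n-m+1)\theta_k}\right|\le\begin{cases}C\delta^n, & \text{if } m=1,\\ C/n, & \text{if } m\ge2,\end{cases}$$ where $\theta_1=1$ and $\theta_k=\frac1{2\pi}(\arg a_k-\arg a_1)$ for $k=2,\dots,\ell$. (iii) In particular, on every compact set $K\subset\mathbb D_\rho$, for all sufficiently large $n$ the polynomials $\Phi_n$ can have at most $\ell-1$ zeros, counting their multiplicities.
   Context: Notation: for $s>0$, $\mathbb D_s=\{|z|<s\}$, $\mathbb T_s=\{|z|=s\}$; $B_\varepsilon(a)=\{z\in\mathbb C:|z-a|<\varepsilon\}$. A strictly positive analytic weight on $\mathbb T_1$ is a function $w$ that is strictly positive on $\mathbb T_1$ and extends to a nowhere vanishing holomorphic function on an open set containing $\mathbb T_1$. The orthonormal polynomials $\varphi_n(z)=\kappa_nz^n+\dots$, $\kappa_n>0$, satisfy $\oint_{\mathbb T_1}\varphi_n\overline{\varphi_m}\,w\,|dz|=\delta_{mn}$, and $\Phi_n=\varphi_n/\kappa_n$ is monic. Szegő functions: $D(z)=\exp\left(\frac1{4\pi}\int_0^{2\pi}\log w(e^{i\theta})\frac{e^{i\theta}+z}{e^{i\theta}-z}\,d\theta\right)$ for $|z|\ne1$; $D_{\rm i}$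 is its restriction to $|z|<1$ and $D_{\rm e}$ its restriction to $|z|>1$. Both extend holomorphically across $\mathbb T_1$ (same notation for all continuations). Put $\rho=\inf\{0<s<1: D_{\rm e}\text{ is (extends) holomorphic in }|z|>s\}<1$ and $\tau=1/D_{\rm i}(0)=\exp\left(-\frac1{4\pi}\int_0^{2\pi}\log w(e^{i\theta})\,d\theta\right)>0$. Dominant poles: a pole $a$ of $f$, $|a|<1$, is dominant if for any other singularity $b$ of $f$, either $|a|>|b|$, or $|a|=|b|$ and then $b$ is also a pole whose multiplicity does not exceed that of $a$. In the present setting the dominant poles of $D_{\rm e}$ are exactly the poles on $\mathbb T_\rho$ having the maximal multiplicity, $m$, among $a_1,\dots,a_u$. The estimate in (ii) is understood for those $n$ for which the binomial coefficient $\binom n{m-1}$ is nonzero.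
   Formalization: In (i) the bound on h_n is false uniformly in z; it is proved with C depending on a compact K in |z|>ρ' containing z. For m≥2 the factor ε^{-(m-1)} is kept only if K contains no a_k; otherwise it is the correct ε^{-m}. Here n≥1. *)

(* Defs.v *)
From HB Require Import structures.
From mathcomp Require Import all_boot all_order all_algebra.
From mathcomp Require Import complex.
From mathcomp Require Import all_classical all_reals all_analysis.

Set Implicit Arguments.
Unset Strict Implicit.
Unset Printing Implicit Defensive.

Import Order.TTheory GRing.Theory Num.Theory.
Import numFieldNormedType.Exports.
Import ComplexField.Normc.

Local Open Scope classical_set_scope.
Local Open Scope ring_scope.
Local Open Scope complex_scope.

(* Topological notions on R[i] are found by the library on R[i]^o, i.e. R[i] as
   a normed space over itself. The library norm `|z| takes its values in R[i]; normc z is the same modulus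
   as an element of R. *)

Section Complex.
Variable R : realType.
Local Notation C := R[i].
Local Notation Re := (@complex.Re R).
Local Notation Im := (@complex.Im R).

Definition cexp (z : C) : C :=
  (expR (Re z) * cos (Im z)) +i* (expR (Re z) * sin (Im z)).

Definition cis (t : R) : C := cos t +i* sin t.

(* Principal argument, in ]-pi, pi] for z != 0. *)
Definition carg (z : C) : R :=
  if 0 <= Im z then acos (Re z / normc z) else - acos (Re z / normc z).

Definition cint (s t : R) (f : R -> C) : C :=
  (\int[lebesgue_measure]_(x in `[s, t]) Re (f x)) +i*
  (\int[lebesgue_measure]_(x in `[s, t]) Im (f x)).

(* Integral with respect to arc length |dz| on the unit circle. *)
Definition arcint (f : C -> C) : C := cint 0 (2 * pi) (fun t => f (cis t)).

(* [derivable] over the base field R[i] is complex differentiability; on an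
   open set A this is holomorphy. *)
Definition holomorphic_on (A : set C) (f : C -> C) : Prop :=
  forall z : C, A z -> derivable (f : C^o -> C^o) z 1.

Definition circle (s : R) : set C := [set z | normc z = s].
Definition disk (s : R) : set C := [set z | normc z < s].
Definition exterior (s : R) : set C := [set z | s < normc z].

(* Only the values of w on the unit circle matter. *)
Definition analytic_weight (w : C -> R) : Prop :=
  (forall z, circle 1 z -> 0 < w z) /\
  exists (U : set C) (W : C -> C),
    [/\ open (U : set C^o), circle 1 `<=` U, holomorphic_on U W,
        (forall z, U z -> W z != 0) &
        (forall z, circle 1 z -> W z = (w z)%:C)].

Definition orthonormal_polys (w : C -> R) (phi : nat -> {poly C}) : Prop :=
  (forall n, size (phi n) = n.+1 /\ 0 < lead_coef (phi n)) /\
  (forall m n,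
    arcint (fun z => (phi n).[z] * conjc (phi m).[z] * (w z)%:C) = (m == n)%:R).

Definition monic_poly (phi : nat -> {poly C}) (n : nat) : {poly C} :=
  (lead_coef (phi n))^-1 *: phi n.

(* Meaningful off the unit circle: its restriction to the disk is D_i, its
   restriction to the exterior is D_e. *)
Definition szego (w : C -> R) (z : C) : C :=
  cexp (((4 * pi)^-1)%:C *
        cint 0 (2 * pi)
          (fun t => (ln (w (cis t)))%:C * ((cis t + z) / (cis t - z)))).

Definition szego_tau (w : C -> R) : C := (szego w 0)^-1.

Definition szego_rho (w : C -> R) : R :=
  inf [set s : R | 0 < s < 1 /\
    exists g : C -> C, holomorphic_on (exterior s) g /\
      (forall z, exterior 1 z -> g z = szego w z)].

(* The value of f at the pole itself is irrelevant. *)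
Definition pole (f : C -> C) (a : C) (m : nat) : Prop :=
  (0 < m)%N /\
  exists (U : set C) (g : C -> C),
    [/\ open (U : set C^o), U a, holomorphic_on U g, g a != 0 &
        forall z, U z -> z != a -> f z = g z / (z - a) ^+ m].

Definition singularity (f : C -> C) (b : C) : Prop :=
  ~ exists U : set C, [/\ open (U : set C^o), U b & holomorphic_on U f].

(* f is a total function, of which only the values on A are meaningful; A is
   meant to be the exterior of a circle, so that singularities outside A have
   smaller modulus than any point of A. *)
Definition dominant_pole (A : set C) (f : C -> C) (a : C) : Prop :=
  exists m, [/\ A a, normc a < 1, pole f a m &
    forall b, A b -> b != a -> singularity f b ->
      normc b < normc a \/
      (normc a = normc b /\ exists2 p, pole f b p & (p <= m)%N)].

(* lim_(z -> a) f z * (z - a)^m *)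
Definition pole_coef (f : C -> C) (m : nat) (a : C) : C :=
  lim ((f z * (z - a) ^+ m : C^o) @[z --> (a : C^o)^']).

(* closed_field_poly_normal factors p as
   lead_coef p *: \prod_(z <- s) ('X - z%:P). *)
Definition nb_zeros (p : {poly C}) (K : set C) : nat :=
  count (fun z => z \in K) (sval (closed_field_poly_normal p)).

End Complex.

(* Main.v *)
(* On the unit circle w = 1 / (D_e G), where G (Gi below), the reflection of D_e, continues 1 /
   D_i across the circle. By orthogonality the Laurent coefficients of Phi_n w of index 0, ...,
   n - 1 vanish, that is, Phi_n w = z^n A + B with A holomorphic inside a circle slightly
   larger than T_1 and B holomorphic outside a slightly smaller one. Cauchy's formula expresses
   A through B and B through A, and each passage gains a geometric factor, so that G A is 1 /
   tau up to an error of order r^(2n), and Phi_n / G (z) is, up to an even smaller error, 1 /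
   tau times the Cauchy integral of t^n F(t) over a circle of radius s, rho < s < 1, where F =
   D_e / G. Writing F on |z| > rho' as its polar parts at the a_k plus a remainder holomorphic
   across T_rho and evaluating each Cauchy integral explicitly gives (i) and (ii). For (iii),
   if l zeros of Phi_n lie in K, the approximation (ii) divided by their polynomial and
   integrated over a circle contradicts the residue at a_1. *)

Require Import Defs.
From HB Require Import structures.
From mathcomp Require Import all_boot all_order all_algebra.
From mathcomp Require Import complex.
From mathcomp Require Import all_classical all_reals all_analysis.
From mathcomp Require Import ring lra.

Set Implicit Arguments.
Unset Strict Implicit.
Unset Printing Implicit Defensive.

Import Order.TTheory GRing.Theory Num.Theory.
Import numFieldNormedType.Exports.
Import ComplexField.Normc.

Local Open Scope classical_set_scope.
Local Open Scope ring_scope.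
Local Open Scope complex_scope.

(** * Complex modulus, continuity and derivatives *)

Section ComplexBasics.
Variable R : realType.
Local Notation C := R[i].
Local Notation Re := (@complex.Re R).
Local Notation Im := (@complex.Im R).
Implicit Types (f g : C -> C) (z t a b : C) (e d s : R).

Lemma norm_normc (z : C) : `|z| = (normc z)%:C.
Proof. by rewrite normc_def; case: z. Qed.

Lemma normc_ge0 z : 0 <= normc z.
Proof. by case: z => x y; apply: sqrtr_ge0. Qed.

Lemma normc_eq0 z : (normc z == 0) = (z == 0).
Proof.
by apply/eqP/eqP => [/eq0_normc//|->]; rewrite normc0.
Qed.

Lemma normc_gt0 z : (0 < normc z) = (z != 0).
Proof. by rewrite lt_def normc_ge0 andbT normc_eq0. Qed.

Lemma normcB z t : normc (z - t) = normc (t - z).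
Proof. by rewrite -normcN opprB. Qed.

Lemma ler_normcB z t : normc (z - t) <= normc z + normc t.
Proof. by rewrite -(normcN t) le_normcD. Qed.

Lemma ler_dist_normc z t : normc z - normc t <= normc (z - t).
Proof. by rewrite lerBlDr -{1}(subrK t z) le_normcD. Qed.

Lemma normcX z n : normc (z ^+ n) = normc z ^+ n.
Proof. by elim: n => [|n IH]; rewrite ?normc1// !exprS normcM IH. Qed.

Lemma normc_real (x : R) : normc x%:C = `|x|.
Proof. by rewrite /= expr0n addr0 sqrtr_sqr. Qed.

Lemma normc_nat n : normc (n%:R : C) = n%:R.
Proof. by rewrite -(rmorph_nat (real_complex R)) normc_real ger0_norm. Qed.

Lemma normc_conj z : normc (conjc z) = normc z.
Proof. by case: z => x y /=; rewrite sqrrN. Qed.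

Lemma normc_i : normc ('i%C : C) = 1.
Proof. by rewrite /= expr0n expr1n add0r sqrtr1. Qed.

Lemma ler_Re z : `|Re z| <= normc z.
Proof. by case: z => x y /=; rewrite -sqrtr_sqr ler_wsqrtr// lerDl sqr_ge0. Qed.

Lemma ler_Im z : `|Im z| <= normc z.
Proof. by case: z => x y /=; rewrite -sqrtr_sqr ler_wsqrtr// lerDr sqr_ge0. Qed.

Lemma normc_ReIm z : normc z <= `|Re z| + `|Im z|.
Proof.
rewrite {1}(complexE z); apply: le_trans (le_normcD _ _) _.
by rewrite normcM !normc_real normc_i mul1r.
Qed.

Lemma normc_sqr z : normc z ^+ 2 = Re z ^+ 2 + Im z ^+ 2.
Proof. by case: z => x y /=; rewrite sqr_sqrtr// addr_ge0// sqr_ge0. Qed.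

Lemma mulcJ z : z * conjc z = (normc z ^+ 2)%:C.
Proof. by rewrite -sqr_normc norm_normc rmorphXn. Qed.

Lemma ler_sum_normc (I : Type) (r : seq I) (P : pred I) (F : I -> C) :
  normc (\sum_(i <- r | P i) F i) <= \sum_(i <- r | P i) normc (F i).
Proof.
elim/big_rec2: _ => [|i x y _ IH]; first by rewrite normc0.
by apply: le_trans (le_normcD _ _) _; rewrite lerD2l.
Qed.

Lemma nbhs_normc (z : C) (P : set C) :
  nbhs (z : C^o) P <-> exists2 e : R, 0 < e & forall t, normc (t - z) < e -> P t.
Proof.
split.
  move=> /nbhs_ballP[e e0 H].
  have eE : e = (Re e)%:C.
    by rewrite RRe_real// gtr0_real.
  exists (Re e); first by rewrite -ltcR -eE.
  move=> t tz; apply: H; rewrite -ball_normE /ball_/=.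
  by rewrite distrC norm_normc eE ltcR.
move=> [e e0 H]; apply/nbhs_ballP; exists e%:C; first by rewrite /= ltcR.
by move=> t; rewrite -ball_normE /ball_/= distrC norm_normc ltcR => /H.
Qed.

Definition ccont f z := forall e, 0 < e ->
  exists2 d, 0 < d & forall t, normc (t - z) < d -> normc (f t - f z) < e.

Lemma ccontP f z : ccont f z <-> {for z, continuous (f : C^o -> C^o)}.
Proof.
split=> [H|H].
  move=> P /= /nbhs_normc[e e0 He].
  have [d d0 Hd] := H _ e0.
  by apply/nbhs_normc; exists d => // t /Hd /He.
move=> e e0.
have /H/nbhs_normc[d d0 Hd] : nbhs (f z : C^o) [set t | normc (t - f z) < e].
  by apply/nbhs_normc; exists e.
by exists d.
Qed.

Lemma ccont_cst (c : C) z : ccont (fun=> c) z.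
Proof. by move=> e e0; exists 1 => // t _; rewrite subrr normc0. Qed.

Lemma ccont_id z : ccont id z.
Proof. by move=> e e0; exists e. Qed.

Lemma ccontD f g z : ccont f z -> ccont g z -> ccont (fun t => f t + g t) z.
Proof. by move=> /ccontP hf /ccontP hg; apply/ccontP; exact: (cvgD hf hg). Qed.

Lemma ccontN f z : ccont f z -> ccont (fun t => - f t) z.
Proof. by move=> /ccontP hf; apply/ccontP; exact: (cvgN hf). Qed.

Lemma ccontB f g z : ccont f z -> ccont g z -> ccont (fun t => f t - g t) z.
Proof. by move=> hf hg; apply: ccontD => //; apply: ccontN. Qed.

Lemma ccontM f g z : ccont f z -> ccont g z -> ccont (fun t => f t * g t) z.
Proof. by move=> /ccontP hf /ccontP hg; apply/ccontP; exact: (cvgM hf hg). Qed.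

Lemma ccontV f z : f z != 0 -> ccont f z -> ccont (fun t => (f t)^-1) z.
Proof. by move=> fz /ccontP hf; apply/ccontP; exact: (cvgV fz hf). Qed.

Lemma ccontX f n z : ccont f z -> ccont (fun t => f t ^+ n) z.
Proof.
move=> hf; elim: n => [|n IH]; first exact: ccont_cst.
under eq_fun do rewrite exprS; exact: ccontM.
Qed.

Lemma ccont_sum (I : Type) (r : seq I) (F : I -> C -> C) z :
  (forall i, ccont (F i) z) -> ccont (fun t => \sum_(i <- r) F i t) z.
Proof.
move=> hF; elim: r => [|i r IH].
  by under eq_fun do rewrite big_nil; apply: ccont_cst.
by under eq_fun do rewrite big_cons; apply: ccontD.
Qed.

Lemma ccont_conj z : ccont (@conjc R) z.
Proof.
by move=> e e0; exists e => // t; rewrite -rmorphB normc_conj.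
Qed.

Lemma ccont_comp f g z : ccont f z -> ccont g (f z) -> ccont (fun t => g (f t)) z.
Proof.
move=> hf hg e /hg[d /hf[d' d'0 H'] H]; exists d' => // t /H' /H //.
Qed.

Lemma ccont_near f g z d : 0 < d ->
  (forall t, normc (t - z) < d -> f t = g t) -> ccont f z -> ccont g z.
Proof.
move=> d0 fg hf e /hf[d' d'0 H]; exists (Num.min d d'); first by rewrite lt_min d0.
move=> t; rewrite lt_min => /andP[/fg <- /H]; by rewrite -(fg z) // subrr normc0.
Qed.

Lemma ccont_horner (p : {poly C}) z : ccont (horner p) z.
Proof.
elim/poly_ind: p => [|p c IH].
  by rewrite (_ : horner 0 = cst 0); [apply: ccont_cst|apply/funext => t; rewrite horner0].
rewrite (_ : horner _ = fun t => p.[t] * t + c); last by apply/funext => t; rewrite hornerMXaddC.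
by apply: ccontD; [apply: ccontM => //; apply: ccont_id|apply: ccont_cst].
Qed.

(* Caratheodory's form of complex differentiability. *)
Definition cdiff f z := exists2 q, ccont q z & forall t, f t = f z + (t - z) * q t.

Lemma cdiffP f z : cdiff f z <-> derivable (f : C^o -> C^o) z 1.
Proof.
split.
  move=> [q hq H]; apply/cvg_ex; exists (q z) => P /nbhs_normc[e /hq[d d0 Hd] He].
  apply/nbhs_normc; exists d => // h; rewrite subr0 => hd h0; apply: He => /=.
  rewrite (H (h *: 1 + z)) addrAC subrr add0r addrK /GRing.scale /= mulr1.
  by rewrite mulrA mulVf// mul1r; apply: Hd; rewrite addrK.
move=> hd; have /cvg_ex[/= l Hl] := hd.
exists (fun t => if t == z then l else (f t - f z) / (t - z)); last first.
  move=> t; case: eqP => [->|/eqP tz]; first by rewrite subrr mul0r addr0.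
  by rewrite mulrC divfK ?subr_eq0// addrC subrK.
move=> e e0.
have /Hl : nbhs (l : C^o) [set t | normc (t - l) < e].
  by apply/nbhs_normc; exists e.
move=> /nbhs_normc[d d0 Hd]; exists d => // t td.
rewrite eqxx; case: eqP => [_|/eqP tz]; first by rewrite subrr normc0.
have := Hd (t - z); rewrite subr0 => /(_ td) /=.
rewrite subr_eq0 => /(_ tz); rewrite /GRing.scale/= mulr1 subrK.
by rewrite mulrC.
Qed.

Lemma cdiff_cont f z : cdiff f z -> ccont f z.
Proof.
move=> [q hq H].
apply: (@ccont_near (fun t => f z + (t - z) * q t) f z 1) => //.
apply: ccontD; first exact: ccont_cst.
by apply: ccontM => //; apply: ccontB; [apply: ccont_id|apply: ccont_cst].
Qed.

Lemma cdiff_cst (c : C) z : cdiff (fun=> c) z.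
Proof. by exists (fun=> 0) => [|t]; [exact: ccont_cst|rewrite mulr0 addr0]. Qed.

Lemma cdiff_id z : cdiff id z.
Proof. by exists (fun=> 1) => [|t]; [exact: ccont_cst|rewrite mulr1 addrC subrK]. Qed.

Lemma cdiffD f g z : cdiff f z -> cdiff g z -> cdiff (fun t => f t + g t) z.
Proof.
move=> [p hp Hp] [q hq Hq]; exists (fun t => p t + q t); first exact: ccontD.
by move=> t; rewrite Hp Hq; ring.
Qed.

Lemma cdiffN f z : cdiff f z -> cdiff (fun t => - f t) z.
Proof.
move=> [p hp Hp]; exists (fun t => - p t); first exact: ccontN.
by move=> t; rewrite Hp; ring.
Qed.

Lemma cdiffB f g z : cdiff f z -> cdiff g z -> cdiff (fun t => f t - g t) z.
Proof. by move=> hf hg; apply: cdiffD => //; apply: cdiffN. Qed.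

Lemma cdiffM f g z : cdiff f z -> cdiff g z -> cdiff (fun t => f t * g t) z.
Proof.
move=> [p hp Hp] hg; have [q hq Hq] := hg.
exists (fun t => p t * g t + f z * q t).
  apply: ccontD; apply: ccontM => //; [exact: cdiff_cont|exact: ccont_cst].
by move=> t; rewrite Hp Hq; ring.
Qed.

Lemma cdiff_near f g z d : 0 < d ->
  (forall t, normc (t - z) < d -> f t = g t) -> cdiff f z -> cdiff g z.
Proof.
move=> d0 fg [q hq Hq].
exists (fun t => if normc (t - z) < d then q t else (g t - g z) / (t - z)).
  apply: (@ccont_near q _ z d) => // t -> //.
move=> t; case: ifPn => [td|]; first by rewrite -(fg t)// -(fg z) ?subrr ?normc0.
rewrite -leNgt => td; rewrite mulrC divfK; first by rewrite addrC subrK.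
by rewrite -normc_gt0; apply: lt_le_trans td.
Qed.

Lemma cdiffV f z : f z != 0 -> cdiff f z -> cdiff (fun t => (f t)^-1) z.
Proof.
move=> fz hf; have [q hq Hq] := hf.
have [d d0 Hd] : exists2 d, 0 < d & forall t, normc (t - z) < d -> f t != 0.
  have [|d d0 H] := cdiff_cont hf (e := normc (f z)); first by rewrite normc_gt0.
  exists d => // t /H; apply: contraTneq => ->.
  by rewrite sub0r normcN ltxx.
apply: (@cdiff_near (fun t => (f z)^-1 + (t - z) * (- q t / (f t * f z))) _ z d d0).
  move=> t /Hd ft; have := Hq t => e.
  by apply: (mulfI ft); rewrite mulrDr divff//; field: e; rewrite ft fz.
apply: cdiffD; first exact: cdiff_cst.
exists (fun t => (- q t / (f t * f z))); last by move=> t; rewrite subrr mul0r add0r.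
apply: ccontM; first exact: ccontN.
apply: ccontV; first by rewrite mulf_neq0.
by apply: ccontM; [exact: cdiff_cont|exact: ccont_cst].
Qed.

Lemma cdiffX f n z : cdiff f z -> cdiff (fun t => f t ^+ n) z.
Proof.
move=> hf; elim: n => [|n IH]; first exact: cdiff_cst.
under eq_fun do rewrite exprS; exact: cdiffM.
Qed.

Lemma cdiff_horner (p : {poly C}) z : cdiff (horner p) z.
Proof.
elim/poly_ind: p => [|p c IH].
  by rewrite (_ : horner 0 = cst 0); [apply: cdiff_cst|apply/funext => t; rewrite horner0].
rewrite (_ : horner _ = fun t => p.[t] * t + c); last by apply/funext => t; rewrite hornerMXaddC.
by apply: cdiffD; [apply: cdiffM => //; apply: cdiff_id|apply: cdiff_cst].
Qed.

Lemma cdiff_sum (I : Type) (r : seq I) (F : I -> C -> C) z :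
  (forall i, cdiff (F i) z) -> cdiff (fun t => \sum_(i <- r) F i t) z.
Proof.
move=> hF; elim: r => [|i r IH].
  by under eq_fun do rewrite big_nil; apply: cdiff_cst.
by under eq_fun do rewrite big_cons; apply: cdiffD.
Qed.

Lemma cdiff_comp f g z : cdiff f z -> cdiff g (f z) -> cdiff (fun t => g (f t)) z.
Proof.
move=> hf [q hq Hq]; have [p hp Hp] := hf.
exists (fun t => p t * q (f t)).
  by apply: ccontM => //; apply: ccont_comp => //; apply: cdiff_cont.
by move=> t; rewrite Hq (Hp t) [f z + _]addrC addrK mulrA.
Qed.

Lemma cdiff_reflect f z : cdiff f (conjc z) -> cdiff (fun t => conjc (f (conjc t))) z.
Proof.
move=> [q hq Hq]; exists (fun t => conjc (q (conjc t))).
  apply: ccont_comp (ccont_conj _).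
  by apply: ccont_comp => //; apply: ccont_conj.
by move=> t; rewrite Hq rmorphD rmorphM rmorphB /= !conjcK.
Qed.

End ComplexBasics.

Arguments normc {R} x : simpl never.
Arguments conjc {R} x : simpl never.
Arguments cint {R} s t f : simpl never.

(** * Contour integrals and Goursat's theorem *)

Section ComplexIntegral.
Variable R : realType.
Local Notation C := R[i].
Local Notation Re := (@complex.Re R).
Local Notation Im := (@complex.Im R).
Implicit Types (f g : R -> C) (x y s t e d : R).


Definition rcont f x := forall e, 0 < e ->
  exists2 d, 0 < d & forall y, `|y - x| < d -> normc (f y - f x) < e.

Lemma rcont_continuous f x : rcont f x -> {for x, continuous (f : R -> C^o)}.
Proof.
move=> H P /= /nbhs_normc[e /H[d d0 Hd] He].
apply/nbhs_ballP; exists d => // t; rewrite -ball_normE /ball_/= distrC => /Hd.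
exact: He.
Qed.

Lemma rcont_Re f x : rcont f x -> {for x, continuous (fun t => Re (f t))}.
Proof.
move=> H P /= /nbhs_ballP[e /= /H[d d0 Hd] He].
apply/nbhs_ballP; exists d => // t; rewrite -ball_normE /ball_/= distrC => /Hd h.
apply: He; rewrite -ball_normE /ball_/= distrC -raddfB.
by apply: le_lt_trans h; apply: ler_Re.
Qed.

Lemma rcont_Im f x : rcont f x -> {for x, continuous (fun t => Im (f t))}.
Proof.
move=> H P /= /nbhs_ballP[e /= /H[d d0 Hd] He].
apply/nbhs_ballP; exists d => // t; rewrite -ball_normE /ball_/= distrC => /Hd h.
apply: He; rewrite -ball_normE /ball_/= distrC -raddfB.
by apply: le_lt_trans h; apply: ler_Im.
Qed.

Lemma rcontD f g x : rcont f x -> rcont g x -> rcont (fun t => f t + g t) x.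
Proof.
move=> hf hg e e0; have e2 : 0 < e / 2 by rewrite divr_gt0.
have [d d0 Hd] := hf _ e2; have [d' d'0 Hd'] := hg _ e2.
exists (Num.min d d'); first by rewrite lt_min d0.
move=> y; rewrite lt_min => /andP[/Hd h1 /Hd' h2].
rewrite opprD addrACA (splitr e); apply: le_lt_trans (le_normcD _ _) _.
exact: ltrD.
Qed.

Lemma rcontZ (c : C) f x : rcont f x -> rcont (fun t => c * f t) x.
Proof.
move=> hf e e0; have c1 : 0 < normc c + 1 by rewrite ltr_wpDl ?normc_ge0.
have [|d d0 Hd] := hf (e / (normc c + 1)); first by rewrite divr_gt0.
exists d => // y /Hd; rewrite -mulrBr normcM ltr_pdivlMr// => h.
apply: le_lt_trans h; rewrite mulrC ler_wpM2l ?normc_ge0//.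
by rewrite lerDl.
Qed.

Lemma rcontB f g x : rcont f x -> rcont g x -> rcont (fun t => f t - g t) x.
Proof.
move=> hf /(rcontZ (-1)) hg.
rewrite (_ : (fun t => _) = fun t => f t + -1 * g t); last first.
  by apply/funext => t; rewrite mulN1r.
exact: rcontD.
Qed.

Lemma rcont_comp (h : C -> C) f x : rcont f x -> ccont h (f x) -> rcont (fun t => h (f t)) x.
Proof. by move=> hf hh e /hh[d /hf[d' d'0 H'] H]; exists d' => // y /H' /H. Qed.

Lemma itvcc_continuous (h : R -> R) s t :
  (forall x, s <= x <= t -> {for x, continuous h}) -> {within `[s, t], continuous h}.
Proof.
move=> H; apply: continuous_in_subspaceT => x.
by rewrite inE /= in_itv /= => /H.
Qed.

Definition itv_rcont f s t := forall x, s <= x <= t -> rcont f x.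

Lemma integrable_Re f s t : itv_rcont f s t ->
  lebesgue_measure.-integrable `[s, t] (EFin \o (fun x => Re (f x))).
Proof.
move=> H; apply: continuous_compact_integrable; first exact: segment_compact.
by apply: itvcc_continuous => x /H /rcont_Re.
Qed.

Lemma integrable_Im f s t : itv_rcont f s t ->
  lebesgue_measure.-integrable `[s, t] (EFin \o (fun x => Im (f x))).
Proof.
move=> H; apply: continuous_compact_integrable; first exact: segment_compact.
by apply: itvcc_continuous => x /H /rcont_Im.
Qed.

Lemma eq_cint f g s t : (forall x, s <= x <= t -> f x = g x) ->
  cint s t f = cint s t g.
Proof.
move=> fg; congr (_ +i* _); apply: eq_Rintegral => x;
  by rewrite inE/= in_itv/= => /fg ->.
Qed.

Lemma cintD f g s t : itv_rcont f s t -> itv_rcont g s t ->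
  cint s t (fun x => f x + g x) = cint s t f + cint s t g.
Proof.
move=> hf hg; rewrite /cint.
rewrite -[RHS]/(Complex (_ + _) (_ + _)) -!RintegralD//; 
  do ?[exact: integrable_Re|exact: integrable_Im].
by congr (_ +i* _); apply: eq_Rintegral => x _; rewrite raddfD.
Qed.

Lemma cintZ (c : C) f s t : itv_rcont f s t ->
  cint s t (fun x => c * f x) = c * cint s t f.
Proof.
move=> hf; case: c => a b; rewrite /cint.
rewrite -[RHS]/(Complex (_ * _ - _ * _) (_ * _ + _ * _)).
have iR := integrable_Re hf; have iI := integrable_Im hf.
have iM (k : R) (h : R -> R) : lebesgue_measure.-integrable `[s, t] (EFin \o h) ->
    lebesgue_measure.-integrable `[s, t] (EFin \o (fun x => k * h x)).
  move=> hi. exact: (@integrableZl _ _ _ lebesgue_measure _ (measurable_itv `[s, t]) k (EFin \o h) hi).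
rewrite -!RintegralZl// -RintegralB// -?RintegralD//; do ?exact: iM.
by congr (_ +i* _); apply: eq_Rintegral => x _; case: (f x).
Qed.

Lemma cintB f g s t : itv_rcont f s t -> itv_rcont g s t ->
  cint s t (fun x => f x - g x) = cint s t f - cint s t g.
Proof.
move=> hf hg; rewrite -mulN1r -cintZ// -cintD//.
  by apply: eq_cint => x _; rewrite mulN1r.
by move=> x /hg; apply: rcontZ.
Qed.

Lemma cint_cst (c : C) s t : s <= t -> cint s t (fun=> c) = (t - s)%:C * c.
Proof.
move=> st; case: c => a b; rewrite /cint /=.
rewrite !Rintegral_cst//= ?lebesgue_measure_itv/=; try by rewrite ltry.
rewrite lte_fin; case: ltgtP st => // [st _|-> _].
  by rewrite -EFinB /=; congr (_ +i* _); ring.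
by rewrite /= subrr; congr (_ +i* _); ring.
Qed.

Lemma cint_bound f s t (M : R) : s <= t -> itv_rcont f s t ->
  (forall x, s <= x <= t -> normc (f x) <= M) ->
  normc (cint s t f) <= 2 * M * (t - s).
Proof.
move=> st hf hM.
have key (h : R -> R) : lebesgue_measure.-integrable `[s, t] (EFin \o h) ->
    (forall x, s <= x <= t -> `|h x| <= M) ->
    `| \int[lebesgue_measure]_(x in `[s, t]) h x | <= M * (t - s).
  move=> ih hh; apply: le_trans (le_normr_Rintegral _ ih) _ => //.
  apply: (@le_trans _ _ (\int[lebesgue_measure]_(x in `[s, t]) M)).
    apply: le_Rintegral => //; first exact: (integrable_norm ih).
      apply: continuous_compact_integrable; first exact: segment_compact.
      by apply: itvcc_continuous => x _; exact: cst_continuous.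
  rewrite Rintegral_cst//= lebesgue_measure_itv/= lte_fin.
  by case: ltgtP st => // -> _; rewrite subrr.
apply: le_trans (normc_ReIm _) _; rewrite -mulrA mulr_natl mulr2n.
apply: lerD; apply: key; do ?[exact: integrable_Re|exact: integrable_Im].
  by move=> x /hM; apply: le_trans; apply: ler_Re.
by move=> x /hM; apply: le_trans; apply: ler_Im.
Qed.

Lemma cint_split f s u t : s <= u -> u <= t -> itv_rcont f s t ->
  cint s t f = cint s u f + cint u t f.
Proof.
move=> su ut hf.
have key (h : R -> R) : lebesgue_measure.-integrable `[s, t] (EFin \o h) ->
    \int[lebesgue_measure]_(x in `[s, t]) h x =
    \int[lebesgue_measure]_(x in `[s, u]) h x + \int[lebesgue_measure]_(x in `[u, t]) h x.
  move=> ih; have := @Rintegral_itvB R h (BLeft s) (BRight t) u ih.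
  rewrite !bnd_simp => /(_ su ut) /eqP; rewrite subr_eq addrC => /eqP ->.
  congr (_ + _); apply: Rintegral_itv_obnd_cbnd.
  apply: integrableS ih => //.
  by move=> x /=; rewrite !in_itv/= => /andP[h1 ->]; rewrite (le_trans su (ltW h1)).
rewrite /cint -[RHS]/(Complex (_ + _) (_ + _)) -!key//;
  do ?[exact: integrable_Re|exact: integrable_Im].
Qed.

Lemma nested_intervals (a b : nat -> R) :
  (forall n, a n <= a n.+1) -> (forall n, b n.+1 <= b n) -> (forall n, a n <= b n) ->
  exists c, forall n, a n <= c <= b n.
Proof.
move=> ha hb hab.
have ma n m : (n <= m)%N -> a n <= a m.
  by move=> /subnK <-; elim: (m - n)%N => // k IH; apply: le_trans IH _; apply: ha.
have mb n m : (n <= m)%N -> b m <= b n.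
  by move=> /subnK <-; elim: (m - n)%N => // k IH; apply: le_trans IH; apply: hb.
have ab n m : a n <= b m.
  case: (leqP n m) => [/ma h|/ltnW /mb h]; first exact: le_trans h (hab m).
  exact: le_trans (hab n) h.
exists (sup (range a)) => n; apply/andP; split.
  apply: ub_le_sup; last by exists n.
  by exists (b 0) => _ [m _ <-].
by apply: ge_sup; [exists (a 0), 0|move=> _ [m _ <-]].
Qed.

Definition rect_int (g : C -> C) x1 x2 y1 y2 : C :=
  cint x1 x2 (fun x => g (x +i* y1)) - cint x1 x2 (fun x => g (x +i* y2))
  + 'i%C * (cint y1 y2 (fun y => g (x2 +i* y)) - cint y1 y2 (fun y => g (x1 +i* y))).

Definition rect_cont (g : C -> C) x1 x2 y1 y2 :=
  forall x y, x1 <= x <= x2 -> y1 <= y <= y2 -> ccont g (x +i* y).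

Lemma rcont_hor (g : C -> C) x y : ccont g (x +i* y) -> rcont (fun x => g (x +i* y)) x.
Proof.
move=> hg; apply: (@rcont_comp g (fun x => x +i* y)) => // e e0.
exists e => // z; rewrite -[X in normc X]/(Complex (z - x) (y - y)) subrr.
by rewrite -[_ +i* 0]/(_%:C) normc_real.
Qed.

Lemma rcont_ver (g : C -> C) x y : ccont g (x +i* y) -> rcont (fun y => g (x +i* y)) y.
Proof.
move=> hg; apply: (@rcont_comp g (fun y => x +i* y)) => // e e0.
exists e => // z h; rewrite -[X in normc X]/(Complex (x - x) (z - y)) subrr.
by apply: le_lt_trans (normc_ReIm _) _; rewrite /= normr0 add0r.
Qed.


Lemma rect_cont_sub (g : C -> C) x1 x2 y1 y2 x1' x2' y1' y2' :
  x1 <= x1' -> x2' <= x2 -> y1 <= y1' -> y2' <= y2 ->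
  rect_cont g x1 x2 y1 y2 -> rect_cont g x1' x2' y1' y2'.
Proof.
move=> h1 h2 h3 h4 hg x y /andP[h5 h6] /andP[h7 h8].
by apply: hg; rewrite ?(le_trans h1 h5) ?(le_trans h6 h2) ?(le_trans h3 h7) ?(le_trans h8 h4).
Qed.

Lemma rect_int_splitx (g : C -> C) x1 u x2 y1 y2 : x1 <= u -> u <= x2 -> y1 <= y2 ->
  rect_cont g x1 x2 y1 y2 ->
  rect_int g x1 x2 y1 y2 = rect_int g x1 u y1 y2 + rect_int g u x2 y1 y2.
Proof.
move=> xu ux yy hg; rewrite /rect_int.
rewrite (@cint_split _ x1 u x2)//; last first.
  by move=> x hx; apply: rcont_hor; apply: hg => //; rewrite lexx yy.
rewrite (@cint_split (fun x => g (x +i* y2)) x1 u x2)//; last first.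
  by move=> x hx; apply: rcont_hor; apply: hg => //; rewrite lexx yy.
ring.
Qed.

Lemma rect_int_splity (g : C -> C) x1 x2 y1 u y2 : y1 <= u -> u <= y2 -> x1 <= x2 ->
  rect_cont g x1 x2 y1 y2 ->
  rect_int g x1 x2 y1 y2 = rect_int g x1 x2 y1 u + rect_int g x1 x2 u y2.
Proof.
move=> yu uy xx hg; rewrite /rect_int.
rewrite (@cint_split _ y1 u y2)//; last first.
  by move=> x hx; apply: rcont_ver; apply: hg => //; rewrite lexx xx.
rewrite (@cint_split (fun y => g (x1 +i* y)) y1 u y2)//; last first.
  by move=> x hx; apply: rcont_ver; apply: hg => //; rewrite lexx xx.
ring.
Qed.

Lemma rect_int_bound (g : C -> C) x1 x2 y1 y2 (M : R) : x1 <= x2 -> y1 <= y2 ->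
  rect_cont g x1 x2 y1 y2 ->
  (forall x y, x1 <= x <= x2 -> y1 <= y <= y2 -> normc (g (x +i* y)) <= M) ->
  normc (rect_int g x1 x2 y1 y2) <= 4 * M * ((x2 - x1) + (y2 - y1)).
Proof.
move=> xx yy hg hM; rewrite /rect_int.
have hx y : y1 <= y <= y2 -> normc (cint x1 x2 (fun x => g (x +i* y))) <= 2 * M * (x2 - x1).
  move=> hy; apply: cint_bound => // x hx; last exact: hM.
  by apply: rcont_hor; apply: hg.
have hy x : x1 <= x <= x2 -> normc (cint y1 y2 (fun y => g (x +i* y))) <= 2 * M * (y2 - y1).
  move=> hx'; apply: cint_bound => // y hy; last exact: hM.
  by apply: rcont_ver; apply: hg.
have i1 := normc_i R.
apply: le_trans (le_normcD _ _) _.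
rewrite normcM i1 mul1r.
have e1 : normc (cint x1 x2 (fun x => g (x +i* y1)) - cint x1 x2 (fun x => g (x +i* y2)))
  <= 4 * M * (x2 - x1).
  apply: le_trans (ler_normcB _ _) _.
  rewrite (_ : 4 * M * (x2 - x1) = 2 * M * (x2 - x1) + 2 * M * (x2 - x1)); last by ring.
  by apply: lerD; apply: hx; rewrite ?lexx ?yy.
have e2 : normc (cint y1 y2 (fun y => g (x2 +i* y)) - cint y1 y2 (fun y => g (x1 +i* y)))
  <= 4 * M * (y2 - y1).
  apply: le_trans (ler_normcB _ _) _.
  rewrite (_ : 4 * M * (y2 - y1) = 2 * M * (y2 - y1) + 2 * M * (y2 - y1)); last by ring.
  by apply: lerD; apply: hy; rewrite ?lexx ?xx.
by rewrite mulrDr; apply: lerD.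
Qed.

Lemma rect_intD (g h : C -> C) x1 x2 y1 y2 : x1 <= x2 -> y1 <= y2 ->
  rect_cont g x1 x2 y1 y2 -> rect_cont h x1 x2 y1 y2 ->
  rect_int (fun z => g z + h z) x1 x2 y1 y2 = rect_int g x1 x2 y1 y2 + rect_int h x1 x2 y1 y2.
Proof.
move=> xx yy hg hh; rewrite /rect_int !cintD; try ring;
  by move=> t ht; (apply: rcont_hor || apply: rcont_ver); (apply: hg || apply: hh) => //; rewrite lexx ?xx ?yy.
Qed.

Lemma rect_int_affine (a b : C) x1 x2 y1 y2 : x1 <= x2 -> y1 <= y2 ->
  rect_int (fun z => a + b * z) x1 x2 y1 y2 = 0.
Proof.
move=> xx yy.
have hc z : ccont (fun z => a + b * z) z.
  by apply: ccontD; [exact: ccont_cst|apply: ccontM; [exact: ccont_cst|exact: ccont_id]].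
have hh y s t : itv_rcont (fun x => a + b * (x +i* y)) s t.
  by move=> x _; exact: (@rcont_hor (fun z => a + b * z) x y (hc _)).
have hv x s t : itv_rcont (fun y => a + b * (x +i* y)) s t.
  by move=> y _; exact: (@rcont_ver (fun z => a + b * z) x y (hc _)).
rewrite /rect_int -!cintB//.
rewrite (@eq_cint _ (fun=> b * (0 +i* (y1 - y2))) x1 x2); last first.
  move=> x _; rewrite opprD addrACA subrr add0r -mulrBr; congr (_ * _).
  by apply/eqP; rewrite eq_complex /= subrr !eqxx.
rewrite (@eq_cint _ (fun=> b * ((x2 - x1) +i* 0)) y1 y2); last first.
  move=> x _; rewrite opprD addrACA subrr add0r -mulrBr; congr (_ * _).
  by apply/eqP; rewrite eq_complex /= subrr !eqxx.
rewrite !cint_cst//.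
have -> : 0 +i* (y1 - y2) = - ('i%C * (y2 - y1)%:C) :> C.
  by apply/eqP; rewrite eq_complex /=; apply/andP; split; apply/eqP; ring.
rewrite complexr0; ring.
Qed.

Lemma rect_int_quarters (g : C -> C) x w y h (M : R) : 0 <= w -> 0 <= h ->
  rect_cont g x (x + w + w) y (y + h + h) ->
  normc (rect_int g x (x + w) y (y + h)) <= M ->
  normc (rect_int g (x + w) (x + w + w) y (y + h)) <= M ->
  normc (rect_int g x (x + w) (y + h) (y + h + h)) <= M ->
  normc (rect_int g (x + w) (x + w + w) (y + h) (y + h + h)) <= M ->
  normc (rect_int g x (x + w + w) y (y + h + h)) <= 4 * M.
Proof.
move=> w0 h0 hc q1 q2 q3 q4.
have xw z : z <= z + w by rewrite lerDl.
have yh z : z <= z + h by rewrite lerDl.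
have xw2 z : z <= z + w + w by apply: le_trans (xw z) (xw _).
have yh2 z : z <= z + h + h by apply: le_trans (yh z) (yh _).
rewrite (@rect_int_splitx g x (x + w))//.
rewrite (@rect_int_splity g x (x + w) y (y + h))//; last first.
  by apply: rect_cont_sub hc.
rewrite (@rect_int_splity g (x + w) (x + w + w) y (y + h))//; last first.
  by apply: rect_cont_sub hc.
rewrite (_ : 4 * M = (M + M) + (M + M)); last by ring.
by apply: le_trans (le_normcD _ _) _; apply: lerD;
   apply: le_trans (le_normcD _ _) _; apply: lerD.
Qed.

(* Quadrisection: a rectangle on which the boundary integral is large relative to
   its area contains a quarter with the same property, and nested quarters shrink to
   a point where the function is nearly affine. *)
Lemma goursat (g : C -> C) x1 x2 y1 y2 : x1 < x2 -> y1 < y2 ->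
  (forall x y, x1 <= x <= x2 -> y1 <= y <= y2 -> cdiff g (x +i* y)) ->
  rect_int g x1 x2 y1 y2 = 0.
Proof.
move=> lx ly hg; apply/eqP; rewrite -normc_eq0; apply/negPn/negP => nz.
have N0 : 0 < normc (rect_int g x1 x2 y1 y2) by rewrite lt_def nz normc_ge0.
set W := x2 - x1; set H := y2 - y1.
have W0 : 0 < W by rewrite subr_gt0.
have H0 : 0 < H by rewrite subr_gt0.
pose eps := normc (rect_int g x1 x2 y1 y2) / (2 * W * H).
have eps0 : 0 < eps by rewrite divr_gt0// !mulr_gt0.
have hgc : rect_cont g x1 x2 y1 y2 by move=> x y hx hy; apply: cdiff_cont; apply: hg.
pose bad (w h : R) (p : R * R) :=
  eps * (w * h) < normc (rect_int g p.1 (p.1 + w) p.2 (p.2 + h)).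
pose inR (w h : R) (p : R * R) := [&& x1 <= p.1, p.1 + w <= x2, y1 <= p.2 & p.2 + h <= y2].
have step w h p : 0 < w -> 0 < h -> inR w h p -> bad w h p ->
  exists q, [/\ bad (w / 2) (h / 2) q, p.1 <= q.1, q.1 + w / 2 <= p.1 + w,
    p.2 <= q.2 & q.2 + h / 2 <= p.2 + h].
  case: p => x y w0 h0 /and4P[/= h1 h2 h3 h4] hb.
  apply: contrapT => hn; move: hb; rewrite /bad /= ltNge => /negP; apply.
  have ew : w = w / 2 + w / 2 by rewrite -splitr.
  have eh : h = h / 2 + h / 2 by rewrite -splitr.
  have w2 : 0 <= w / 2 by rewrite divr_ge0 ?ltW.
  have h2' : 0 <= h / 2 by rewrite divr_ge0 ?ltW.
  move: (w / 2) (h / 2) w2 h2' ew eh hn => a b a0 b0 ew eh hn.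
  have good q : x <= q.1 -> q.1 + a <= x + w -> y <= q.2 -> q.2 + b <= y + h ->
      normc (rect_int g q.1 (q.1 + a) q.2 (q.2 + b)) <= eps * (a * b).
    move=> a1 a2 a3 a4; rewrite leNgt; apply/negP => hb'; apply: hn.
    by exists q.
  have hc : rect_cont g x (x + w) y (y + h) by apply: rect_cont_sub hgc.
  have xa : x <= x + a by rewrite lerDl.
  have yb : y <= y + b by rewrite lerDl.
  have xaw : x + a <= x + w by rewrite ew addrA lerDl.
  have ybw : y + b <= y + h by rewrite eh addrA lerDl.
  have ewx : x + a + a = x + w by rewrite ew addrA.
  have ehy : y + b + b = y + h by rewrite eh addrA.
  have -> : eps * (w * h) = 4 * (eps * (a * b)) by rewrite ew eh; ring.
  rewrite -ewx -ehy; apply: rect_int_quarters => //; rewrite ?ewx ?ehy//.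
  - exact: (good (x, y)).
  - by rewrite -ewx; apply: (good (x + a, y)); rewrite //= ewx.
  - by rewrite -ehy; apply: (good (x, y + b)); rewrite //= ehy.
  - by rewrite -ewx -ehy; apply: (good (x + a, y + b)); rewrite //= ?ewx ?ehy.
pose wn n := W / 2 ^+ n; pose hn n := H / 2 ^+ n.
have wn0 n : 0 < wn n by rewrite divr_gt0// exprn_gt0.
have hn0 n : 0 < hn n by rewrite divr_gt0// exprn_gt0.
have wS n : wn n.+1 = wn n / 2 by rewrite /wn exprSr invfM mulrA.
have hS n : hn n.+1 = hn n / 2 by rewrite /hn exprSr invfM mulrA.
have step' n p : exists q, inR (wn n) (hn n) p -> bad (wn n) (hn n) p ->
   [/\ bad (wn n.+1) (hn n.+1) q, p.1 <= q.1, q.1 + wn n.+1 <= p.1 + wn n,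
    p.2 <= q.2 & q.2 + hn n.+1 <= p.2 + hn n].
  case: (pselect (inR (wn n) (hn n) p /\ bad (wn n) (hn n) p)) => [[i b]|nn].
    by have [q Hq] := step _ _ _ (wn0 n) (hn0 n) i b; exists q => _ _; rewrite wS hS.
  by exists p => i b; case: nn.
have [nx hnx] := choice (fun np => step' np.1 np.2).
pose P := fix P n := if n is m.+1 then nx (m, P m) else (x1, y1).
have PR n : inR (wn n) (hn n) (P n) /\ bad (wn n) (hn n) (P n).
  elim: n => [|n [i b]].
    have e1 : x1 + (x2 - x1) = x2 by ring.
    have e2 : y1 + (y2 - y1) = y2 by ring.
    have epsE : eps * (W * H) = normc (rect_int g x1 x2 y1 y2) / 2.
      by rewrite /eps; field; rewrite !gt_eqF.
    rewrite /inR /bad /wn /hn expr0 !divr1 epsE /= /W /H e1 e2 !lexx; split => //.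
    by rewrite ltr_pdivrMr// ltr_pMr// ltrDl.
  have [b' h1 h2 h3 h4] := hnx (n, P n) i b.
  split => //; move: i => /and4P[i1 i2 i3 i4]; apply/and4P; split.
  - exact: le_trans h1.
  - exact: le_trans h2 _.
  - exact: le_trans h3.
  - exact: le_trans h4 _.
have PS n : [/\ (P n).1 <= (P n.+1).1, (P n.+1).1 + wn n.+1 <= (P n).1 + wn n,
    (P n).2 <= (P n.+1).2 & (P n.+1).2 + hn n.+1 <= (P n).2 + hn n].
  by have [i b] := PR n; have [] := hnx (n, P n) i b.
have [|||cx hcx] := @nested_intervals (fun n => (P n).1) (fun n => (P n).1 + wn n).
- by move=> n; case: (PS n).
- by move=> n; case: (PS n).
- by move=> n; rewrite lerDl ltW.
have [|||cy hcy] := @nested_intervals (fun n => (P n).2) (fun n => (P n).2 + hn n).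
- by move=> n; case: (PS n).
- by move=> n; case: (PS n).
- by move=> n; rewrite lerDl ltW.
have [q hq Hq] : cdiff g (cx +i* cy).
  have := hcx 0%N; have := hcy 0%N; rewrite /wn /hn expr0 !divr1 /= /W /H => h1 h2.
  by apply: hg; lra.
set z0 := cx +i* cy in hq Hq.
pose eta := eps * (W * H) / (4 * (W + H) ^+ 2).
have WH : 0 < W + H by rewrite addr_gt0.
have eta0 : 0 < eta.
  by rewrite /eta; apply: divr_gt0; apply: mulr_gt0 => //; [apply: mulr_gt0|apply: exprn_gt0].
have [d d0 Hd] := hq _ eta0.
have [n Hn] : exists n, (W + H) / 2 ^+ n < d.
  have := archi_boundP (ltW (divr_gt0 WH d0)); set n := Num.bound _ => hn'; exists n.
  rewrite ltr_pdivrMr ?exprn_gt0// -ltr_pdivrMl// mulrC; apply: lt_trans hn' _.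
  by rewrite -natrX ltr_nat ltn_expl.
have [i b] := PR n.
move: (P n) (hcx n) (hcy n) i b => [x y] /= /andP[cx1 cx2] /andP[cy1 cy2] i.
rewrite /bad /= ltNge => /negP; apply.
pose rem z := (z - z0) * (q z - q z0).
have remE z : rem z = g z + ((z0 * q z0 - g z0) + (- q z0) * z).
  by rewrite (Hq z) /rem; ring.
have affc z : ccont (fun z => (z0 * q z0 - g z0) + (- q z0) * z) z.
  by apply: ccontD; [exact: ccont_cst|apply: ccontM; [exact: ccont_cst|exact: ccont_id]].
have gc : rect_cont g x (x + wn n) y (y + hn n).
  by move: i => /and4P[/= h1 h2 h3 h4]; apply: rect_cont_sub hgc.
have xw : x <= x + wn n by rewrite lerDl ltW.
have yh : y <= y + hn n by rewrite lerDl ltW.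
have -> : rect_int g x (x + wn n) y (y + hn n) = rect_int rem x (x + wn n) y (y + hn n).
  by rewrite (funext remE) rect_intD// rect_int_affine// addr0.
have wh : wn n + hn n = (W + H) / 2 ^+ n by rewrite mulrDl.
apply: le_trans (@rect_int_bound _ _ _ _ _ (eta * (wn n + hn n)) xw yh _ _) _.
- move=> s t hs ht; rewrite (funext remE).
  by apply: ccontD; [exact: gc|exact: affc].
- move=> s t /andP[s1 s2] /andP[t1 t2].
  have hz : normc (s +i* t - z0) <= wn n + hn n.
    apply: le_trans (normc_ReIm _) _; apply: lerD => /=; rewrite ler_norml; lra.
  rewrite /rem normcM mulrC; apply: ler_pM; rewrite ?normc_ge0//.
  by apply: ltW; apply: Hd; apply: le_lt_trans hz _; rewrite wh.
rewrite (_ : x + wn n - x = wn n); last by ring.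
rewrite (_ : y + hn n - y = hn n); last by ring.
rewrite wh /eta /wn /hn le_eqVlt; apply/orP; left; apply/eqP; field.
by rewrite expf_neq0 //= gt_eqF.
Qed.

End ComplexIntegral.

(** * Exponential and argument *)

Section Exponential.
Variable R : realType.
Local Notation C := R[i].
Local Notation Re := (@complex.Re R).
Local Notation Im := (@complex.Im R).
Implicit Types (x y s t e d : R) (z w : C).

Lemma is_derive_eps (f : R -> R) (a l : R) : is_derive a 1 f l -> forall e, 0 < e ->
  exists2 d, 0 < d & forall h, `|h| < d -> `|f (h + a) - f a - l * h| <= e * `|h|.
Proof.
move=> [fd fl] e e0.
have H : h^-1 *: (f (h *: 1 + a) - f a) @[h --> (0:R)^'] --> l by rewrite -fl; exact: fd.
have /H/nbhs_ballP[d /= d0 Hd] : nbhs l (ball l e) by exact: nbhsx_ballx.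
exists d => // h hd; have [->|h0] := eqVneq h 0.
  by rewrite add0r subrr mulr0 subrr normr0 mulr0.
have : ball 0 d h by rewrite -ball_normE /ball_/= sub0r normrN.
move=> /Hd /(_ h0) /=; rewrite -ball_normE /ball_ /= /GRing.scale /= mulr1 => h1.
rewrite -normrN -[X in `|X| <= _](@mulfVK _ h)// normrM ler_wpM2r// ltW//.
suff -> : - (f (h + a) - f a - l * h) / h = l - h^-1 * (f (h + a) - f a) by [].
by field.
Qed.

Lemma cexp0 : cexp (0 : C) = 1.
Proof. by rewrite /cexp /= expR0 cos0 sin0 mulr1 mulr0. Qed.

Lemma cexpD z w : cexp (z + w) = cexp z * cexp w.
Proof.
case: z => a b; case: w => c d; rewrite /cexp /= expRD cosD sinD.
by apply/eqP; rewrite eq_complex /=; apply/andP; split; apply/eqP; ring.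
Qed.

Lemma normc_cexp z : normc (cexp z) = expR (Re z).
Proof.
rewrite /normc /cexp /= !exprMn -mulrDr cos2Dsin2 mulr1 sqrtr_sqr.
by rewrite ger0_norm// expR_ge0.
Qed.

Lemma cexp_neq0 z : cexp z != 0.
Proof. by rewrite -normc_gt0 normc_cexp expR_gt0. Qed.

Lemma cexp_periodic z : cexp (z + (0 +i* (2 * pi))) = cexp z.
Proof.
rewrite cexpD (_ : cexp (0 +i* _) = 1) ?mulr1//.
by rewrite /cexp /= expR0 [2 * pi]mulrC mulr_natr cos2pi sin2pi mulr1 mulr0.
Qed.

Lemma cexp_sub1 e : 0 < e -> exists2 d, 0 < d &
  forall z, normc z < d -> normc (cexp z - 1 - z) <= e * normc z.
Proof.
move=> e0; pose k := Num.min 1 (e / 12).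
have k0 : 0 < k by rewrite lt_min ltr01 divr_gt0.
have k1 : k <= 1 by rewrite ge_min lexx.
have ke : k <= e / 12 by rewrite ge_min lexx orbT.
clearbody k.
have [d1 d10 H1] := is_derive_eps (is_derive_expR (0:R)) k0.
have [d2 d20 H2] := is_derive_eps (is_derive_cos (0:R)) k0.
have [d3 d30 H3] := is_derive_eps (is_derive_sin (0:R)) k0.
exists (Num.min (Num.min d1 d2) (Num.min d3 k)); first by rewrite !lt_min d10 d20 d30 k0.
move=> [x y]; rewrite !lt_min => /andP[/andP[n1 n2] /andP[n3 n4]].
set n := normc _ in n1 n2 n3 n4 *.
have hx : `|x| <= n by exact: (ler_Re (x +i* y)).
have hy : `|y| <= n by exact: (ler_Im (x +i* y)).
have n0 : 0 <= n by apply: le_trans hx.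
have := H1 x (le_lt_trans hx n1); rewrite addr0 expR0 mul1r => b1.
have := H2 y (le_lt_trans hy n2); rewrite addr0 sin0 oppr0 mul0r subr0 cos0 => b2.
have := H3 y (le_lt_trans hy n3); rewrite addr0 sin0 cos0 mul1r subr0 => b3.
apply: le_trans (normc_ReIm _) _; rewrite /cexp /= subr0.
have kn (a : R) : `|a| <= n -> k * `|a| <= k * n by move=> ?; rewrite ler_wpM2l// ltW.
have {}b1 := le_trans b1 (kn _ hx).
have {}b2 := le_trans b2 (kn _ hy).
have {}b3 := le_trans b3 (kn _ hy).
have nk : n <= k by apply: ltW.
have ex : `|expR x - 1| <= 2 * k.
  have : `|expR x - 1| <= `|expR x - 1 - x| + `|x| by rewrite -{1}(subrK x (expR x - 1)) ler_normD.
  move=> h; apply: le_trans h _; rewrite mulrDl mul1r; apply: lerD; last exact: le_trans hx nk.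
  by apply: le_trans b1 _; rewrite ler_piMr ?(ltW k0)// (le_trans nk).
have ex3 : `|expR x| <= 3.
  rewrite -(subrK 1 (expR x)); apply: le_trans (ler_normD _ _) _; rewrite normr1.
  by move: ex k1; clear; lra.
have r1 : `|expR x * cos y - 1 - x| <= 4 * (k * n).
  rewrite (_ : _ - x = (expR x - 1 - x) + expR x * (cos y - 1)); last by ring.
  apply: le_trans (ler_normD _ _) _; rewrite normrM.
  rewrite (_ : 4 * (k * n) = k * n + 3 * (k * n)); last by ring.
  by apply: lerD => //; apply: ler_pM.
have r2 : `|expR x * sin y - y| <= 5 * (k * n).
  rewrite (_ : _ - y = expR x * (sin y - y) + (expR x - 1) * y); last by ring.
  apply: le_trans (ler_normD _ _) _; rewrite !normrM.
  rewrite (_ : 5 * (k * n) = 3 * (k * n) + (2 * k) * n); last by ring.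
  by apply: lerD; apply: ler_pM.
apply: le_trans (lerD r1 r2) _.
rewrite -mulrDl; apply: (@le_trans _ _ (9 * (e / 12 * n))).
  by rewrite (_ : 4 + 5 = 9) ?ler_wpM2l ?ler_wpM2r//; ring.
rewrite mulrA ler_wpM2r//; move: e0; clear; lra.
Qed.

Lemma cdiff_cexp z : cdiff (@cexp R) z.
Proof.
pose q (h : C) := if h == 0 then 1 else (cexp h - 1) / h.
have qc : ccont q 0.
  move=> e e0; have [|d d0 H] := @cexp_sub1 (e / 2); first by rewrite divr_gt0.
  exists d => // h; rewrite subr0 => /H; rewrite /q eqxx.
  case: eqP => [_|/eqP h0 hh]; first by rewrite subrr normc0.
  have -> : (cexp h - 1) / h - 1 = (cexp h - 1 - h) / h by field.
  rewrite normcM normcV ltr_pdivrMr ?normc_gt0//.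
  apply: le_lt_trans hh _; rewrite ltr_pM2r ?normc_gt0//.
  by rewrite ltr_pdivrMr// ltr_pMr// ltr1n.
exists (fun w => cexp z * q (w - z)).
  apply: ccontM; first exact: ccont_cst.
  apply: (@ccont_comp _ (fun w => w - z)); last by rewrite subrr.
  by apply: ccontB; [exact: ccont_id|exact: ccont_cst].
move=> t; rewrite /q; case: eqP => [/eqP|/eqP tz].
  by rewrite subr_eq0 => /eqP ->; rewrite subrr mul0r addr0.
rewrite mulrCA [(t - z) * _]mulrC divfK// mulrBr mulr1 -cexpD.
by rewrite [z + _]addrC subrK addrC subrK.
Qed.

Lemma cisE t : cis t = cexp (0 +i* t) :> C.
Proof. by rewrite /cexp /= expR0 !mul1r. Qed.

Lemma normc_cis t : normc (cis t : C) = 1.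
Proof. by rewrite cisE normc_cexp expR0. Qed.

Lemma cisD s t : cis (s + t) = cis s * cis t :> C.
Proof.
rewrite !cisE -cexpD; congr cexp.
by apply/eqP; rewrite eq_complex /= addr0 !eqxx.
Qed.

Lemma cis0 : cis 0 = 1 :> C.
Proof. by rewrite /cis cos0 sin0. Qed.

Lemma cisX t n : cis t ^+ n = cis (n%:R * t) :> C.
Proof.
elim: n => [|n IH]; first by rewrite expr0 mul0r cis0.
by rewrite exprS IH -cisD -addn1 natrD mulrDl mul1r addrC.
Qed.

Lemma cis_2pi_nat n : cis (2 * pi * n%:R) = 1 :> C.
Proof.
rewrite [_ * n%:R]mulrC -cisX (_ : cis (2 * pi) = 1) ?expr1n//.
by rewrite cisE -(add0r (0 +i* _)) cexp_periodic cexp0.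
Qed.

Lemma rcont_cis s x : rcont (fun t => s%:C * cis t : C) x.
Proof.
apply: rcontZ; rewrite (_ : cis (R:=R) = fun t => cexp (0 +i* t)); last first.
  by apply/funext => t; rewrite cisE.
by apply: (@rcont_ver _ (@cexp R) 0); apply: cdiff_cont; apply: cdiff_cexp.
Qed.

Lemma cargP z : z != 0 -> z = (normc z)%:C * cis (carg z).
Proof.
move=> z0; have n0 : 0 < normc z by rewrite normc_gt0.
have q1 : -1 <= Re z / normc z <= 1.
  by rewrite -ler_norml normrM normfV (ger0_norm (ltW n0)) ler_pdivrMr// mul1r ler_Re.
have c1 : cos (carg z) = Re z / normc z.
  by rewrite /carg; case: ifP => _; rewrite ?cosN acosK ?in_itv.
have s1 : sin (carg z) = Im z / normc z.
  have e2 : 1 - (Re z / normc z) ^+ 2 = (Im z / normc z) ^+ 2.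
    rewrite !expr_div_n -[in LHS](@divff _ (normc z ^+ 2)) ?expf_neq0 ?gt_eqF//.
    by rewrite -mulrBl {1}normc_sqr addrC addKr.
  rewrite /carg; case: (leP 0 (Im z)) => hI.
    by rewrite sin_acos// e2 sqrtr_sqr ger0_norm// divr_ge0// ltW.
  rewrite sinN sin_acos// e2 sqrtr_sqr ltr0_norm ?opprK//.
  by rewrite pmulr_llt0 // invr_gt0.
rewrite /cis c1 s1; apply/eqP; rewrite eq_complex /= !mul0r subr0 addr0.
by apply/andP; split; apply/eqP; field; rewrite gt_eqF.
Qed.

Lemma carg_itv z : z != 0 -> - pi <= carg z <= pi.
Proof.
move=> z0; have n0 : 0 < normc z by rewrite normc_gt0.
have q1 : -1 <= Re z / normc z <= 1.
  by rewrite -ler_norml normrM normfV (ger0_norm (ltW n0)) ler_pdivrMr// mul1r ler_Re.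
have a0 := acos_ge0 q1; have a1 := acos_lepi q1; have := @pi_ge0 R => p0.
by rewrite /carg; case: ifP => _; apply/andP; split; move: a0 a1 p0; clear; lra.
Qed.

Lemma circle_compact s : compact (circle s : set C^o).
Proof.
have [s0|s0] := ltP s 0.
  rewrite (_ : circle s = set0); first exact: compact0.
  by apply/seteqP; split => // z; rewrite /circle /= => zs; have := normc_ge0 z; rewrite zs leNgt s0.
rewrite (_ : circle s = (fun t => s%:C * cis t : C^o) @` `[- pi, pi]).
  apply: continuous_compact; last exact: segment_compact.
  by apply: continuous_subspaceT => x; apply: rcont_continuous; exact: rcont_cis.
apply/seteqP; split => z; rewrite /circle /=.
  move=> zs; have [z0|z0] := eqVneq z 0.
    exists 0; first by rewrite in_itv/= oppr_le0 pi_ge0.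
    by rewrite -zs z0 normc0 mul0r.
  exists (carg z); first by rewrite in_itv/= carg_itv.
  by rewrite -zs -cargP.
move=> [t _ <-]; by rewrite normcM normc_cis normc_real mulr1 ger0_norm.
Qed.

Lemma heine (K : set C) (f : C -> C) : compact (K : set C^o) ->
  (forall z, K z -> ccont f z) -> forall e, 0 < e ->
  exists2 d, 0 < d & forall z t : C, K z -> normc (t - z) < d -> normc (f t - f z) < e.
Proof.
move=> cK hf e e0.
have [] : \forall d \near (0:R)^'+,
    K `<=` (fun z => forall t : C, normc (t - z) < d -> normc (f t - f z) < e).
  apply: ((compact_near_coveringP (K : set C^o)).1 cK R (0:R)^'+
    (fun d z => forall t : C, normc (t - z) < d -> normc (f t - f z) < e)).
  move=> z Kz; have [|d d0 Hd] := hf z Kz (e / 2); first by rewrite divr_gt0.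
  have d2 : 0 < d / 2 by rewrite divr_gt0.
  exists ([set z' | normc (z' - z) < d / 2], [set x | x < d / 2]); first split => /=.
  + by apply/nbhs_normc; exists (d / 2).
  + exact: nbhs_right_lt.
  + move=> [z' d'] /= [h1 h2] t h3.
    rewrite (splitr e) -(subrK (f z) (f t)) -addrA.
    apply: le_lt_trans (le_normcD _ _) _; apply: ltrD; last first.
      rewrite normcB; apply: Hd; apply: lt_trans h1 _.
      by rewrite ltr_pdivrMr// ltr_pMr// ltr1n.
    apply: Hd; rewrite -(subrK z' t) -addrA (splitr d).
    by apply: le_lt_trans (le_normcD _ _) _; apply: ltrD => //; apply: lt_trans h2.
move=> d /= d0 H; have d2 : 0 < d / 2 by rewrite divr_gt0.
exists (d / 2) => // z t Kz; apply: H => //=.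
by rewrite sub0r normrN ger0_norm ?ltW// ltr_pdivrMr// ltr_pMr// ltr1n.
Qed.

Lemma compact_normc_bounded (K : set C) (f : C -> C) : compact (K : set C^o) ->
  (forall z, K z -> ccont f z) -> exists2 M, 0 < M & forall z, K z -> normc (f z) <= M.
Proof.
move=> cK hf.
have [M [Mr H]] : \forall M \near +oo, K `<=` (fun z => normc (f z) <= M).
  apply: ((compact_near_coveringP (K : set C^o)).1 cK R +oo (fun M z => normc (f z) <= M)).
  move=> z Kz; have [d d0 Hd] := hf z Kz 1 ltr01.
  exists ([set z' | normc (z' - z) < d], [set x | normc (f z) + 1 <= x]); first split => /=.
  + by apply/nbhs_normc; exists d.
  + by apply: nbhs_pinfty_ge; rewrite num_real.
  + move=> [z' M] /= [/Hd h1 h2]; apply: le_trans h2.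
    rewrite -{1}(subrK (f z) (f z')) addrC; apply: le_trans (le_normcD _ _) _.
    by rewrite lerD2l ltW.
exists (Num.max M 0 + 1); first by rewrite ltr_wpDl// le_max lexx orbT.
by move=> z Kz; apply: H => //; rewrite ltr_pwDr// le_max lexx.
Qed.

End Exponential.

(** * Means over circles and Cauchy formulas *)

Section CircleMean.
Variable R : realType.
Local Notation C := R[i].
Local Notation Re := (@complex.Re R).
Local Notation Im := (@complex.Im R).
Implicit Types (s e d : R) (z t : C) (f g : C -> C) (L : seq R).

Definition cmean s f : C :=
  ((2 * pi)^-1)%:C * cint 0 (2 * pi) (fun x => f (s%:C * cis x)).

Definition ccont_circle s f := forall z, normc z = s -> ccont f z.

Lemma normc_polar s x : 0 <= s -> normc (s%:C * cis x : C) = s.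
Proof. by move=> s0; rewrite normcM normc_cis mulr1 normc_real ger0_norm. Qed.

Lemma twopi_gt0 : 0 < 2 * pi :> R.
Proof. by rewrite mulr_gt0// pi_gt0. Qed.

Lemma circle_rcont s f a b : 0 <= s -> ccont_circle s f ->
  itv_rcont (fun x => f (s%:C * cis x)) a b.
Proof.
move=> s0 hf x _; apply: rcont_comp; first exact: rcont_cis.
by apply: hf; rewrite normc_polar.
Qed.

Lemma eq_cmean s f g : 0 <= s -> (forall z, normc z = s -> f z = g z) ->
  cmean s f = cmean s g.
Proof.
by move=> s0 fg; congr (_ * _); apply: eq_cint => x _; apply: fg; rewrite normc_polar.
Qed.

Lemma cmeanD s f g : 0 <= s -> ccont_circle s f -> ccont_circle s g ->
  cmean s (fun z => f z + g z) = cmean s f + cmean s g.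
Proof.
by move=> s0 hf hg; rewrite /cmean -mulrDr -cintD//; apply: circle_rcont.
Qed.

Lemma cmeanZ s (c : C) f : 0 <= s -> ccont_circle s f ->
  cmean s (fun z => c * f z) = c * cmean s f.
Proof.
move=> s0 hf; rewrite /cmean mulrCA; congr (_ * _); rewrite -cintZ//.
exact: circle_rcont.
Qed.

Lemma cmeanB s f g : 0 <= s -> ccont_circle s f -> ccont_circle s g ->
  cmean s (fun z => f z - g z) = cmean s f - cmean s g.
Proof.
by move=> s0 hf hg; rewrite /cmean -mulrBr -cintB//; apply: circle_rcont.
Qed.

Lemma cmean_cst s (c : C) : cmean s (fun=> c) = c.
Proof.
rewrite /cmean cint_cst ?(ltW twopi_gt0)// subr0 mulrA -rmorphM mulVf ?mul1r//.
by rewrite gt_eqF// twopi_gt0.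
Qed.

Lemma cmean_sum (I : Type) (r : seq I) (F : I -> C -> C) s : 0 <= s ->
  (forall i, ccont_circle s (F i)) ->
  cmean s (fun z => \sum_(i <- r) F i z) = \sum_(i <- r) cmean s (F i).
Proof.
move=> s0 hF; elim: r => [|i r IH].
  by under eq_fun do rewrite big_nil; rewrite cmean_cst big_nil.
under eq_fun do rewrite big_cons; rewrite big_cons cmeanD ?IH// => z zs.
by apply: ccont_sum => j; apply: hF.
Qed.

Lemma cmean_bound s f (M : R) : 0 <= s -> ccont_circle s f ->
  (forall z, normc z = s -> normc (f z) <= M) -> normc (cmean s f) <= 2 * M.
Proof.
move=> s0 hf hM; have p0 := twopi_gt0.
rewrite /cmean normcM normc_real ger0_norm ?invr_ge0 ?(ltW p0)//.
rewrite mulrC ler_pdivrMr//.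
rewrite -[X in _ <= _ * X]subr0; apply: cint_bound; first exact: ltW.
  exact: circle_rcont.
by move=> x _; apply: hM; rewrite normc_polar.
Qed.

Lemma cmean0 f : cmean 0 f = f 0.
Proof.
rewrite -[RHS](cmean_cst 0); congr (_ * _); apply: eq_cint => x _.
by rewrite mul0r.
Qed.

Lemma cmean_continuous s f : 0 <= s -> ccont_circle s f -> forall e, 0 < e ->
  exists2 d, 0 < d & forall s', 0 <= s' -> `|s' - s| < d -> ccont_circle s' f ->
    normc (cmean s' f - cmean s f) <= e.
Proof.
move=> s0 hf e e0; have e2 : 0 < e / 2 by rewrite divr_gt0.
have [d d0 Hd] := heine (@circle_compact R s) hf e2.
exists d => // s' s'0 ss hf'; have p0 := twopi_gt0.
rewrite /cmean -mulrBr -cintB; try exact: circle_rcont.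
rewrite normcM normc_real ger0_norm ?invr_ge0 ?(ltW p0)//.
rewrite mulrC ler_pdivrMr//.
rewrite -[X in _ <= _ * X]subr0 (_ : e = 2 * (e / 2)); last by field.
apply: cint_bound; first exact: ltW.
  by move=> x hx; apply: rcontB; apply: circle_rcont hx.
move=> x _; apply: ltW; apply: Hd; first by rewrite /circle /= normc_polar.
by rewrite -mulrBl -rmorphB normcM normc_cis normc_real mulr1.
Qed.

Lemma cmean_eq_open s s' f : 0 < s -> s < s' ->
  (forall z, s <= normc z <= s' -> cdiff f z) -> cmean s f = cmean s' f.
Proof.
move=> s0 ss hf; have s'0 := lt_trans s0 ss; have p0 := twopi_gt0.
have lss : ln s < ln s' by rewrite ltr_ln.
have hg x y : ln s <= x <= ln s' -> cdiff (fun z => f (cexp z)) (x +i* y).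
  move=> /andP[h1 h2]; apply: cdiff_comp; first exact: cdiff_cexp.
  apply: hf; rewrite normc_cexp /=; apply/andP; split.
    by rewrite -(lnK s0) ler_expR.
  by rewrite -(lnK s'0) ler_expR.
have := goursat lss p0 (fun x y hx _ => hg x y hx).
rewrite /rect_int.
have -> : (fun x => f (cexp (x +i* (2 * pi)))) = (fun x => f (cexp (x +i* 0))).
  apply/funext => x; rewrite -(cexp_periodic (x +i* 0)); congr (f (cexp _)).
  by apply/eqP; rewrite eq_complex /= addr0 add0r !eqxx.
rewrite subrr add0r => /eqP; rewrite mulf_eq0.
have -> : ('i%C == 0 :> C) = false.
  by rewrite -normc_eq0 normc_i oner_eq0.
rewrite /= subr_eq0 => /eqP h.
have polar (a b : R) : 0 < a -> cexp (ln a +i* b) = a%:C * cis b.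
  move=> a0; rewrite /cexp /= (lnK a0); apply/eqP.
  by rewrite eq_complex /= !mul0r subr0 addr0 !eqxx.
rewrite /cmean; congr (_ * _).
transitivity (cint 0 (2 * pi) (fun y => f (cexp (ln s +i* y)))).
  by apply: eq_cint => x _; rewrite polar.
by rewrite -h; apply: eq_cint => x _; rewrite polar.
Qed.

(* The circle of radius s may degenerate to the centre, and finitely many
   exceptional radii are allowed at which f is only assumed continuous. *)
Lemma cmean_eq L s s' f : 0 <= s -> s <= s' ->
  (forall z, s <= normc z <= s' -> ccont f z) ->
  (forall z, s < normc z < s' -> normc z \notin L -> cdiff f z) ->
  cmean s f = cmean s' f.
Proof.
elim: L s s' => [|x L IH] s s' s0.
  rewrite le_eqVlt => /predU1P[->//|ss] hc hd.
  have s'0 : 0 <= s' by apply: le_trans (ltW ss).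
  have cs : ccont_circle s f by move=> z zs; apply: hc; rewrite zs lexx ltW.
  have cs' : ccont_circle s' f by move=> z zs; apply: hc; rewrite zs lexx ltW.
  apply/eqP; rewrite -subr_eq0 -normc_eq0; apply/negPn/negP => nz.
  have n0 : 0 < normc (cmean s f - cmean s' f) by rewrite lt_def nz normc_ge0.
  set n := normc _ in n0; have n3 : 0 < n / 3 by rewrite divr_gt0.
  have [d d0 Hd] := cmean_continuous s0 cs n3.
  have [d' d'0 Hd'] := cmean_continuous s'0 cs' n3.
  pose h := Num.min (Num.min (d / 2) (d' / 2)) ((s' - s) / 3).
  have h0 : 0 < h by rewrite !lt_min !divr_gt0// subr_gt0.
  have h1 : h < d.
    apply: (@le_lt_trans _ _ (d / 2)); first by rewrite !ge_min lexx.
    by rewrite ltr_pdivrMr// ltr_pMr// ltr1n.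
  have h2 : h < d'.
    apply: (@le_lt_trans _ _ (d' / 2)); first by rewrite !ge_min lexx orbT.
    by rewrite ltr_pdivrMr// ltr_pMr// ltr1n.
  have h3 : h <= (s' - s) / 3 by rewrite !ge_min lexx !orbT.
  clearbody h.
  have lss : s + h < s' - h by move: h0 h3 ss; clear; lra.
  have sh0 : 0 < s + h by rewrite ltr_wpDl.
  have E : cmean (s + h) f = cmean (s' - h) f.
    apply: cmean_eq_open => // z /andP[z1 z2]; apply: hd => //.
    by rewrite (lt_le_trans _ z1) ?ltrDl// (le_lt_trans z2)// ltrBlDr ltrDl.
  have g1 : normc (cmean (s + h) f - cmean s f) <= n / 3.
    apply: Hd; [exact: ltW|by rewrite addrAC subrr add0r ger0_norm ?ltW|].
    by move=> z zs; apply: hc; rewrite zs; apply/andP; split; move: h0 lss; clear; lra.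
  have g2 : normc (cmean (s' - h) f - cmean s' f) <= n / 3.
    apply: Hd'; [by apply: ltW; apply: lt_trans lss|by rewrite addrAC subrr add0r normrN ger0_norm ?ltW|].
    by move=> z zs; apply: hc; rewrite zs; apply/andP; split; move: h0 lss; clear; lra.
  have : n <= n / 3 + n / 3.
    rewrite {1}/n -(subrK (cmean (s + h) f) (cmean s f)) -addrA.
    apply: le_trans (le_normcD _ _) _; apply: lerD; first by rewrite normcB.
    by rewrite E.
  by move: n0; clear; lra.
move=> ss hc hd; case: (boolP (s < x < s')) => [/andP[sx xs]|nx].
  have x0 : 0 <= x by apply: le_trans (ltW sx).
  rewrite (IH s x)// ?ltW//; first last.
  - move=> z /andP[z1 z2] zL; apply: hd; first by rewrite z1 (lt_trans z2).
    by rewrite inE negb_or zL andbT lt_eqF.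
  - by move=> z /andP[z1 z2]; apply: hc; rewrite z1 (le_trans z2 (ltW xs)).
  apply: IH => //; first exact: ltW.
  - by move=> z /andP[z1 z2]; apply: hc; rewrite z2 (le_trans (ltW sx) z1).
  - move=> z /andP[z1 z2] zL; apply: hd; first by rewrite z2 (lt_trans sx).
    by rewrite inE negb_or zL andbT gt_eqF.
apply: IH => // z hz zL; apply: hd => //; rewrite inE negb_or zL andbT.
by apply: contraNneq nx => <-.
Qed.

Definition at_infty : set_system C :=
  [set P | exists S : R, forall z, S <= normc z -> P z].

Global Instance at_infty_filter : Filter at_infty.
Proof.
split=> [|P Q [S HS] [T HT]|P Q PQ [S HS]].
- by exists 0.
- by exists (Num.max S T) => z; rewrite ge_max => /andP[/HS ? /HT].
- by exists S => z /HS /PQ.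
Qed.

Definition ctends f (c : C) := f z @[z --> at_infty] --> (c : C^o).

Lemma ctendsP f c : ctends f c <->
  forall e, 0 < e -> exists S : R, forall z, S <= normc z -> normc (f z - c) < e.
Proof.
split=> [H e e0|H P /nbhs_normc[e /H[S HS] He]].
  have /H[S HS] : nbhs (c : C^o) [set t | normc (t - c) < e].
    by apply/nbhs_normc; exists e.
  by exists S.
by exists S => z /HS /He.
Qed.

Lemma ctends_cst c : ctends (fun=> c) c.
Proof. by apply/ctendsP => e e0; exists 0 => z _; rewrite subrr normc0. Qed.

Lemma ctendsD f g c c' : ctends f c -> ctends g c' -> ctends (fun z => f z + g z) (c + c').
Proof. by move=> hf hg; exact: (@cvgD _ C^o _ at_infty _ f g c c' hf hg). Qed.

Lemma ctendsM f g c c' : ctends f c -> ctends g c' -> ctends (fun z => f z * g z) (c * c').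
Proof. by move=> hf hg; exact: (cvgM hf hg). Qed.

Lemma ctendsV f c : c != 0 -> ctends f c -> ctends (fun z => (f z)^-1) c^-1.
Proof. by move=> c0 hf; exact: (cvgV c0 hf). Qed.

Lemma ctends_near f g c (S : R) : (forall z, S <= normc z -> f z = g z) ->
  ctends f c -> ctends g c.
Proof.
move=> fg /ctendsP H; apply/ctendsP => e /H[T HT].
by exists (Num.max S T) => z; rewrite ge_max => /andP[/fg <- /HT].
Qed.

Lemma ctends_inv : ctends (fun z => z^-1) 0.
Proof.
apply/ctendsP => e e0; exists (e^-1 + 1) => z hz.
have z0 : 0 < normc z by apply: lt_le_trans hz; rewrite ltr_wpDl// invr_ge0 ltW.
rewrite subr0 normcV -ltf_pV2 ?posrE ?invr_gt0// invrK.
by apply: lt_le_trans hz; rewrite ltrDl.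
Qed.

Lemma ctends_kernel z : ctends (fun t => t / (t - z)) 1.
Proof.
apply: (@ctends_near (fun t => (1 + - z * t^-1)^-1) _ _ (normc z + 1)).
  move=> t tz; have t0 : t != 0.
    by rewrite -normc_gt0; apply: lt_le_trans tz; rewrite ltr_wpDl ?normc_ge0.
  have tz0 : t - z != 0.
    rewrite subr_eq0; apply: contraTneq tz => ->.
    by rewrite -ltNge ltrDl.
  have -> : 1 + - z * t^-1 = (t - z) / t by field.
  by rewrite invf_div.
rewrite -[X in ctends _ X]invr1; apply: ctendsV; first exact: oner_neq0.
rewrite -[X in ctends _ X]addr0; apply: ctendsD; first exact: ctends_cst.
rewrite -[X in ctends _ X](mulr0 (- z)); apply: ctendsM; first exact: ctends_cst.
exact: ctends_inv.
Qed.

Lemma cmean_ext L s f c : 0 <= s -> (forall z, s <= normc z -> ccont f z) ->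
  (forall z, s < normc z -> normc z \notin L -> cdiff f z) ->
  ctends f c -> cmean s f = c.
Proof.
move=> s0 hc hd /ctendsP fc; apply/eqP; rewrite -subr_eq0 -normc_eq0.
apply/negPn/negP => nz.
have n0 : 0 < normc (cmean s f - c) by rewrite lt_def nz normc_ge0.
have [|S HS] := fc (normc (cmean s f - c) / 3); first by rewrite divr_gt0.
pose T := Num.max s S.
have sT : s <= T by rewrite le_max lexx.
have ST : S <= T by rewrite le_max lexx orbT.
have T0 := le_trans s0 sT.
have cT : ccont_circle T f by move=> z zT; apply: hc; rewrite zT.
have E : cmean s f = cmean T f.
  apply: (@cmean_eq L) => // z /andP[z1 z2]; [exact: hc|exact: hd].
have : normc (cmean s f - c) <= 2 * (normc (cmean s f - c) / 3).
  rewrite {1}E -{1}(cmean_cst T c) -cmeanB//; last by move=> z _; exact: ccont_cst.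
  apply: cmean_bound => //.
    by move=> z zT; apply: ccontB; [exact: cT|exact: ccont_cst].
  by move=> z zT; apply: ltW; apply: HS; rewrite zT.
by move: n0; clear; lra.
Qed.

Lemma sub_neq0 z t : normc z != normc t -> t - z != 0.
Proof. by rewrite subr_eq0; apply: contra => /eqP ->. Qed.

Lemma ccont_kernel z t : t != z -> ccont (fun t => t / (t - z)) t.
Proof.
move=> tz; apply: ccontM; first exact: ccont_id.
apply: ccontV; first by rewrite subr_eq0.
by apply: ccontB; [exact: ccont_id|exact: ccont_cst].
Qed.

Lemma cdiff_kernel z t : t != z -> cdiff (fun t => t / (t - z)) t.
Proof.
move=> tz; apply: cdiffM; first exact: cdiff_id.
apply: cdiffV; first by rewrite subr_eq0.
by apply: cdiffB; [exact: cdiff_id|exact: cdiff_cst].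
Qed.

Lemma normc_neq z t : normc t != normc z -> t != z.
Proof. by apply: contra => /eqP ->. Qed.

Lemma cmean_kernel_in s z : normc z < s -> cmean s (fun t => t / (t - z)) = 1.
Proof.
move=> zs; have s0 : 0 <= s by apply: le_trans (ltW zs); exact: normc_ge0.
apply: (@cmean_ext [::]) => //; last exact: ctends_kernel.
  by move=> t st; apply: ccont_kernel; apply: normc_neq; rewrite gt_eqF// (lt_le_trans zs).
by move=> t st _; apply: cdiff_kernel; apply: normc_neq; rewrite gt_eqF// (lt_trans zs).
Qed.

Lemma cmean_kernel_out s z : 0 <= s -> s < normc z -> cmean s (fun t => t / (t - z)) = 0.
Proof.
move=> s0 sz; rewrite -(@cmean_eq [::] 0 s) ?cmean0 ?mul0r//.
  by move=> t /andP[_ ts]; apply: ccont_kernel; apply: normc_neq; rewrite lt_eqF// (le_lt_trans ts).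
by move=> t /andP[_ ts] _; apply: cdiff_kernel; apply: normc_neq; rewrite lt_eqF// (lt_trans ts).
Qed.

Lemma cdiff_quot f z : cdiff f z -> exists q,
  [/\ forall t, f t = f z + (t - z) * q t, ccont q z,
      forall t, t != z -> ccont f t -> ccont q t &
      forall t, t != z -> cdiff f t -> cdiff q t].
Proof.
move=> [q hq Hq]; exists q.
have qE t u : t != z -> normc (u - t) < normc (t - z) -> (f u - f z) / (u - z) = q u.
  move=> tz ut; have uz : u - z != 0.
    rewrite subr_eq0; apply: contraTneq ut => ->.
    by rewrite normcB ltxx.
  by rewrite {1}Hq addrAC subrr add0r mulrC mulKf.
split => // t tz hf.
  apply: (@ccont_near _ (fun u => (f u - f z) / (u - z)) _ _ (normc (t - z))).
  - by rewrite normc_gt0 subr_eq0.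
  - by move=> u; apply: qE.
  apply: ccontM; first by apply: ccontB => //; exact: ccont_cst.
  apply: ccontV; first by rewrite subr_eq0.
  by apply: ccontB; [exact: ccont_id|exact: ccont_cst].
apply: (@cdiff_near _ (fun u => (f u - f z) / (u - z)) _ _ (normc (t - z))).
- by rewrite normc_gt0 subr_eq0.
- by move=> u; apply: qE.
apply: cdiffM; first by apply: cdiffB => //; exact: cdiff_cst.
apply: cdiffV; first by rewrite subr_eq0.
by apply: cdiffB; [exact: cdiff_id|exact: cdiff_cst].
Qed.

Lemma cauchy_split s f q z : 0 <= s -> normc z != s ->
  (forall t, f t = f z + (t - z) * q t) -> ccont_circle s q ->
  cmean s (fun t => f t * (t / (t - z))) =
    f z * cmean s (fun t => t / (t - z)) + cmean s (fun t => q t * t).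
Proof.
move=> s0 zs Hq hq.
have tz t : normc t = s -> t != z by move=> ts; apply: normc_neq; rewrite ts eq_sym.
rewrite -cmeanZ//; last by move=> t /tz; exact: ccont_kernel.
rewrite -cmeanD//; first last.
- by move=> t ts; apply: ccontM; [exact: hq|exact: ccont_id].
- by move=> t /tz h; apply: ccontM; [exact: ccont_cst|exact: ccont_kernel].
apply: eq_cmean => // t /tz h; rewrite {1}Hq; field.
by rewrite subr_eq0.
Qed.

Lemma cauchy_disk L f s z : normc z < s ->
  (forall t, normc t <= s -> ccont f t) ->
  (forall t, 0 < normc t < s -> normc t \notin L -> cdiff f t) ->
  (z != 0 -> cdiff f z) ->
  cmean s (fun t => f t * (t / (t - z))) = f z.
Proof.
move=> zs hc hd hz; have s0 : 0 <= s by apply: le_trans (ltW zs); exact: normc_ge0.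
have [z0|z0] := eqVneq z 0.
  rewrite z0 in zs *; rewrite normc0 in zs.
  transitivity (cmean s f).
    apply: eq_cmean => // t ts; rewrite subr0 divff ?mulr1//.
    by rewrite -normc_gt0 ts.
  rewrite -(@cmean_eq L 0 s) ?cmean0//.
  by move=> t /andP[_]; exact: hc.
have [q [Hq q1 q2 q3]] := cdiff_quot (hz z0).
have qc t : normc t <= s -> ccont q t.
  by move=> ts; have [->//|tz] := eqVneq t z; apply: q2 => //; exact: hc.
rewrite (cauchy_split s0 _ Hq); [|by rewrite lt_eqF|by move=> t ts; apply: qc; rewrite ts].
rewrite cmean_kernel_in// mulr1 -(@cmean_eq (normc z :: L) 0 s)//.
- by rewrite cmean0 mulr0 addr0.
- by move=> t /andP[_ ts]; apply: ccontM; [exact: qc|exact: ccont_id].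
- move=> t hts; rewrite inE negb_or => /andP[/normc_neq tz tL].
  by apply: cdiffM; [apply: q3 => //; exact: hd|exact: cdiff_id].
Qed.

Lemma cauchy_ext L f s z : 0 <= s -> s < normc z ->
  (forall t, s <= normc t -> ccont f t) ->
  (forall t, s < normc t -> normc t \notin L -> cdiff f t) ->
  cdiff f z -> ctends f 0 ->
  cmean s (fun t => f t * (t / (t - z))) = - f z.
Proof.
move=> s0 zs hc hd hz h0.
have [q [Hq q1 q2 q3]] := cdiff_quot hz.
have qc t : s <= normc t -> ccont q t.
  by move=> ts; have [->//|tz] := eqVneq t z; apply: q2 => //; exact: hc.
rewrite (cauchy_split s0 _ Hq); [|by rewrite gt_eqF|by move=> t ts; apply: qc; rewrite ts].
rewrite cmean_kernel_out// mulr0 add0r.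
apply: (@cmean_ext (normc z :: L) s (fun t => q t * t) _ s0).
- by move=> t ts; apply: ccontM; [exact: qc|exact: ccont_id].
- move=> t hts; rewrite inE negb_or => /andP[/normc_neq tz tL].
  by apply: cdiffM; [apply: q3 => //; exact: hd|exact: cdiff_id].
apply: (@ctends_near (fun t => (f t + - f z) * (t / (t - z))) _ _ (normc z + 1)).
  move=> t tz; have tz0 : t - z != 0.
    by apply: sub_neq0; rewrite lt_eqF// (lt_le_trans _ tz)// ltrDl.
  by rewrite {1}Hq addrAC subrr add0r; field.
rewrite -[X in ctends _ X]mulr1; apply: ctendsM; last exact: ctends_kernel.
by rewrite -[X in ctends _ X]add0r; apply: ctendsD; [exact: h0|exact: ctends_cst].
Qed.

Lemma cauchy_annulus L f s s' z : 0 <= s -> s < normc z < s' ->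
  (forall t, s <= normc t <= s' -> ccont f t) ->
  (forall t, s < normc t < s' -> normc t \notin L -> cdiff f t) ->
  cdiff f z ->
  cmean s' (fun t => f t * (t / (t - z))) - cmean s (fun t => f t * (t / (t - z))) = f z.
Proof.
move=> s0 /andP[sz zs'] hc hd hz.
have s'0 : 0 <= s' by apply: le_trans s0 _; apply: ltW; apply: lt_trans zs'.
have ss' : s <= s' by apply: ltW; apply: lt_trans zs'.
have [q [Hq q1 q2 q3]] := cdiff_quot hz.
have qc t : s <= normc t <= s' -> ccont q t.
  by move=> ts; have [->//|tz] := eqVneq t z; apply: q2 => //; exact: hc.
rewrite (cauchy_split s'0 _ Hq) ?lt_eqF//; last by move=> t ts; apply: qc; rewrite ts lexx ss'.
rewrite (cauchy_split s0 _ Hq) ?gt_eqF//; last by move=> t ts; apply: qc; rewrite ts lexx ss'.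
rewrite cmean_kernel_in// cmean_kernel_out// mulr1 mulr0 add0r.
rewrite (@cmean_eq (normc z :: L) s s' (fun t => q t * t))// ?addrK//.
- by move=> t ts; apply: ccontM; [exact: qc|exact: ccont_id].
- move=> t hts; rewrite inE negb_or => /andP[/normc_neq tz tL].
  by apply: cdiffM; [apply: q3 => //; exact: hd|exact: cdiff_id].
Qed.

Lemma cauchy_transform_cont s f z : 0 <= s -> normc z != s -> ccont_circle s f ->
  ccont (fun z => cmean s (fun t => f t / (t - z))) z.
Proof.
move=> s0 zs hf; have [M M0 HM] := compact_normc_bounded (@circle_compact R s) hf.
pose k := `|normc z - s| / 2.
have k0 : 0 < k by rewrite divr_gt0// normr_gt0 subr_eq0.
have dist w t : normc (w - z) < k -> normc t = s -> k <= normc (t - w).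
  move=> wz ts; have h : `|normc z - s| <= normc (t - w) + normc (w - z).
    rewrite -ts; apply: (@le_trans _ _ (normc (t - z))); last first.
      by rewrite (_ : t - z = (t - w) + (w - z)); [exact: le_normcD|rewrite addrA subrK].
    by rewrite ler_norml; have := ler_dist_normc z t; have := ler_dist_normc t z;
       rewrite (normcB z t); clear; lra.
  have : `|normc z - s| = 2 * k by rewrite /k; field.
  by move: h wz => + + e; rewrite e; clear; lra.
clearbody k; move=> e e0.
exists (Num.min k (e * (k * k) / (2 * M) / 2)).
  by rewrite lt_min k0 /=; do 2 (apply: divr_gt0 => //); do !apply: mulr_gt0.
move=> w; rewrite lt_min => /andP[wk we].
have zk : normc (z - z) < k by rewrite subrr normc0.
have cw v : normc (v - z) < k -> ccont_circle s (fun t => f t / (t - v)).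
  move=> vk t ts; apply: ccontM; first exact: hf.
  apply: ccontV; last by apply: ccontB; [exact: ccont_id|exact: ccont_cst].
  by rewrite -normc_gt0; apply: lt_le_trans (dist _ _ vk ts).
rewrite -cmeanB//; [|exact: cw|exact: cw].
apply: (@le_lt_trans _ _ (2 * (M * normc (w - z) / (k * k)))).
  apply: cmean_bound => //.
    by move=> t ts; apply: ccontB; apply: cw.
  move=> t ts; have d1 := dist _ _ wk ts; have d2 := dist _ _ zk ts.
  have n1 : 0 < normc (t - w) by apply: lt_le_trans d1.
  have n2 : 0 < normc (t - z) by apply: lt_le_trans d2.
  have -> : f t / (t - w) - f t / (t - z) = f t * (w - z) / ((t - w) * (t - z)).
    by field; rewrite -!normc_gt0 n1 n2.
  rewrite normcM normcV !normcM; apply: ler_pM.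
  - by rewrite mulr_ge0 ?normc_ge0.
  - by rewrite invr_ge0 mulr_ge0 ?normc_ge0.
  - by rewrite ler_wpM2r ?normc_ge0// HM.
  - by rewrite lef_pV2 ?posrE ?mulr_gt0//; apply: ler_pM => //; exact: ltW.
have kk : 0 < k * k by rewrite mulr_gt0.
rewrite mulrA ltr_pdivrMr// mulrA.
move: we; rewrite ltr_pdivlMr// ltr_pdivlMr ?mulr_gt0// => we.
apply: le_lt_trans we; rewrite [leRHS]mulrC mulrA.
by rewrite ler_peMr ?ler1n// !mulr_ge0 ?normc_ge0// ltW.
Qed.

Lemma cauchy_transform_cdiff s f z : 0 <= s -> normc z != s -> ccont_circle s f ->
  cdiff (fun z => cmean s (fun t => f t / (t - z))) z.
Proof.
move=> s0 zs hf.
pose g t := f t / (t - z).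
have hg : ccont_circle s g.
  move=> t ts; apply: ccontM; first exact: hf.
  apply: ccontV; last by apply: ccontB; [exact: ccont_id|exact: ccont_cst].
  by apply: sub_neq0; rewrite ts.
have d0 : 0 < `|normc z - s| by rewrite normr_gt0 subr_eq0.
apply: (@cdiff_near _ (fun w => cmean s g + (w - z) * cmean s (fun t => g t / (t - w))) _ z _ d0).
  move=> w hw; have ws : normc w != s.
    apply: contraTneq hw => <-; rewrite -leNgt normcB ler_norml.
    by have := ler_dist_normc z w; have := ler_dist_normc w z;
       rewrite (normcB w z); clear; lra.
  have cg : ccont_circle s (fun t => g t / (t - w)).
    move=> t ts; apply: ccontM; first exact: hg.
    apply: ccontV; last by apply: ccontB; [exact: ccont_id|exact: ccont_cst].
    by apply: sub_neq0; rewrite ts.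
  rewrite -cmeanZ// -cmeanD//; last first.
    by move=> t ts; apply: ccontM; [exact: ccont_cst|exact: cg].
  apply: eq_cmean => // t ts; rewrite /g; field.
  by rewrite !sub_neq0 ?ts.
exists (fun w => cmean s (fun t => g t / (t - w))).
  exact: cauchy_transform_cont.
by move=> w; rewrite subrr mul0r addr0.
Qed.

Lemma cauchy_transform_cdiff' s f z : 0 <= s -> normc z != s -> ccont_circle s f ->
  cdiff (fun z => cmean s (fun t => f t * (t / (t - z)))) z.
Proof.
move=> s0 zs hf.
rewrite (_ : (fun z => _) = fun z => cmean s (fun t => (f t * t) / (t - z))); last first.
  by apply/funext => w; congr (cmean s); apply/funext => t; rewrite mulrA.
apply: cauchy_transform_cdiff => // t ts.
by apply: ccontM; [exact: hf|exact: ccont_id].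
Qed.

Lemma kernel_bound s z t : 0 <= s -> normc t = s -> normc z != s ->
  normc (t / (t - z)) <= s / `|normc z - s|.
Proof.
move=> s0 ts zs; rewrite normcM normcV ts ler_wpM2l// lef_pV2 ?posrE.
- rewrite -ts ler_norml; have := ler_dist_normc z t; have := ler_dist_normc t z.
  by rewrite (normcB z t); clear; lra.
- by rewrite normc_gt0; apply: sub_neq0; rewrite ts.
- by rewrite normr_gt0 subr_eq0.
Qed.

Lemma cauchy_bound s f z (M : R) : 0 <= s -> normc z != s -> ccont_circle s f ->
  (forall t, normc t = s -> normc (f t) <= M) ->
  normc (cmean s (fun t => f t * (t / (t - z)))) <= 2 * (M * (s / `|normc z - s|)).
Proof.
move=> s0 zs hf hM; apply: cmean_bound => // t ts.
  by apply: ccontM; [exact: hf|apply: ccont_kernel; apply: normc_neq; rewrite ts eq_sym].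
by rewrite normcM; apply: ler_pM; rewrite ?normc_ge0 ?hM ?kernel_bound.
Qed.

End CircleMean.

Arguments cmean {R} s f : simpl never.

(** * Integral representation of the monic orthogonal polynomials *)

(* Both tactics are purely syntactic: they never unfold a named function. *)
Ltac cc := repeat lazymatch goal with
  | |- ccont (fun _ => ?c) _ => exact: ccont_cst
  | |- ccont (fun t => t) _ => exact: ccont_id
  | |- ccont (fun t => horner ?p t) _ => exact: ccont_horner
  | |- ccont (fun t => GRing.add (@?f t) (GRing.opp (@?g t))) _ => apply: (@ccontB _ f g)
  | |- ccont (fun t => GRing.add (@?f t) (@?g t)) _ => apply: (@ccontD _ f g)
  | |- ccont (fun t => GRing.opp (@?f t)) _ => apply: (@ccontN _ f)
  | |- ccont (fun t => GRing.mul (@?f t) (@?g t)) _ => apply: (@ccontM _ f g)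
  | |- ccont (fun t => GRing.inv (@?f t)) _ => apply: (@ccontV _ f)
  | |- ccont (fun t => GRing.exp (@?f t) ?n) _ => apply: (@ccontX _ f n)
  end.
Ltac cd := repeat lazymatch goal with
  | |- cdiff (fun _ => ?c) _ => exact: cdiff_cst
  | |- cdiff (fun t => t) _ => exact: cdiff_id
  | |- cdiff (fun t => horner ?p t) _ => exact: cdiff_horner
  | |- cdiff (fun t => GRing.add (@?f t) (GRing.opp (@?g t))) _ => apply: (@cdiffB _ f g)
  | |- cdiff (fun t => GRing.add (@?f t) (@?g t)) _ => apply: (@cdiffD _ f g)
  | |- cdiff (fun t => GRing.opp (@?f t)) _ => apply: (@cdiffN _ f)
  | |- cdiff (fun t => GRing.mul (@?f t) (@?g t)) _ => apply: (@cdiffM _ f g)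
  | |- cdiff (fun t => GRing.inv (@?f t)) _ => apply: (@cdiffV _ f)
  | |- cdiff (fun t => GRing.exp (@?f t) ?n) _ => apply: (@cdiffX _ f n)
  end.

Section Monic.
Variable R : realType.
Local Notation C := R[i].
Implicit Types (z t : C).

Lemma ctendsX (f : C -> C) c n : ctends f c -> ctends (fun z => f z ^+ n) (c ^+ n).
Proof.
move=> h; elim: n => [|n IH]; first exact: ctends_cst.
by under eq_fun do rewrite exprS; rewrite exprS; exact: ctendsM h IH.
Qed.

Lemma ctends_sum (I : Type) (r : seq I) (F : I -> C -> C) (c : I -> C) :
  (forall i, ctends (F i) (c i)) ->
  ctends (fun z => \sum_(i <- r) F i z) (\sum_(i <- r) c i).
Proof.
move=> hF; elim: r => [|i r IH].
  by under eq_fun do rewrite big_nil; rewrite big_nil; exact: ctends_cst.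
by under eq_fun do rewrite big_cons; rewrite big_cons; exact: ctendsD (hF i) IH.
Qed.

Lemma ctends_poly_div (p : {poly C}) n : (size p <= n.+1)%N ->
  ctends (fun t => p.[t] / t ^+ n) p`_n.
Proof.
move=> sp.
apply: (@ctends_near _ (fun t => \sum_(i < n.+1) p`_i * t^-1 ^+ (n - i)) _ _ 1).
  move=> t t1; have t0 : t != 0 by rewrite -normc_gt0; apply: lt_le_trans t1.
  rewrite (horner_coef_wide _ sp) mulr_suml; apply: eq_bigr => i _.
  rewrite -mulrA exprVn; congr (_ * _).
  have -> : t ^+ n = t ^+ i * t ^+ (n - i) by rewrite -exprD subnKC// -ltnS.
  by rewrite invfM mulrA divff ?mul1r// expf_neq0.
have -> : p`_n = \sum_(i < n.+1) p`_i * 0 ^+ (n - i).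
  rewrite big_ord_recr /= subnn mulr1 big1 ?add0r// => i _.
  by rewrite expr0n subn_eq0 leqNgt ltn_ord mulr0.
apply: ctends_sum => i; apply: ctendsM; first exact: ctends_cst.
by apply: ctendsX; exact: ctends_inv.
Qed.

End Monic.

Section Geometric.
Variable R : realType.
Implicit Types q e : R.

Lemma natr_geom_bound q n : 0 <= q -> q < 1 -> n%:R * q ^+ n <= (1 - q)^-1.
Proof.
move=> q0 q1; have h1 : 0 < 1 - q by rewrite subr_gt0.
rewrite -[leRHS]mul1r ler_pdivlMr//.
suff : n%:R * q ^+ n * (1 - q) <= 1 - q ^+ n.
  by move=> h; apply: le_trans h _; rewrite gerBl exprn_ge0.
elim: n => [|n IH]; first by rewrite expr0 mul0r mul0r subrr.
have qn : q ^+ n.+1 <= 1 by rewrite exprn_ile1// ltW.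
apply: (@le_trans _ _ (q * (1 - q ^+ n) + q ^+ n.+1 * (1 - q))).
  rewrite (_ : _ * (1 - q) = q * (n%:R * q ^+ n * (1 - q)) + q ^+ n.+1 * (1 - q)).
    by rewrite lerD2r ler_wpM2l.
  by rewrite -addn1 natrD addn1 exprS; ring.
rewrite -subr_ge0 (_ : _ - _ = (1 - q) * (1 - q ^+ n.+1)); last by rewrite exprS; ring.
by apply: mulr_ge0; rewrite subr_ge0// ltW.
Qed.

Lemma geom_small q e : 0 <= q -> q < 1 -> 0 < e ->
  exists N, forall n, (N <= n)%N -> q ^+ n <= e.
Proof.
move=> q0 q1 e0; have h1 : 0 < 1 - q by rewrite subr_gt0.
have := archi_boundP (ltW (divr_gt0 (ltr01 : 0 < 1 :> R) (mulr_gt0 e0 h1))).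
set N := Num.bound _ => hN; exists N.+1 => n hn.
have n0 : 0 < n%:R :> R by rewrite ltr0n; apply: leq_trans hn.
rewrite -(ler_pM2l n0); apply: le_trans (natr_geom_bound n q0 q1) _.
rewrite -ler_pdivrMr// -[leLHS]mul1r -invfM [(1 - q) * e]mulrC.
by apply: ltW; apply: lt_le_trans hN _; rewrite ler_nat ltnW.
Qed.

End Geometric.

Section Asymptotics.
Variable R : realType.
Local Notation C := R[i].
Implicit Types (s e d : R) (z t : C).

Variables (rho : R) (De Gi : C -> C) (tau : C) (P : nat -> {poly C}).
Hypotheses (rho0 : 0 < rho) (rho1 : rho < 1).
Hypothesis De_cdiff : forall z, rho < normc z -> cdiff De z.
Hypothesis De_neq0 : forall z, 1 <= normc z -> De z != 0.
Hypothesis De_oo : ctends De tau.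
Hypothesis Gi_cdiff : forall z, 0 < normc z < rho^-1 -> cdiff Gi z.
Hypothesis Gi_cont0 : ccont Gi 0.
Hypothesis Gi_neq0 : forall z, normc z <= 1 -> Gi z != 0.
Hypothesis tau_neq0 : tau != 0.
Hypothesis P_size : forall n, size (P n) = n.+1.
Hypothesis P_monic : forall n, (P n)`_n = 1.
Hypothesis P_orth : forall n j, (j < n)%N ->
  cmean 1 (fun t => (P n).[t] / (De t * Gi t) / t ^+ j) = 0.

Let De_cont z : rho < normc z -> ccont De z.
Proof. by move=> /De_cdiff /cdiff_cont. Qed.

Let Gi_cont z : normc z < rho^-1 -> ccont Gi z.
Proof.
move=> hz; have [->//|z0] := eqVneq z 0.
by apply: cdiff_cont; apply: Gi_cdiff; rewrite normc_gt0 z0.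
Qed.

Let rhoV1 : 1 < rho^-1.
Proof. by rewrite invf_gt1. Qed.

Let normc1_neq0 z : 0 < normc z -> z != 0.
Proof. by rewrite normc_gt0. Qed.

Lemma nonvanishing_annulus : exists sg1 sg2, [/\ rho < sg1 < 1, 1 < sg2 < rho^-1,
  forall z, sg1 <= normc z -> De z != 0 & forall z, normc z <= sg2 -> Gi z != 0].
Proof.
have key (f : C -> C) : (forall z, normc z = 1 -> ccont f z) ->
    (forall z, normc z = 1 -> f z != 0) ->
    exists2 d, 0 < d & forall z, `|normc z - 1| < d -> f z != 0.
  move=> hc h0.
  have c1 := @circle_compact R 1.
  have [M M0 HM] : exists2 M, 0 < M & forall z, circle 1 z -> normc (f z)^-1 <= M.
    by apply: compact_normc_bounded c1 _ => z hz; apply: ccontV; [exact: h0|exact: hc].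
  have [|d d0 Hd] := heine c1 hc (e := M^-1); first by rewrite invr_gt0.
  exists (Num.min d 1); first by rewrite lt_min d0 ltr01.
  move=> z; rewrite lt_min => /andP[hz hz1].
  have z0 : z != 0.
    by apply: contraTneq hz1 => ->; rewrite normc0 sub0r normrN normr1 ltxx.
  have n0 : 0 < normc z by rewrite normc_gt0.
  pose u := z / (normc z)%:C.
  have u1 : normc u = 1.
    by rewrite normcM normcV normc_real ger0_norm ?ltW// divff ?gt_eqF.
  have zu : normc (z - u) < d.
    have -> : z - u = (normc z - 1)%:C * u.
      rewrite /u rmorphB /= mulrBl mul1r mulrCA divff ?mulr1//.
      by rewrite -normc_gt0 normc_real normr_gt0 gt_eqF.
    by rewrite normcM u1 mulr1 normc_real.
  have := Hd u z u1 zu; apply: contraTneq => ->; rewrite sub0r normcN -leNgt.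
  have fu := h0 _ u1.
  by rewrite -lef_pV2 ?posrE ?invr_gt0 ?normc_gt0// invrK -normcV HM.
have [d d0 Hd] : exists2 d, 0 < d & forall z, `|normc z - 1| < d -> De z != 0.
  by apply: key => z z1; [apply: De_cont; rewrite z1|apply: De_neq0; rewrite z1].
have [d' d'0 Hd'] : exists2 d, 0 < d & forall z, `|normc z - 1| < d -> Gi z != 0.
  by apply: key => z z1; [apply: Gi_cont; rewrite z1|apply: Gi_neq0; rewrite z1].
have [sg1 /andP[a1 a2]] : exists sg1, Num.max rho (1 - d) < sg1 < 1.
  exists ((Num.max rho (1 - d) + 1) / 2).
  have : Num.max rho (1 - d) < 1 by rewrite gt_max rho1 gtrBl.
  by move=> h; rewrite midf_lt//; case: (midf_lt h).
have [sg2 /andP[b1 b2]] : exists sg2, 1 < sg2 < Num.min rho^-1 (1 + d').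
  exists ((1 + Num.min rho^-1 (1 + d')) / 2).
  have h : 1 < Num.min rho^-1 (1 + d') by rewrite lt_min rhoV1 ltrDl.
  by rewrite !midf_lt.
move: a1 b2; rewrite gt_max lt_min => /andP[a3 a4] /andP[b3 b4].
exists sg1, sg2; split; [by rewrite a3|by rewrite b1| |].
  move=> z hz; have [z1|z1] := leP 1 (normc z); first exact: De_neq0.
  by apply: Hd; rewrite ltr0_norm ?subr_lt0// opprB ltrBlDr -ltrBlDl (lt_le_trans a4).
move=> z hz; have [z1|z1] := leP (normc z) 1; first exact: Gi_neq0.
by apply: Hd'; rewrite gtr0_norm ?subr_gt0// ltrBlDl (le_lt_trans hz).
Qed.

Section Decomposition.
Variables (sg1 sg2 : R).
Hypotheses (sg1_itv : rho < sg1 < 1) (sg2_itv : 1 < sg2 < rho^-1).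
Hypothesis De_sg : forall z, sg1 <= normc z -> De z != 0.
Hypothesis Gi_sg : forall z, normc z <= sg2 -> Gi z != 0.
Variable n : nat.

Let sg1_0 : 0 <= sg1. Proof. by case/andP: sg1_itv => h _; exact/ltW/(lt_trans rho0 h). Qed.
Let sg1_1 : sg1 < 1. Proof. by case/andP: sg1_itv. Qed.
Let sg2_1 : 1 < sg2. Proof. by case/andP: sg2_itv. Qed.
Let rho_sg1 : rho < sg1. Proof. by case/andP: sg1_itv. Qed.
Let sg2_rho : sg2 < rho^-1. Proof. by case/andP: sg2_itv. Qed.
Let sg2_0 : 0 <= sg2. Proof. exact/ltW/(lt_trans ltr01 sg2_1). Qed.
Let sg12 : sg1 < sg2. Proof. exact: lt_trans sg1_1 sg2_1. Qed.

Let Wt t : C := (P n).[t] / (De t * Gi t).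

Let ann_neq0 t : sg1 <= normc t -> t != 0.
Proof. by move=> h; apply: normc1_neq0; apply: lt_le_trans h; exact: lt_trans rho_sg1. Qed.

Let Wt_cdiff t : sg1 <= normc t <= sg2 -> cdiff Wt t.
Proof.
move=> /andP[h1 h2]; rewrite /Wt; cd.
- by rewrite mulf_neq0 ?De_sg ?Gi_sg.
- by apply: De_cdiff; exact: lt_le_trans h1.
- by apply: Gi_cdiff; rewrite normc_gt0 ann_neq0//= (le_lt_trans h2).
Qed.

Let Wt_cont t : sg1 <= normc t <= sg2 -> ccont Wt t.
Proof. by move/Wt_cdiff/cdiff_cont. Qed.

Definition analytic_part z : C := cmean sg2 (fun t => Wt t / t ^+ n * (t / (t - z))).
Definition principal_part z : C := - cmean sg1 (fun t => Wt t * (t / (t - z))).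
Local Notation A := analytic_part.
Local Notation B := principal_part.

Let Wtn_cont : ccont_circle sg2 (fun t => Wt t / t ^+ n).
Proof.
move=> t ts; have h : sg1 <= normc t <= sg2 by rewrite ts lexx ltW.
apply: ccontM; first exact: Wt_cont.
cc; by rewrite expf_neq0// ann_neq0//; case/andP: h.
Qed.

Let Wt_cont1 : ccont_circle sg1 Wt.
Proof. by move=> t ts; apply: Wt_cont; rewrite ts lexx ltW. Qed.

Lemma analytic_part_cdiff z : normc z < sg2 -> cdiff A z.
Proof. by move=> hz; apply: cauchy_transform_cdiff' => //; rewrite lt_eqF. Qed.

Lemma principal_part_cdiff z : sg1 < normc z -> cdiff B z.
Proof.
by move=> hz; apply: cdiffN; apply: cauchy_transform_cdiff' => //; rewrite gt_eqF.
Qed.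

Lemma principal_part_oo : ctends B 0.
Proof.
have [M M0 HM] := compact_normc_bounded (@circle_compact R sg1) Wt_cont1.
apply/ctendsP => e e0; exists (sg1 + 2 * (M * sg1) / e + 1) => z hz.
have k0 : 0 <= 2 * (M * sg1) / e by rewrite divr_ge0 ?mulr_ge0// ltW.
have z1 : 0 < normc z - sg1 by rewrite subr_gt0; move: hz k0; set k := _ / e => *; lra.
rewrite subr0 normcN; apply: le_lt_trans (cauchy_bound (M := M) _ _ _ _) _ => //.
  by rewrite gt_eqF// -subr_gt0.
rewrite ger0_norm ?(ltW z1)// mulrA mulrA ltr_pdivrMr// -ltr_pdivrMl//.
by rewrite -mulrA mulrC; move: hz; set k := _ / e => *; lra.
Qed.

Lemma weighted_split z : sg1 < normc z < sg2 -> Wt z = z ^+ n * A z + B z.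
Proof.
move=> hz; have [h1 h2] := andP hz.
have hc : ccont_circle sg2 (fun t => t / (t - z)).
  by move=> t ts; apply: ccont_kernel; apply: normc_neq; rewrite ts gt_eqF.
have Wc i : ccont_circle sg2 (fun t => Wt t / t ^+ i).
  move=> t ts; have h : sg1 <= normc t <= sg2 by rewrite ts lexx ltW.
  apply: ccontM; first exact: Wt_cont.
  cc; by rewrite expf_neq0// ann_neq0//; case/andP: h.
rewrite -(@cauchy_annulus R [::] Wt sg1 sg2 z)//; last 2 first.
- by move=> t /andP[a b] _; apply: Wt_cdiff; rewrite !ltW.
- by apply: Wt_cdiff; rewrite !ltW.
congr (_ - _); apply/eqP; rewrite -subr_eq0 /A -cmeanZ//; last first.
  by move=> t ts; apply: ccontM; [exact: Wc|exact: hc].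
rewrite -cmeanB//; first last.
- move=> t ts; apply: ccontM; first exact: ccont_cst.
  by apply: ccontM; [exact: Wc|exact: hc].
- by move=> t ts; apply: ccontM; [apply: Wt_cont; rewrite ts lexx ltW|exact: hc].
rewrite (@eq_cmean _ _ _ (fun t => \sum_(i < n) z ^+ i * (Wt t / t ^+ i)))//; last first.
  move=> t ts; have t0 : t != 0 by apply: ann_neq0; rewrite ts ltW.
  have tz : t - z != 0 by apply: sub_neq0; rewrite ts lt_eqF.
  rewrite (_ : _ - _ = Wt t * t / t ^+ n * ((t ^+ n - z ^+ n) / (t - z))); last first.
    by field; rewrite tz expf_neq0.
  rewrite subrXX [(t - z) * _]mulrC mulfK// mulr_sumr; apply: eq_bigr => i _.
  have -> : t ^+ n = t * (t ^+ i * t ^+ (n.-1 - i)).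
    rewrite -exprD -exprS subnKC; first by case: n i => [[]|m i].
    by case: n i => [[]|m i] //=; rewrite -ltnS.
  by field; rewrite t0 !expf_neq0.
rewrite cmean_sum//; last by move=> i t ts; apply: ccontM; [exact: ccont_cst|exact: Wc].
apply/eqP; rewrite big1// => i _; rewrite cmeanZ; [|by []|exact: Wc].
rewrite -(@cmean_eq R [::] 1 sg2) ?ltW// ?P_orth ?mulr0//.
- move=> t /andP[a b]; have h : sg1 <= normc t <= sg2 by rewrite b (le_trans (ltW sg1_1)).
  apply: ccontM; first exact: Wt_cont.
  cc; by rewrite expf_neq0// ann_neq0//; case/andP: h.
- move=> t /andP[a b] _; have h : sg1 <= normc t <= sg2 by rewrite (ltW b) (le_trans (ltW sg1_1))// ltW.
  apply: cdiffM; first exact: Wt_cdiff.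
  cd; by rewrite expf_neq0// ann_neq0//; case/andP: h.
Qed.

Let unit_ann t : normc t = 1 -> sg1 < normc t < sg2.
Proof. by move=> ->; rewrite sg1_1 sg2_1. Qed.

Let split_De t : normc t = 1 -> (P n).[t] / De t / t ^+ n = Gi t * A t + B t * Gi t / t ^+ n.
Proof.
move=> t1; have t0 : t ^+ n != 0 by rewrite expf_neq0// normc1_neq0// t1.
have d0 : De t != 0 by rewrite De_neq0// t1.
have g0 : Gi t != 0 by rewrite Gi_neq0// t1.
have := weighted_split (unit_ann t1); rewrite /Wt => h.
have -> : (P n).[t] = De t * Gi t * (t ^+ n * A t + B t).
  by rewrite -h mulrC divfK// mulf_neq0.
by field; rewrite t0 d0.
Qed.

Let split_Gi t : normc t = 1 -> (P n).[t] / Gi t = t ^+ n * De t * A t + De t * B t.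
Proof.
move=> t1; have d0 : De t != 0 by rewrite De_neq0// t1.
have g0 : Gi t != 0 by rewrite Gi_neq0// t1.
have := weighted_split (unit_ann t1); rewrite /Wt => h.
have -> : (P n).[t] = De t * Gi t * (t ^+ n * A t + B t).
  by rewrite -h mulrC divfK// mulf_neq0.
by field.
Qed.

Let A_cont z : normc z < sg2 -> ccont A z.
Proof. by move/analytic_part_cdiff/cdiff_cont. Qed.

Let B_cont z : sg1 < normc z -> ccont B z.
Proof. by move/principal_part_cdiff/cdiff_cont. Qed.

Let De_kernel_shift z s : rho < s -> s <= 1 -> (1 < normc z \/ normc z < s) ->
  cmean s (fun t => t ^+ n * De t * A t * (t / (t - z))) =
  cmean 1 (fun t => t ^+ n * De t * A t * (t / (t - z))).
Proof.
move=> rs s1 hz.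
have kz t : s <= normc t <= 1 -> t != z.
  move=> /andP[a b]; apply: normc_neq; case: hz => h.
    by rewrite lt_eqF// (le_lt_trans b).
  by rewrite gt_eqF// (lt_le_trans h).
apply: (@cmean_eq R [::]) => //; first exact/ltW/(lt_trans rho0).
- move=> t hz'; have [a b] := andP hz'; apply: ccontM; last exact: ccont_kernel (kz _ hz').
  cc; [by apply: De_cont; exact: lt_le_trans a|by apply: A_cont; exact: le_lt_trans b _].
- move=> t /andP[a b] _; have hz' : s <= normc t <= 1 by rewrite !ltW.
  apply: cdiffM; last exact: cdiff_kernel (kz _ hz').
  cd; [by apply: De_cdiff; exact: lt_trans a|].
  by apply: analytic_part_cdiff; exact: lt_trans b _.
Qed.

Let circ1_neq z t : normc z != 1 -> normc t = 1 -> t != z.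
Proof. by move=> h t1; apply: normc_neq; rewrite t1 eq_sym. Qed.

Let PGi_cont t : normc t <= 1 -> ccont (fun t => (P n).[t] / Gi t) t.
Proof.
move=> t1; cc; first exact: Gi_neq0.
by apply: Gi_cont; exact: le_lt_trans t1 _.
Qed.

Let PGi_cdiff t : 0 < normc t <= 1 -> cdiff (fun t => (P n).[t] / Gi t) t.
Proof.
move=> /andP[t0 t1]; cd; first exact: Gi_neq0.
by apply: Gi_cdiff; rewrite t0 (le_lt_trans t1).
Qed.

Let DeAB_cont z t : normc z != 1 -> normc t = 1 ->
  ccont (fun t => t ^+ n * De t * A t * (t / (t - z))) t /\
  ccont (fun t => De t * B t * (t / (t - z))) t.
Proof.
move=> z1 t1; split; apply: ccontM; try exact: ccont_kernel (circ1_neq z1 t1).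
  by cc; [apply: De_cont; rewrite t1|apply: A_cont; rewrite t1].
by cc; [apply: De_cont; rewrite t1|apply: B_cont; rewrite t1].
Qed.

Let PGi_split z : normc z != 1 -> cmean 1 (fun t => (P n).[t] / Gi t * (t / (t - z))) =
  cmean 1 (fun t => t ^+ n * De t * A t * (t / (t - z))) +
  cmean 1 (fun t => De t * B t * (t / (t - z))).
Proof.
move=> z1; rewrite -cmeanD//.
- by apply: eq_cmean => // t t1; rewrite split_Gi// mulrDl.
- by move=> t t1; case: (DeAB_cont z1 t1).
- by move=> t t1; case: (DeAB_cont z1 t1).
Qed.

Let DeB_oo : ctends (fun t => De t * B t) 0.
Proof. by rewrite -[X in ctends _ X](mulr0 tau); apply: ctendsM; [exact: De_oo|exact: principal_part_oo]. Qed.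

Lemma principal_part_repr z s : 1 < normc z -> rho < s -> s < 1 ->
  De z * B z = cmean s (fun t => t ^+ n * De t * A t * (t / (t - z))).
Proof.
move=> z1 rs s1; rewrite De_kernel_shift ?ltW//; last by left.
have zn1 : normc z != 1 by rewrite gt_eqF.
have := PGi_split zn1.
have -> : cmean 1 (fun t => (P n).[t] / Gi t * (t / (t - z))) = 0.
  rewrite -(@cmean_eq R [::] 0 1) ?cmean0 ?mul0r ?mulr0//.
  - move=> t /andP[_ t1]; apply: ccontM; first exact: PGi_cont.
    by apply: ccont_kernel; apply: normc_neq; rewrite lt_eqF// (le_lt_trans t1).
  - move=> t /andP[t0 t1] _; apply: cdiffM; first by apply: PGi_cdiff; rewrite t0 ltW.
    by apply: cdiff_kernel; apply: normc_neq; rewrite lt_eqF// (lt_trans t1).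
rewrite (@cauchy_ext R [::] (fun t => De t * B t) 1 z)//.
- by move=> /esym /eqP; rewrite subr_eq0 => /eqP.
- move=> t t1; cc; first by apply: De_cont; exact: lt_le_trans t1.
  by apply: B_cont; exact: lt_le_trans t1.
- move=> t t1 _; cd; first by apply: De_cdiff; exact: lt_trans t1.
  by apply: principal_part_cdiff; exact: lt_trans t1.
- cd; first by apply: De_cdiff; exact: lt_trans z1.
  by apply: principal_part_cdiff; exact: lt_trans z1.
Qed.

Lemma poly_repr z s : normc z < s -> rho < s -> s <= 1 ->
  (P n).[z] / Gi z = cmean s (fun t => t ^+ n * De t * A t * (t / (t - z))).
Proof.
move=> zs rs s1; rewrite De_kernel_shift//; last by right.
have z1 : normc z < 1 by exact: lt_le_trans s1.
have zn1 : normc z != 1 by rewrite lt_eqF.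
rewrite -(@cauchy_disk R [::] (fun t => (P n).[t] / Gi t) 1 z)//.
- rewrite PGi_split// [X in _ + X](@cmean_ext R [::] 1 (fun t => De t * B t * (t / (t - z))) 0 ler01); [exact: addr0| | |].
  + move=> t t1; apply: ccontM; last by apply: ccont_kernel; apply: normc_neq; rewrite gt_eqF// (lt_le_trans z1).
    by cc; [apply: De_cont; exact: lt_le_trans t1|apply: B_cont; exact: lt_le_trans t1].
  + move=> t t1 _; apply: cdiffM; last by apply: cdiff_kernel; apply: normc_neq; rewrite gt_eqF// (lt_trans z1).
    by cd; [apply: De_cdiff; exact: lt_trans t1|apply: principal_part_cdiff; exact: lt_trans t1].
  + rewrite -[X in ctends _ X](mul0r 1); apply: ctendsM; first exact: DeB_oo.
    exact: ctends_kernel.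
- by move=> t /andP[t0 t1] _; apply: PGi_cdiff; rewrite t0 ltW.
- by move=> z0; apply: PGi_cdiff; rewrite normc_gt0 z0 ltW.
Qed.

Lemma analytic_part_repr z s : 0 < normc z -> normc z < 1 -> 1 < s -> s < rho^-1 ->
  Gi z * A z = tau^-1 - cmean s (fun t => B t * Gi t / t ^+ n * (t / (t - z))).
Proof.
move=> z0 z1 s1 sr; have zn1 : normc z != 1 by rewrite lt_eqF.
have BG_cont t : 1 <= normc t < rho^-1 -> ccont (fun t => B t * Gi t / t ^+ n) t.
  move=> /andP[a b]; cc.
  - by apply: B_cont; exact: lt_le_trans a.
  - exact: Gi_cont.
  - by rewrite expf_neq0// normc1_neq0// (lt_le_trans _ a).
rewrite -(@cmean_eq R [::] 1 s) ?ltW//; first last.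
- move=> t /andP[a b] _; apply: cdiffM; last first.
    by apply: cdiff_kernel; apply: normc_neq; rewrite gt_eqF// (lt_trans z1).
  cd.
  + by apply: principal_part_cdiff; exact: lt_trans a.
  + by apply: Gi_cdiff; rewrite (lt_trans _ a)//= (lt_trans b).
  + by rewrite expf_neq0// normc1_neq0// (lt_trans _ a).
- move=> t /andP[a b]; apply: ccontM; first by apply: BG_cont; rewrite a (le_lt_trans b).
  by apply: ccont_kernel; apply: normc_neq; rewrite gt_eqF// (lt_le_trans z1).
have GA_cont t : normc t <= 1 -> ccont (fun t => Gi t * A t) t.
  move=> t1; cc; first by apply: Gi_cont; exact: le_lt_trans t1 _.
  by apply: A_cont; exact: le_lt_trans t1 _.
have GA_cdiff t : 0 < normc t <= 1 -> cdiff (fun t => Gi t * A t) t.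
  move=> /andP[t0 t1]; cd; first by apply: Gi_cdiff; rewrite t0 (le_lt_trans t1).
  by apply: analytic_part_cdiff; exact: le_lt_trans t1 _.
rewrite -(@cauchy_disk R [::] (fun t => Gi t * A t) 1 z)//; first last.
- by move=> _; apply: GA_cdiff; rewrite z0 ltW.
- by move=> t /andP[t0 t1] _; apply: GA_cdiff; rewrite t0 ltW.
have -> : tau^-1 = cmean 1 (fun t => (P n).[t] / De t / t ^+ n * (t / (t - z))).
  apply/esym; apply: (@cmean_ext R [::] 1 _ tau^-1 ler01).
  - move=> t t1; apply: ccontM; last by apply: ccont_kernel; apply: normc_neq; rewrite gt_eqF// (lt_le_trans z1).
    cc; [exact: De_neq0|by apply: De_cont; exact: lt_le_trans t1|].
    by rewrite expf_neq0// normc1_neq0// (lt_le_trans _ t1).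
  - move=> t t1 _; apply: cdiffM; last by apply: cdiff_kernel; apply: normc_neq; rewrite gt_eqF// (lt_trans z1).
    cd; [by apply: De_neq0; exact: ltW|by apply: De_cdiff; exact: lt_trans t1|].
    by rewrite expf_neq0// normc1_neq0// (lt_trans _ t1).
  - apply: (@ctends_near R (fun t => ((P n).[t] / t ^+ n) * (De t)^-1 * (t / (t - z))) _ _ 0).
      by move=> t _; ring.
    rewrite -[X in ctends _ X]mulr1; apply: ctendsM; last exact: ctends_kernel.
    rewrite -[X in ctends _ X]mul1r; apply: ctendsM.
      by rewrite -(P_monic n); apply: ctends_poly_div; rewrite P_size.
    exact: ctendsV tau_neq0 De_oo.
rewrite -cmeanB//.
- apply: eq_cmean => // t t1; rewrite split_De//; ring.
- move=> t t1; apply: ccontM; last exact: ccont_kernel (circ1_neq zn1 t1).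
  cc; [by apply: De_neq0; rewrite t1|by apply: De_cont; rewrite t1|].
  by rewrite expf_neq0// normc1_neq0// t1.
- move=> t t1; apply: ccontM; last exact: ccont_kernel (circ1_neq zn1 t1).
  by apply: BG_cont; rewrite t1 lexx.
Qed.

End Decomposition.

(* Feeding the two integral representations into one another bounds the analytic part
   on a circle by an affine contraction of itself once n is large. *)
Lemma analytic_part_bounds sg1 sg2 r0 : rho < sg1 < 1 -> 1 < sg2 < rho^-1 ->
  (forall z, sg1 <= normc z -> De z != 0) -> (forall z, normc z <= sg2 -> Gi z != 0) ->
  rho < r0 < 1 ->
  exists2 c, 0 < c & forall n z, 0 < normc z < 1 ->
    normc (Gi z * analytic_part sg2 n z - tau^-1) <= c * r0 ^+ (2 * n).
Proof.
move=> hs1 hs2 De_sg Gi_sg /andP[rr0 r01].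
pose A n := analytic_part sg2 n; pose B n := principal_part sg1 n.
have r00 : 0 < r0 by exact: lt_trans rr0.
pose R0 := r0^-1; have R01 : 1 < R0 by rewrite invf_gt1.
have R0rho : R0 < rho^-1 by rewrite ltf_pV2.
have R00 : 0 < R0 by exact: lt_trans R01.
have cDe : ccont_circle r0 De by move=> t tr; apply: De_cont; rewrite tr.
have cGi : ccont_circle R0 Gi by move=> t tr; apply: Gi_cont; rewrite tr.
have [M1 M10 HM1] := compact_normc_bounded (@circle_compact R r0) cDe.
have [M3 M30 HM3] := compact_normc_bounded (@circle_compact R R0) cGi.
have [M2 M20 HM2] : exists2 M, 0 < M & forall z, circle R0 z -> normc (De z)^-1 <= M.
  apply: compact_normc_bounded (@circle_compact R R0) _ => z zR.
  apply: ccontV; first by apply: De_neq0; rewrite zR ltW.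
  by apply: De_cont; rewrite zR; exact: lt_trans R01.
have [M4 M40 HM4] : exists2 M, 0 < M & forall z, circle r0 z -> normc (Gi z)^-1 <= M.
  apply: compact_normc_bounded (@circle_compact R r0) _ => z zR.
  apply: ccontV; first by apply: Gi_neq0; rewrite zR ltW.
  by apply: Gi_cont; rewrite zR; exact: lt_trans rhoV1.
pose K1 := M2 * (2 * (M1 * (r0 / (R0 - r0)))).
pose K2 := 2 * (M3 * (R0 / (R0 - 1))).
have dR : 0 < R0 - r0 by rewrite subr_gt0; exact: lt_trans R01.
have dR1 : 0 < R0 - 1 by rewrite subr_gt0.
have K10 : 0 < K1 by do !apply: mulr_gt0 => //; rewrite invr_gt0.
have K20 : 0 < K2 by do !apply: mulr_gt0 => //; rewrite invr_gt0.
have sg2_1 : 1 < sg2 by case/andP: hs2.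
have sg1_1 : sg1 < 1 by case/andP: hs1.
have cA n z : normc z < sg2 -> ccont (A n) z.
  by move=> h; apply: cdiff_cont; apply: (analytic_part_cdiff hs1 hs2).
have cB n z : sg1 < normc z -> ccont (B n) z.
  by move=> h; apply: cdiff_cont; apply: (principal_part_cdiff hs1 hs2).
have Bstep n M : (forall t, normc t = r0 -> normc (A n t) <= M) ->
    forall z, normc z = R0 -> normc (B n z) <= r0 ^+ n * (K1 * M).
  move=> hM z zR; have z1 : 1 < normc z by rewrite zR.
  have E := principal_part_repr hs1 hs2 De_sg Gi_sg n z1 rr0 r01.
  have d0 : De z != 0 by apply: De_neq0; exact: ltW.
  have -> : B n z = (De z)^-1 * cmean r0 (fun t => t ^+ n * De t * A n t * (t / (t - z))).
    by rewrite -E mulKf.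
  rewrite normcM (_ : _ * (K1 * M) =
    M2 * (2 * (r0 ^+ n * M1 * M * (r0 / (R0 - r0))))); last by rewrite /K1; ring.
  apply: ler_pM; rewrite ?normc_ge0 ?HM2//.
  rewrite (_ : R0 - r0 = `|normc z - r0|); last by rewrite zR gtr0_norm.
  apply: cauchy_bound; first exact: ltW.
  - by rewrite zR gt_eqF// -subr_gt0.
  - move=> t tr; cc; first by apply: De_cont; rewrite tr.
    by apply: cA; rewrite tr; exact: lt_trans sg2_1.
  - move=> t tr; rewrite (normcM _ (A n t)) (normcM _ (De t)) normcX tr.
    have rn0 : 0 <= r0 ^+ n by rewrite exprn_ge0// ltW.
    apply: ler_pM; [by rewrite mulr_ge0 ?normc_ge0|exact: normc_ge0| |exact: hM].
    by rewrite ler_wpM2l// HM1.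
have Astep n M : (forall t, normc t = R0 -> normc (B n t) <= M) ->
    forall z, 0 < normc z < 1 -> normc (Gi z * A n z - tau^-1) <= r0 ^+ n * (M * K2).
  move=> hM z /andP[z0 z1].
  have M0 : 0 <= M.
    by apply: le_trans (hM R0%:C _); rewrite ?normc_ge0// normc_real ger0_norm ?ltW.
  rewrite (analytic_part_repr hs1 hs2 De_sg Gi_sg n z0 z1 R01 R0rho).
  rewrite addrAC subrr add0r normcN.
  apply: (@le_trans _ _ (2 * (M * M3 * r0 ^+ n * (R0 / `|normc z - R0|)))).
    apply: cauchy_bound; first exact: ltW.
    - by rewrite lt_eqF//; exact: lt_trans R01.
    - move=> t tr; cc; [by apply: cB; rewrite tr; exact: lt_trans R01|exact: cGi|].
      by rewrite expf_neq0// normc1_neq0// tr.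
    - move=> t tr; rewrite !normcM normcV normcX tr -exprVn invrK.
      rewrite ler_wpM2r ?exprn_ge0 ?(ltW r00)//.
      by apply: ler_pM; rewrite ?normc_ge0 ?hM ?HM3.
  rewrite (_ : r0 ^+ n * (M * K2) = 2 * (M * M3 * r0 ^+ n * (R0 / (R0 - 1)))); last by rewrite /K2; ring.
  apply: ler_wpM2l => //; apply: ler_wpM2l.
    by rewrite !mulr_ge0 ?exprn_ge0// ltW.
  apply: ler_wpM2l; first exact: ltW.
  have zR : normc z < R0 by exact: lt_trans R01.
  rewrite ltr0_norm ?subr_lt0// opprB lef_pV2 ?posrE ?subr_gt0//.
  by rewrite lerB// ltW.
pose K := M4 * (K1 * K2).
have contr n M : (forall t, normc t = r0 -> normc (A n t) <= M) ->
    forall t, normc t = r0 -> normc (A n t) <= M4 * normc tau^-1 + K * r0 ^+ (2 * n) * M.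
  move=> hM t tr.
  have g0 : Gi t != 0 by apply: Gi_neq0; rewrite tr ltW.
  have ht : 0 < normc t < 1 by rewrite tr r00.
  have := Astep n _ (Bstep n M hM) t ht => h.
  have -> : A n t = (Gi t)^-1 * (tau^-1 + (Gi t * A n t - tau^-1)).
    by rewrite addrC subrK mulKf.
  rewrite normcM (_ : _ + _ = M4 * (normc tau^-1 + r0 ^+ n * (r0 ^+ n * (K1 * M) * K2))); last first.
    by rewrite /K mul2n -addnn exprD; ring.
  apply: ler_pM; rewrite ?normc_ge0 ?HM4//.
  by apply: le_trans (le_normcD _ _) _; rewrite lerD2l.
have K0 : 0 < K by apply: mulr_gt0 => //; exact: mulr_gt0.
have cAr n : ccont_circle r0 (A n).
  by move=> t tr; apply: cA; rewrite tr; exact: lt_trans sg2_1.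
have r02 : 0 <= r0 ^+ 2 < 1 by rewrite exprn_ge0 ?ltW//= expr_lt1// ltW.
have [N HN] : exists N, forall n, (N <= n)%N -> (r0 ^+ 2) ^+ n <= (2 * K)^-1.
  by case/andP: r02 => ? ?; apply: geom_small => //; rewrite invr_gt0 mulr_gt0.
have small : exists2 M, 0 < M & forall n, (n < N)%N -> forall t, normc t = r0 -> normc (A n t) <= M.
  elim: (N) => [|k [M M0 HM]]; first by exists 1.
  have [M' M'0 HM'] := compact_normc_bounded (@circle_compact R r0) (cAr k).
  exists (Num.max M M'); first by rewrite lt_max M0.
  move=> n; rewrite ltnS leq_eqVlt => /predU1P[->|nk] t tr.
    by rewrite le_max HM' ?orbT.
  by rewrite le_max HM.
have T0 : 0 <= M4 * normc tau^-1 by rewrite mulr_ge0 ?normc_ge0 ?ltW.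
have large n : (N <= n)%N -> forall t, normc t = r0 -> normc (A n t) <= 2 * (M4 * normc tau^-1).
  move=> nN t tr; pose E := [set normc (A n u) | u in circle r0].
  have [M' M'0 HM'] := compact_normc_bounded (@circle_compact R r0) (cAr n).
  have Eub : has_ubound E by exists M' => _ [u ur <-]; exact: HM'.
  have E0 : E !=set0 by exists (normc (A n t)), t.
  have Esup u : normc u = r0 -> normc (A n u) <= sup E.
    by move=> ur; apply: ub_le_sup => //; exists u.
  have S0 : 0 <= sup E by apply: le_trans (Esup _ tr); exact: normc_ge0.
  apply: le_trans (Esup _ tr) _.
  have : sup E <= M4 * normc tau^-1 + K * r0 ^+ (2 * n) * sup E.
    by apply: ge_sup => // _ [u ur <-]; exact: contr.
  have h1 : K * r0 ^+ (2 * n) * sup E <= 2^-1 * sup E.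
    apply: ler_wpM2r => //; rewrite exprM.
    apply: le_trans (ler_wpM2l (ltW K0) (HN _ nN)) _.
    by rewrite invfM mulrCA divff ?mulr1// gt_eqF.
  move: (sup E) S0 h1 => S S0 h1 h2; rewrite -lerBlDr in h2.
  have : S - 2^-1 * S <= M4 * normc tau^-1 by apply: le_trans h2; rewrite lerB.
  by rewrite (_ : S - 2^-1 * S = S / 2); [rewrite ler_pdivrMr// mulrC|field].
have [M M0 HM] := small.
pose M' := Num.max M (2 * (M4 * normc tau^-1)).
have M'0 : 0 < M' by rewrite lt_max M0.
have HM' n t : normc t = r0 -> normc (A n t) <= M'.
  move=> tr; have [nN|nN] := ltnP n N; first by rewrite le_max HM.
  by rewrite le_max large ?orbT.
exists (K1 * M' * K2); first by apply: mulr_gt0 => //; exact: mulr_gt0.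
move=> n z hz; have := Astep n _ (Bstep n M' (HM' n)) z hz.
by rewrite (_ : _ * r0 ^+ (2 * n) = r0 ^+ n * (r0 ^+ n * (K1 * M') * K2))// mul2n -addnn exprD; ring.
Qed.

Lemma poly_cauchy_approx r0 r s : rho < r0 < 1 -> rho < s < 1 -> r < s ->
  exists2 c, 0 < c & forall n z, normc z <= r ->
    normc ((P n).[z] / Gi z
           - tau^-1 * cmean s (fun t => t ^+ n * (De t / Gi t) * (t / (t - z))))
    <= c * (s * r0 ^+ 2) ^+ n.
Proof.
move=> hr0 /andP[rs s1] rs'.
have [sg1 [sg2 [hs1 hs2 De_sg Gi_sg]]] := nonvanishing_annulus.
have [c c0 Hc] := analytic_part_bounds hs1 hs2 De_sg Gi_sg hr0.
have s0 : 0 < s by exact: lt_trans rs.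
have FC : ccont_circle s (fun t => De t / Gi t).
  move=> t ts; cc; [by apply: De_cont; rewrite ts|by apply: Gi_neq0; rewrite ts ltW|].
  by apply: Gi_cont; rewrite ts; exact: lt_trans rhoV1.
have [M M0 HM] := compact_normc_bounded (@circle_compact R s) FC.
have r00 : 0 <= r0 by case/andP: hr0 => h _; exact/ltW/(lt_trans rho0 h).
have sr : 0 < s - r by rewrite subr_gt0.
exists (2 * (M * c * (s / (s - r)))).
  by do !apply: mulr_gt0 => //; rewrite invr_gt0.
move=> n z zr; have zs : normc z < s by exact: le_lt_trans zr _.
have zns : normc z != s by rewrite lt_eqF.
rewrite (poly_repr hs1 hs2 De_sg Gi_sg n zs rs (ltW s1)).
have kc : ccont_circle s (fun t => t / (t - z)).
  by move=> t ts; apply: ccont_kernel; apply: normc_neq; rewrite ts gt_eqF.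
have Ac : ccont_circle s (analytic_part sg2 n).
  move=> t ts; apply: cdiff_cont; apply: (analytic_part_cdiff hs1 hs2 De_sg Gi_sg).
  by rewrite ts (lt_trans s1)//; case/andP: hs2.
have Gc : ccont_circle s Gi.
  by move=> t ts; apply: Gi_cont; rewrite ts; exact: lt_trans rhoV1.
have Dc : ccont_circle s De by move=> t ts; apply: De_cont; rewrite ts.
have nFC : ccont_circle s (fun t => t ^+ n * (De t / Gi t)).
  by move=> t ts; apply: ccontM; [cc|exact: FC].
rewrite -cmeanZ; [|exact: ltW|by move=> t ts; apply: ccontM; [exact: nFC|exact: kc]].
rewrite -cmeanB; [|exact: ltW| |]; first last.
- move=> t ts; apply: ccontM; first exact: ccont_cst.
  by apply: ccontM; [exact: nFC|exact: kc].
- by move=> t ts; apply: ccontM; [cc; [exact: Dc|exact: Ac]|exact: kc].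
rewrite (@eq_cmean _ _ _ (fun t => t ^+ n * (De t / Gi t) *
   (Gi t * analytic_part sg2 n t - tau^-1) * (t / (t - z)))); [|exact: ltW|]; last first.
  move=> t ts; have g0 : Gi t != 0 by apply: Gi_neq0; rewrite ts ltW.
  have tz : t - z != 0 by apply: sub_neq0; rewrite ts lt_eqF.
  by field; rewrite g0 tz tau_neq0.
apply: (@le_trans _ _ (2 * (s ^+ n * M * (c * r0 ^+ (2 * n)) * (s / `|normc z - s|)))).
  apply: cauchy_bound => //; first exact: ltW.
    by move=> t ts; apply: ccontM; [exact: nFC|cc; [exact: Gc|exact: Ac]].
  move=> t ts; rewrite !normcM normcX ts.
  have cr : 0 <= c * r0 ^+ (2 * n) by rewrite mulr_ge0 ?exprn_ge0// ltW.
  have sn0 : 0 <= s ^+ n by rewrite exprn_ge0// ltW.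
  apply: ler_pM; [by rewrite !mulr_ge0 ?normc_ge0|exact: normc_ge0| |].
    by rewrite ler_wpM2l// -normcM HM.
  by apply: Hc; rewrite ts s0.
rewrite exprMn -exprM.
rewrite (_ : 2 * (M * c * _) * _ = 2 * (s ^+ n * M * (c * r0 ^+ (2 * n)) * (s / (s - r)))); last by ring.
apply: ler_wpM2l => //; apply: ler_wpM2l.
  by rewrite !mulr_ge0 ?exprn_ge0 ?(ltW s0) ?(ltW M0) ?(ltW c0).
apply: ler_wpM2l; first exact: ltW.
by rewrite ltr0_norm ?subr_lt0// opprB lef_pV2 ?posrE ?subr_gt0// lerB.
Qed.

End Asymptotics.

(** * The Szego function *)

Section CircleMeanReal.
Variable R : realType.
Local Notation C := R[i].
Local Notation Re := (@complex.Re R).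
Local Notation Im := (@complex.Im R).
Implicit Types (s e d : R) (z t : C) (f g : C -> C).

Lemma cint_conj (f : R -> C) a b : itv_rcont f a b ->
  conjc (cint a b f) = cint a b (fun x => conjc (f x)).
Proof.
move=> hf; rewrite /cint /conjc /=; congr (_ +i* _).
  by apply: eq_Rintegral => x _; case: (f x).
rewrite -mulN1r -RintegralZl//; last exact: integrable_Im.
by apply: eq_Rintegral => x _; rewrite mulN1r; case: (f x).
Qed.

Lemma cmean_conj s f : 0 <= s -> ccont_circle s f ->
  conjc (cmean s f) = cmean s (fun t => conjc (f t)).
Proof.
move=> s0 hf; rewrite /cmean rmorphM /= conjc_real cint_conj//.
exact: circle_rcont.
Qed.

Lemma Re_cmean_le s f g : 0 <= s -> ccont_circle s f -> ccont_circle s g ->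
  (forall t, normc t = s -> Re (f t) <= Re (g t)) -> Re (cmean s f) <= Re (cmean s g).
Proof.
move=> s0 hf hg fg; rewrite /cmean.
have ReZ (k : R) z : Re (k%:C * z) = k * Re z by case: z => a b; rewrite /= mul0r subr0.
rewrite !ReZ ler_wpM2l ?invr_ge0 ?(ltW (twopi_gt0 R))//.
rewrite /cint /=; apply: le_Rintegral => //.
- by apply: integrable_Re; apply: circle_rcont.
- by apply: integrable_Re; apply: circle_rcont.
- by move=> x _; apply: fg; rewrite normc_polar.
Qed.

End CircleMeanReal.

Section Szego.
Variable R : realType.
Local Notation C := R[i].
Local Notation Re := (@complex.Re R).
Local Notation Im := (@complex.Im R).
Implicit Types (s e d S : R) (z t : C).
Variable w : C -> R.
Hypothesis w_analytic : analytic_weight w.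

Lemma weight_gt0 t : normc t = 1 -> 0 < w t.
Proof. by case: w_analytic => h _; exact: h. Qed.

(* Radial extension of log w, so that it is continuous in a neighbourhood. *)
Definition log_weight t : C := (ln (w (t / (normc t)%:C)))%:C.

Lemma log_weightE t : normc t = 1 -> log_weight t = (ln (w t))%:C.
Proof. by move=> t1; rewrite /log_weight t1 divr1. Qed.

Lemma ccont_normc z : ccont (fun t => (normc t)%:C) z.
Proof.
move=> e e0; exists e => // t h; rewrite -rmorphB normc_real; apply: le_lt_trans h.
rewrite ler_norml; have := ler_dist_normc t z; have := ler_dist_normc z t.
by rewrite (normcB z t) => *; lra.
Qed.

Lemma log_weight_cont t : normc t = 1 -> ccont log_weight t.
Proof.
move=> t1; have [_ [U [W [oU cU hW _ Ww]]]] := w_analytic.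
have t0 : t != 0 by rewrite -normc_gt0 t1.
pose p u : C := u / (normc u)%:C.
have p1 u : u != 0 -> normc (p u) = 1.
  rewrite -normc_gt0 => u0; rewrite /p normcM normcV normc_real ger0_norm ?ltW//.
  by rewrite divff// gt_eqF.
have pt : p t = t by rewrite /p t1 divr1.
have hp : ccont p t.
  apply: ccontM; first exact: ccont_id.
  apply: ccontV; last exact: ccont_normc.
  by rewrite t1 oner_neq0.
have hWp : ccont (fun u => W (p u)) t.
  apply: ccont_comp => //; rewrite pt; apply: cdiff_cont; apply/cdiffP.
  by apply: hW; apply: cU.
move=> e e0; have w0 := weight_gt0 t1.
have /(continuous_ln)/= : 0 < w t by [].
move=> /(_ (ball (ln (w t)) e)); rewrite /= => /(_ (nbhsx_ballx _ _ e0)).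
move=> /nbhs_ballP[d /= d0 Hd].
have [d' d'0 Hd'] := hWp _ d0.
exists (Num.min d' 1); first by rewrite lt_min d'0 ltr01.
move=> u; rewrite lt_min => /andP[hu hu1].
have u0 : u != 0.
  by apply: contraTneq hu1 => ->; rewrite sub0r normcN t1 ltxx.
rewrite /log_weight -/(p u) -/(p t) -rmorphB normc_real pt.
have : ball (w t) d (w (p u)).
  rewrite -ball_normE /ball_/= distrC -normc_real rmorphB /= -!Ww; last 2 first.
  - by [].
  - by rewrite /circle /= p1.
  by have := Hd' _ hu; rewrite pt.
by move=> /Hd /=; rewrite -ball_normE /ball_/= distrC.
Qed.

Let lw_cont : ccont_circle 1 log_weight.
Proof. by move=> t; exact: log_weight_cont. Qed.

Definition szego_exponent z : C :=
  cmean 1 (fun t => log_weight t * (t / (t - z))) - 2^-1 * cmean 1 log_weight.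

Arguments szego_exponent : simpl never.

Let lwk_cont z : normc z != 1 -> ccont_circle 1 (fun t => log_weight t * (t / (t - z))).
Proof.
move=> z1 t t1; apply: ccontM; first exact: lw_cont.
by apply: ccont_kernel; apply: normc_neq; rewrite t1 eq_sym.
Qed.

Lemma szego_exponentE z : normc z != 1 ->
  szego_exponent z = 2^-1 * cmean 1 (fun t => log_weight t * ((t + z) / (t - z))).
Proof.
move=> z1; rewrite (@eq_cmean _ _ _ (fun t =>
   2 * (log_weight t * (t / (t - z))) - log_weight t))//; last first.
  move=> t t1; have tz : t - z != 0 by apply: sub_neq0; rewrite t1.
  by field.
have c2 : ccont_circle 1 (fun t => 2 * (log_weight t * (t / (t - z)))).
  by move=> t t1; apply: ccontM; [exact: ccont_cst|exact: lwk_cont].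
rewrite cmeanB// cmeanZ//; last exact: lwk_cont.
by rewrite mulrBr mulrA mulVf ?mul1r// pnatr_eq0.
Qed.

Lemma szegoE z : normc z != 1 -> szego w z = cexp (szego_exponent z).
Proof.
move=> z1; rewrite szego_exponentE// /szego; congr cexp.
rewrite /cmean mulrA; congr (_ * _).
  rewrite -[2^-1 : C]/((2 : C)^-1) -(rmorph_nat (real_complex R) 2) -fmorphV -rmorphM.
  by congr (_%:C); rewrite /= -invfM mulrA -natrM.
apply: eq_cint => x _; rewrite mul1r log_weightE// normc_cis.
by [].
Qed.

Lemma szego_neq0 z : szego w z != 0.
Proof. exact: cexp_neq0. Qed.

Lemma szego_cdiff z : normc z != 1 -> cdiff (szego w) z.
Proof.
move=> z1; have d0 : 0 < `|normc z - 1| by rewrite normr_gt0 subr_eq0.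
apply: (@cdiff_near _ (fun z => cexp (szego_exponent z)) _ _ _ d0).
  move=> t ht; rewrite szegoE//; apply: contraTneq ht => t1; rewrite -leNgt -t1.
  rewrite normcB ler_norml; have := ler_dist_normc t z; have := ler_dist_normc z t.
  by rewrite (normcB t z) => *; lra.
apply: cdiff_comp; last exact: cdiff_cexp.
apply: cdiffB; last exact: cdiff_cst.
exact: cauchy_transform_cdiff'.
Qed.

Lemma conj_cexp z : conjc (cexp z) = cexp (conjc z).
Proof. by case: z => a b; rewrite /cexp /conjc /= cosN sinN mulrN. Qed.

Lemma cexpN z : cexp (- z) = (cexp z)^-1.
Proof.
apply: (mulfI (cexp_neq0 z)); rewrite -cexpD subrr cexp0 divff//.
exact: cexp_neq0.
Qed.

Lemma conj_log_weight t : conjc (log_weight t) = log_weight t.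
Proof. by rewrite /log_weight conjc_real. Qed.

Lemma conj_half : conjc (2^-1 : C) = 2^-1.
Proof. by rewrite fmorphV /= conjc_nat. Qed.

Lemma szego_reflect z : z != 0 -> normc z != 1 ->
  conjc (szego w (conjc z)^-1) = (szego w z)^-1.
Proof.
move=> z0 z1; have zc0 : conjc z != 0 by rewrite conjc_eq0.
have z1' : normc (conjc z)^-1 != 1.
  by rewrite normcV normc_conj; apply: contra z1 => /eqP h; rewrite -(invrK (normc z)) h invr1.
have tz t y : normc y != 1 -> normc t = 1 -> t - y != 0.
  by move=> y1 t1; apply: sub_neq0; rewrite t1.
rewrite !szegoE// conj_cexp -cexpN; congr cexp.
rewrite !szego_exponentE// rmorphM /= conj_half -mulrN; congr (_ * _).
have Kc y : normc y != 1 -> ccont_circle 1 (fun t => log_weight t * ((t + y) / (t - y))).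
  move=> y1 t t1; apply: ccontM; first exact: lw_cont.
  by cc; exact: tz.
rewrite cmean_conj//; last exact: Kc.
rewrite -mulN1r -cmeanZ//; last exact: Kc.
apply: eq_cmean => // t t1.
rewrite !(rmorphM, rmorphD, rmorphN, fmorphV) /= conj_log_weight !conjcK.
have tc : conjc t = t^-1.
  have t0 : t != 0 by rewrite -normc_gt0 t1.
  by apply: (mulfI t0); rewrite divff// mulcJ t1 expr1n.
have t0 : t != 0 by rewrite -normc_gt0 t1.
have := tz t z z1 t1 => tz0.
have tz1 : z - t != 0 by rewrite -oppr_eq0 opprB.
have tz2 : t * z != 0 by rewrite mulf_neq0.
have e1 : t^-1 - z^-1 = - ((t - z) / (t * z)) by field; rewrite t0 z0.
have e2 : t^-1 + z^-1 = (t + z) / (t * z) by field; rewrite t0 z0.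
by rewrite tc e1 e2 invrN invf_div mulrN [X in - X]mulrA divfK// mulrN mulN1r.
Qed.

Lemma szego0_real : conjc (szego w 0) = szego w 0.
Proof.
have n01 : normc (0 : C) != 1 by rewrite normc0 eq_sym oner_neq0.
rewrite szegoE// conj_cexp; congr cexp.
rewrite rmorphB [X in _ - X = _]rmorphM /= conj_half !cmean_conj//; last exact: lwk_cont.
congr (_ - _ * _); apply: eq_cmean => // t t1; last exact: conj_log_weight.
have t0 : t != 0 by rewrite -normc_gt0 t1.
by rewrite subr0 divff// mulr1 conj_log_weight.
Qed.

Lemma szego_oo : ctends (szego w) (szego w 0)^-1.
Proof.
have n01 : normc (0 : C) != 1 by rewrite normc0 eq_sym oner_neq0.
have hc : ccont (fun u => (conjc (szego w (conjc u)))^-1) 0.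
  apply: ccontV; first by rewrite conjc0 conjc_eq0 szego_neq0.
  apply: (@ccont_comp _ (fun u => szego w (conjc u)) (@conjc R)); last exact: ccont_conj.
  apply: ccont_comp; first exact: ccont_conj.
  by rewrite conjc0; apply: cdiff_cont; exact: szego_cdiff.
apply/ctendsP => e /hc[d d0 Hd]; exists (Num.max 2 (d^-1 + 1)) => z.
rewrite ge_max => /andP[z2 zd].
have z0 : 0 < normc z by apply: lt_le_trans z2.
have z1 : normc z != 1 by rewrite gt_eqF// (lt_le_trans _ z2)// ltr1n.
have zn0 : z != 0 by rewrite -normc_gt0.
have := Hd z^-1; rewrite subr0 conjc0 szego0_real fmorphV /= szego_reflect// invrK.
apply; rewrite normcV -ltf_pV2 ?posrE ?invr_gt0// invrK.
by apply: lt_le_trans zd; rewrite ltrDl.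
Qed.

Lemma Re_schwarz_kernel z t : normc t = 1 -> normc z != 1 ->
  Re ((t + z) / (t - z)) = - ((normc z ^+ 2 - 1) / normc (t - z) ^+ 2).
Proof.
move=> t1 z1; have tz : t - z != 0 by apply: sub_neq0; rewrite t1.
have n0 : (normc (t - z) ^+ 2)%:C != 0 :> C.
  by rewrite -mulcJ mulf_neq0// conjc_eq0.
have -> : (t + z) / (t - z) = ((normc (t - z) ^+ 2)^-1)%:C * ((t + z) * conjc (t - z)).
  rewrite fmorphV /= -mulcJ invfM mulrACA [(t - z)^-1 * _]mulrC.
  by rewrite [(conjc _)^-1 * _]mulVf ?mulr1// conjc_eq0.
rewrite -[normc z ^+ 2 - 1]opprB mulNr opprK [X in _ = X]mulrC.
rewrite -[1](expr1n _ 2) -t1 !normc_sqr.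
by case: t {t1 tz n0} => a b; case: z {z1} => c d /=; ring.
Qed.

Lemma normc_dilate z t S : normc t = 1 -> normc z = 1 -> 1 <= S ->
  normc (t - z) <= normc (t - S%:C * z).
Proof.
move=> t1 z1 S1; rewrite -(@ler_pXn2r _ 2)// ?nnegrE ?normc_ge0// !normc_sqr.
have := normc_sqr t; have := normc_sqr z; rewrite t1 z1 !expr1n.
case: t {t1} => a b; case: z {z1} => c d /= e1 e2.
have h : a * c + b * d <= 1.
  have := sqr_ge0 (a - c); have := sqr_ge0 (b - d); rewrite !sqrrB => h1 h2.
  rewrite -!mulrnAr in h1 h2; lra.
rewrite -subr_ge0 (_ : _ - _ = (S ^+ 2 - 1) * (c ^+ 2 + d ^+ 2) - (S - 1) * (a * c + b * d) *+ 2); last by ring.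
rewrite -e1 mulr1 (_ : _ - _ = (S - 1) * (S + 1 - (a * c + b * d) *+ 2)); last by ring.
by apply: mulr_ge0; [rewrite subr_ge0|rewrite mulr2n; lra].
Qed.

(* Korovkin-type argument: |t - z|^2 times the Poisson kernel at S z is at most S^2 - 1. *)
Lemma poisson_limit z : normc z = 1 -> forall e, 0 < e -> exists2 k, 0 < k &
  forall S, 1 < S -> `|Re (szego_exponent (S%:C * z)) *+ 2 + ln (w z)| <= e + k * (S ^+ 2 - 1).
Proof.
move=> z1 e e0; pose c : C := (ln (w z))%:C.
have hg t : normc t = 1 -> ccont (fun t => log_weight t - c) t.
  by move=> t1; apply: ccontB; [exact: lw_cont|exact: ccont_cst].
have [M M0 HM] := compact_normc_bounded (@circle_compact R 1) hg.
have [d d0 Hd] := log_weight_cont z1 e0.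
exists (M / d ^+ 2); first by rewrite divr_gt0// exprn_gt0.
move=> S S1; pose y := S%:C * z.
have S0 : 0 < S by exact: lt_trans S1.
have yS : normc y = S by rewrite normcM z1 mulr1 normc_real ger0_norm ?ltW.
have y1 : normc y != 1 by rewrite yS gt_eqF.
pose K t : C := (t + y) / (t - y).
have Kc : ccont_circle 1 K.
  by move=> t t1; rewrite /K; cc; apply: sub_neq0; rewrite t1.
have K1 : cmean 1 K = -1.
  rewrite (@eq_cmean _ _ _ (fun t => 2 * (t / (t - y)) - 1))//; last first.
    move=> t t1; have tz : t - y != 0 by apply: sub_neq0; rewrite t1.
    by rewrite /K; field.
  have kc : ccont_circle 1 (fun t => t / (t - y)).
    by move=> t t1; apply: ccont_kernel; apply: normc_neq; rewrite t1 eq_sym.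
  rewrite cmeanB//; first last.
  - by move=> t t1; exact: ccont_cst.
  - by move=> t t1; apply: ccontM; [exact: ccont_cst|exact: kc].
  by rewrite cmeanZ// cmean_kernel_out ?yS// mulr0 cmean_cst sub0r.
have gKc : ccont_circle 1 (fun t => (log_weight t - c) * K t).
  by move=> t t1; apply: ccontM; [exact: hg|exact: Kc].
have E : Re (szego_exponent y) *+ 2 + ln (w z) = Re (cmean 1 (fun t => (log_weight t - c) * K t)).
  rewrite (_ : (fun t => _) = fun t => log_weight t * K t - c * K t); last first.
    by apply/funext => t; rewrite mulrBl.
  have c1 : ccont_circle 1 (fun t => log_weight t * K t).
    by move=> t t1; apply: ccontM; [exact: lw_cont|exact: Kc].
  rewrite cmeanB//; last by move=> t t1; apply: ccontM; [exact: ccont_cst|exact: Kc].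
  rewrite cmeanZ// K1 mulrN1 opprK -raddfMn.
  have -> : szego_exponent y *+ 2 = cmean 1 (fun t => log_weight t * K t).
    by rewrite szego_exponentE// -/K -mulrnAl -mulr_natl divff ?mul1r// pnatr_eq0.
  by move: (cmean _ _) => v; rewrite raddfD.
rewrite -/y E.
pose h t : C := - e%:C * K t + (M / d ^+ 2 * (S ^+ 2 - 1))%:C.
have hc : ccont_circle 1 h.
  move=> t t1; apply: ccontD; last exact: ccont_cst.
  by apply: ccontM; [exact: ccont_cst|exact: Kc].
have hE : Re (cmean 1 h) = e + M / d ^+ 2 * (S ^+ 2 - 1).
  rewrite cmeanD//; first last.
  - by move=> t t1; exact: ccont_cst.
  - by move=> t t1; apply: ccontM; [exact: ccont_cst|exact: Kc].
  by rewrite cmeanZ// K1 mulrN1 opprK cmean_cst.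
have key t : normc t = 1 -> `|Re ((log_weight t - c) * K t)| <= Re (h t).
  move=> t1; rewrite log_weightE// -rmorphB /=.
  have ReZ (k : R) x : Re (k%:C * x) = k * Re x by case: x => a b; rewrite /= mul0r subr0.
  have -> : Re (h t) = - e * Re (K t) + M / d ^+ 2 * (S ^+ 2 - 1).
    by rewrite /h raddfD /= -rmorphN ReZ.
  have S21 : 0 <= S ^+ 2 - 1 by rewrite subr_ge0 expr_ge1// ltW.
  have tz : 0 < normc (t - y) ^+ 2.
    by rewrite exprn_gt0// normc_gt0; apply: sub_neq0; rewrite t1.
  rewrite ReZ /K Re_schwarz_kernel// yS mulrNN normrM normrN.
  set P := (S ^+ 2 - 1) / _.
  have P0 : 0 <= P by rewrite divr_ge0// ltW.
  rewrite (ger0_norm P0).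
  have tzP : normc (t - z) ^+ 2 * P <= S ^+ 2 - 1.
    rewrite /P mulrCA ler_piMr// ler_pdivrMr// mul1r lerXn2r ?nnegrE ?normc_ge0//.
    by rewrite /y normc_dilate// ltW.
  have k0 : 0 <= M / d ^+ 2 by rewrite divr_ge0 ?ltW// exprn_gt0.
  have nE : `|ln (w t) - ln (w z)| = normc (log_weight t - c).
    by rewrite log_weightE// -rmorphB normc_real.
  have [hd|hd] := ltP (normc (t - z)) d.
    have {}hd := Hd _ hd; rewrite (log_weightE z1) -/c -nE in hd.
    apply: ler_wpDr; first by rewrite mulr_ge0.
    by rewrite ler_wpM2r// ltW.
  apply: ler_wpDl; first by rewrite mulr_ge0// ltW.
  apply: (@le_trans _ _ (M / d ^+ 2 * (normc (t - z) ^+ 2 * P))); last exact: ler_wpM2l.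
  rewrite mulrA ler_wpM2r// nE; apply: le_trans (HM _ t1) _.
  rewrite mulrAC ler_pdivlMr ?exprn_gt0// ler_wpM2l ?(ltW M0)//.
  by rewrite lerXn2r ?nnegrE ?normc_ge0// ltW.
rewrite -hE ler_norml; apply/andP; split.
  have ReN x : - Re x = Re (-1 * x) by rewrite mulN1r; case: x.
  rewrite ReN -cmeanZ//; apply: Re_cmean_le => //.
    by move=> t t1; apply: ccontM; [exact: ccont_cst|exact: hc].
  by move=> t /key; rewrite ler_norml -ReN => /andP[].
by apply: Re_cmean_le => // t /key; rewrite ler_norml => /andP[].
Qed.

Lemma szego_boundary (De : C -> C) z : normc z = 1 -> ccont De z ->
  (forall t, 1 < normc t -> De t = szego w t) -> normc (De z) ^+ 2 * w z = 1.
Proof.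
move=> z1 hD DE; have w0 := weight_gt0 z1.
have nS S : 1 < S -> normc (S%:C * z) = S.
  by move=> S1; rewrite normcM z1 mulr1 normc_real ger0_norm// ltW// (lt_trans ltr01).
have nDe S : 1 < S -> normc (De (S%:C * z)) ^+ 2 = expR (Re (szego_exponent (S%:C * z)) *+ 2).
  move=> S1; rewrite DE ?nS// szegoE ?nS ?gt_eqF// normc_cexp.
  by rewrite -expRM_natl mulr_natl.
have lim1 : Re (szego_exponent (S%:C * z)) *+ 2 @[S --> (1:R)^'+] --> - ln (w z).
  apply/cvgrPdist_le => e e0.
  have e2 : 0 < e / 2 by rewrite divr_gt0.
  have [k k0 Hk] := poisson_limit z1 e2.
  pose d := Num.min 1 (e / 2 / (3 * k)).
  have d0 : 0 < d by rewrite lt_min ltr01 !divr_gt0// mulr_gt0.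
  near=> S.
  have S1 : 1 < S by near: S; exact: nbhs_right_gt.
  have Sd : S < 1 + d by near: S; apply: nbhs_right_lt; rewrite ltrDl.
  rewrite -opprD normrN addrC; apply: le_trans (Hk S S1) _.
  have d1 : d <= 1 by rewrite ge_min lexx.
  have dk : d <= e / 2 / (3 * k) by rewrite ge_min lexx orbT.
  rewrite [leRHS](splitr e) lerD2l.
  have h : S ^+ 2 - 1 <= 3 * d.
    rewrite (_ : S ^+ 2 - 1 = (S + 1) * (S - 1)); last by ring.
    by apply: ler_pM; lra.
  apply: le_trans (ler_wpM2l (ltW k0) h) _.
  rewrite mulrCA mulrA -ler_pdivlMl ?mulr_gt0//.
  by rewrite mulrC.
have lim2 : expR (Re (szego_exponent (S%:C * z)) *+ 2) @[S --> (1:R)^'+] --> expR (- ln (w z)).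
  exact: (continuous_cvg _ (@continuous_expR R _) lim1).
have lim3 : normc (De (S%:C * z)) @[S --> (1:R)^'+] --> normc (De z).
  apply/cvgrPdist_le => e e0; have [d d0 Hd] := hD _ e0.
  near=> S.
  have S1 : 1 < S by near: S; exact: nbhs_right_gt.
  have Sd : S < 1 + d by near: S; apply: nbhs_right_lt; rewrite ltrDl.
  have : normc (De (S%:C * z) - De z) < e.
    apply: Hd; rewrite -[X in _ - X]mul1r -mulrBl normcM z1 mulr1 -rmorphB normc_real.
    by rewrite gtr0_norm ?subr_gt0// ltrBlDl.
  move=> h; apply: le_trans (ltW h); rewrite ler_norml.
  have := ler_dist_normc (De z) (De (S%:C * z)); have := ler_dist_normc (De (S%:C * z)) (De z).
  by rewrite (normcB (De z)) => *; lra.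
have lim4 : normc (De (S%:C * z)) ^+ 2 @[S --> (1:R)^'+] --> normc (De z) ^+ 2.
  by rewrite expr2; under eq_fun do rewrite expr2; exact: (@cvgM R _ _ _ _ _ _ _ lim3 lim3).
have -> : normc (De z) ^+ 2 = expR (- ln (w z)).
  apply: (@cvg_unique _ _ (normc (De (S%:C * z)) ^+ 2 @[S --> (1:R)^'+])) => //.
  apply: cvg_trans lim2; apply: near_eq_cvg; near=> S.
  by rewrite nDe//; near: S; exact: nbhs_right_gt.
by rewrite expRN lnK ?posrE// mulVf// gt_eqF.
Unshelve. all: by end_near.
Qed.

End Szego.

(** * Poles *)

Section Poles.
Variable R : realType.
Local Notation C := R[i].
Implicit Types (s e d : R) (z t : C) (f g : C -> C).

Lemma taylor_remainder g (c : C) d m : 0 < d -> (forall z, normc (z - c) < d -> cdiff g z) ->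
  exists gam : nat -> C, exists2 r : C -> C, ccont r c &
    gam 0%N = g c /\ forall z, normc (z - c) < d / 2 ->
      g z = \sum_(j < m) gam j * (z - c) ^+ j + (z - c) ^+ m * r z.
Proof.
move=> d0 hg; pose G t := g (c + t); pose s := d / 2.
have s0 : 0 < s by rewrite divr_gt0.
have sd : s < d by rewrite ltr_pdivrMr// ltr_pMr// ltr1n.
have hG t : normc t <= s -> cdiff G t.
  move=> ts; apply: (@cdiff_comp _ (fun t => c + t) g); first by cd.
  by apply: hg; rewrite addrAC subrr add0r; exact: le_lt_trans ts _.
have Gc t : normc t <= s -> ccont G t by move/hG/cdiff_cont.
have GcX j : ccont_circle s (fun t => G t / t ^+ j).
  move=> t ts; apply: ccontM; first by apply: Gc; rewrite ts.
  by cc; rewrite expf_neq0// -normc_gt0 ts.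
pose r z := cmean s (fun t => G t / t ^+ m * (t / (t - (z - c)))).
exists (fun j => cmean s (fun t => G t / t ^+ j)), r.
  apply: (@ccont_comp _ (fun z => z - c)
    (fun y => cmean s (fun t => G t / t ^+ m * (t / (t - y))))); first by cc.
  apply: cdiff_cont; apply: (cauchy_transform_cdiff' (ltW s0)); last exact: GcX.
  by rewrite subrr normc0 lt_eqF.
split.
  transitivity (cmean s G).
    by apply: eq_cmean; [exact: ltW|move=> t _; rewrite expr0 divr1].
  rewrite -(@cmean_eq R [::] 0 s G (lexx 0) (ltW s0)).
  - by rewrite cmean0 /G addr0.
  - by move=> t /andP[_]; exact: Gc.
  - by move=> t /andP[_ /ltW h] _; exact: hG.
move=> z hz; pose y := z - c.
have yn t : normc t = s -> t - y != 0.
  by move=> ts; apply: sub_neq0; rewrite ts lt_eqF.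
have -> : g z = G y by rewrite /G /y addrC subrK.
rewrite -(@cauchy_disk R [::] G s y)//; first last.
- by move=> _; apply: hG; exact: ltW.
- by move=> t /andP[_ /ltW h] _; exact: hG.
have kc : ccont_circle s (fun t => t / (t - y)).
  by move=> t ts; apply: ccont_kernel; rewrite -subr_eq0 yn.
have c1 (j : nat) : ccont_circle s (fun t => G t / t ^+ j * y ^+ j).
  by move=> t ts; apply: ccontM; [exact: GcX|exact: ccont_cst].
have c2 : ccont_circle s (fun t => y ^+ m * (G t / t ^+ m * (t / (t - y)))).
  move=> t ts; apply: ccontM; first exact: ccont_cst.
  by apply: ccontM; [exact: GcX|exact: kc].
have c3 : ccont_circle s (fun t => \sum_(j < m) (G t / t ^+ j * y ^+ j)).
  by move=> t ts; apply: ccont_sum => j; exact: c1.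
rewrite /r -/y -cmeanZ; [|exact: ltW|]; last first.
  by move=> t ts; apply: ccontM; [exact: GcX|exact: kc].
rewrite (eq_bigr (fun j : 'I_m => cmean s (fun t => G t / t ^+ j * y ^+ j))); last first.
  move=> j _; rewrite mulrC -cmeanZ; [|exact: ltW|exact: GcX].
  by apply: eq_cmean; [exact: ltW|move=> t _; rewrite mulrC].
rewrite -cmean_sum; [|exact: ltW|by move=> j; exact: c1].
rewrite -cmeanD; [|exact: ltW|exact: c3|exact: c2].
apply: eq_cmean; first exact: ltW.
move=> t ts; have t0 : t != 0 by rewrite -normc_gt0 ts.
have ty := yn _ ts.
rewrite (eq_bigr (fun j : 'I_m => G t * (y / t) ^+ j)); last first.
  by move=> j _; rewrite expr_div_n; ring.
rewrite -mulr_sumr.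
have yt : 1 - y / t != 0.
  have -> : 1 - y / t = (t - y) / t by field.
  by rewrite mulf_neq0// invr_eq0.
have -> : \sum_(j < m) (y / t) ^+ j = (1 - (y / t) ^+ m) / (1 - y / t).
  have := subrXX 1 (y / t) m; rewrite expr1n => ->.
  rewrite mulrAC divff// mul1r; apply: eq_bigr => j _.
  by rewrite expr1n mul1r.
rewrite expr_div_n; field.
by rewrite t0 ty expf_neq0.
Qed.

Lemma finite_separation (a : nat -> C) u z : exists2 d, 0 < d &
  forall t, normc (t - z) < d -> forall k, (1 <= k <= u)%N -> a k != z -> t != a k.
Proof.
elim: u => [|u [d d0 Hd]].
  by exists 1 => // t _ k /andP[k1 k0]; have := leq_trans k1 k0.
have [e|e] := eqVneq (a u.+1) z.
  exists d => // t ht k /andP[k1]; rewrite leq_eqVlt => /predU1P[-> |ku].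
    by rewrite e eqxx.
  by apply: Hd => //; rewrite k1.
exists (Num.min d (normc (a u.+1 - z))).
  by rewrite lt_min d0 normc_gt0 subr_eq0.
move=> t; rewrite lt_min => /andP[h1 h2] k /andP[k1]; rewrite leq_eqVlt => /predU1P[-> |ku].
  by move=> _; apply: contraTneq h2 => ->; rewrite ltxx.
by apply: Hd => //; rewrite k1.
Qed.

Lemma polar_decomposition (F : C -> C) (D : set C) (a : nat -> C) (u m : nat)
    (g : nat -> C -> C) :
  (forall z, D z -> (forall k, (1 <= k <= u)%N -> z != a k) -> cdiff F z) ->
  (forall j k, (1 <= j <= u)%N -> (1 <= k <= u)%N -> a j = a k -> j = k) ->
  (forall k, (1 <= k <= u)%N -> exists2 d, 0 < d & forall z, normc (z - a k) < d ->
     cdiff (g k) z /\ (z != a k -> F z = g k z / (z - a k) ^+ m)) ->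
  exists gam : nat -> nat -> C, exists Freg : C -> C,
    [/\ forall k, (1 <= k <= u)%N -> gam k 0%N = g k (a k),
        forall z, D z -> ccont Freg z,
        forall z, D z -> (forall k, (1 <= k <= u)%N -> z != a k) -> cdiff Freg z &
        forall z, (forall k, (1 <= k <= u)%N -> z != a k) ->
          F z = \sum_(1 <= k < u.+1) \sum_(j < m) gam k j / (z - a k) ^+ (m - j) + Freg z].
Proof.
move=> hF ainj hg.
have ex k : exists p : R * (nat -> C) * (C -> C), (1 <= k <= u)%N ->
    [/\ 0 < p.1.1, ccont p.2 (a k), p.1.2 0%N = g k (a k) &
    forall z, normc (z - a k) < p.1.1 -> z != a k ->
      F z = (\sum_(j < m) p.1.2 j * (z - a k) ^+ j + (z - a k) ^+ m * p.2 z) / (z - a k) ^+ m].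
  case: (boolP (1 <= k <= u)%N) => hk; last by exists (0, fun=> 0, fun=> 0).
  have [d d0 Hd] := hg k hk.
  have [|gam [r rc [g0 Hg]]] := @taylor_remainder (g k) (a k) d m d0.
    by move=> z /Hd[].
  exists (d / 2, gam, r) => _; split => //; first by rewrite divr_gt0.
  move=> z hz zk; rewrite -Hg//; apply: (Hd z _).2 => //.
  by apply: lt_trans hz _; rewrite ltr_pdivrMr// ltr_pMr// ltr1n.
have [dat Hdat] := choice ex.
pose gam k := (dat k).1.2; pose r k := (dat k).2; pose dd k := (dat k).1.1.
pose PP k z := \sum_(j < m) gam k j / (z - a k) ^+ (m - j).
pose F0 z := F z - \sum_(1 <= k < u.+1) PP k z.
pose Rk k z := r k z - \sum_(1 <= i < u.+1 | i != k) PP i z.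
have exV z : exists v, forall k, (1 <= k <= u)%N -> z = a k -> v = Rk k (a k).
  case: (pselect (exists2 k, (1 <= k <= u)%N & z = a k)) => [[k hk ->]|nk].
    by exists (Rk k (a k)) => i hi /ainj <-.
  by exists 0 => k hk zk; case: nk; exists k.
have [V HV] := choice exV.
pose isp z := `[< exists2 k, (1 <= k <= u)%N & z = a k >].
have ispN z : (forall k, (1 <= k <= u)%N -> z != a k) -> isp z = false.
  by move=> h; apply/asboolP => -[k /h /eqP].
have ispP z k : (1 <= k <= u)%N -> z = a k -> isp z.
  by move=> hk zk; apply/asboolP; exists k.
pose Freg z := if isp z then V z else F0 z.
have PPd k z : z != a k -> cdiff (PP k) z.
  by move=> zk; apply: cdiff_sum => j; cd; rewrite expf_neq0// subr_eq0.
have PPF0 k z : (1 <= k <= u)%N -> z != a k -> normc (z - a k) < dd k -> F0 z = Rk k z.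
  move=> hk zk hz; have [_ _ _ H] := Hdat k hk.
  rewrite /F0 /Rk H//.
  have -> : \sum_(1 <= i < u.+1) PP i z = PP k z + \sum_(1 <= i < u.+1 | i != k) PP i z.
    by rewrite (bigD1_seq k)//= ?mem_index_iota ?iota_uniq//= ltnS.
  have z0 : z - a k != 0 by rewrite subr_eq0.
  rewrite mulrDl mulrAC divff ?expf_neq0// mul1r mulr_suml.
  rewrite (eq_bigr (fun j : 'I_m => gam k j / (z - a k) ^+ (m - j))); last first.
    move=> j _; rewrite -mulrA; congr (_ * _).
    have -> : (z - a k) ^+ m = (z - a k) ^+ j * (z - a k) ^+ (m - j).
      by rewrite -exprD subnKC// ltnW.
    by rewrite invfM mulrA divff ?mul1r// expf_neq0.
  by rewrite -/(PP k z) -/(r k) opprD addrACA subrr add0r.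
have Fd z : D z -> (forall k, (1 <= k <= u)%N -> z != a k) -> cdiff Freg z.
  move=> Dz hz; have [d d0 Hd] := finite_separation a u z.
  apply: (@cdiff_near _ F0 _ _ d d0).
    move=> t ht; rewrite /Freg ispN// => k hk; apply: Hd => //.
    by rewrite eq_sym hz.
  apply: cdiffB; first exact: hF.
  rewrite /F0; under eq_fun do rewrite big_nat_cond big_mkcond /=.
  apply: cdiff_sum => k.
  case: (boolP ((0 < k < u.+1)%N && true)) => [/andP[hk _]|_]; last exact: cdiff_cst.
  by apply: PPd; apply: hz; move: hk; rewrite ltnS.
exists gam, Freg; split => //.
- by move=> k /Hdat[].
- move=> z Dz; case: (pselect (exists2 k, (1 <= k <= u)%N & z = a k)) => [[k hk zk]|nk]; last first.
    apply: cdiff_cont; apply: Fd => // k hk; apply/eqP => zk; apply: nk; by exists k.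
  have [d d0 Hd] := finite_separation a u z.
  have [dk0 rc _ H] := Hdat k hk.
  apply: (@ccont_near _ (Rk k) _ _ (Num.min d (dd k))); first by rewrite lt_min d0.
    move=> t; rewrite lt_min => /andP[h1 h2]; have [tk|tk] := eqVneq t (a k).
      by rewrite /Freg (ispP _ _ hk tk) (HV _ _ hk tk) tk.
    rewrite /Freg ispN; first by rewrite (PPF0 k)// -zk.
    move=> i hi; have [ik|ik] := eqVneq i k; first by rewrite ik.
    apply: Hd => //; apply/eqP => ai; move/eqP: ik; apply; apply: ainj => //.
    by rewrite ai.
  apply: ccontB; first by rewrite zk.
  under eq_fun do rewrite big_nat_cond big_mkcond /=.
  apply: ccont_sum => i.
  case: (boolP ((0 < i < u.+1)%N && (i != k))) => [/andP[hi ik]|_]; last exact: ccont_cst.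
  apply: cdiff_cont; apply: PPd; rewrite zk; apply/eqP => ai.
  move/eqP: ik; apply; apply: ainj => //; move: hi; by rewrite ltnS.
- move=> z hz; rewrite /Freg ispN// /F0 addrC subrK//.
Qed.

Lemma expr_taylor (x c : C) n p : x ^+ n = \sum_(q < p) 'C(n, q)%:R * c ^+ (n - q) * (x - c) ^+ q
  + (x - c) ^+ p * \sum_(q < n.+1) 'C(n, p + q)%:R * c ^+ (n - (p + q)) * (x - c) ^+ q.
Proof.
pose T q := 'C(n, q)%:R * c ^+ (n - q) * (x - c) ^+ q.
have -> : x ^+ n = \sum_(q < n.+1) T q.
  rewrite -{1}(subrK c x) addrC exprDn; apply: eq_bigr => q _.
  by rewrite /T -mulr_natl mulrA.
have -> : (x - c) ^+ p * \sum_(q < n.+1) 'C(n, p + q)%:R * c ^+ (n - (p + q)) * (x - c) ^+ q =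
    \sum_(q < n.+1) T (p + q)%N.
  by rewrite mulr_sumr; apply: eq_bigr => q _; rewrite /T exprD; ring.
rewrite -(big_mkord xpredT T) -(big_mkord xpredT (fun q => T q)) -(big_mkord xpredT (fun q => T (p + q)%N)).
have -> : \sum_(0 <= q < n.+1) T (p + q)%N = \sum_(p <= q < p + n.+1) T q.
  by rewrite -{2}[p]add0n big_addn addKn; apply: eq_big_nat => i _; rewrite addnC.
rewrite -big_cat_nat//= ?leq_addr//.
rewrite (@big_cat_nat _ _ _ n.+1 0 (p + n.+1))//= ?leq_addl//.
rewrite [X in _ = _ + X]big1_seq ?addr0// => q.
rewrite mem_index_iota => /andP[_ /andP[nq _]].
by rewrite /T bin_small// !mul0r.
Qed.

Lemma cmean_power_pole s n p (c z : C) : normc c < s -> normc z < s -> z != c ->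
  cmean s (fun t => t ^+ n / (t - c) ^+ p * (t / (t - z))) =
  z ^+ n / (z - c) ^+ p - \sum_(q < p) 'C(n, q)%:R * c ^+ (n - q) / (z - c) ^+ (p - q).
Proof.
move=> cs zs zc; have s0 : 0 <= s by apply: le_trans (ltW zs); exact: normc_ge0.
pose Q t := \sum_(q < n.+1) 'C(n, p + q)%:R * c ^+ (n - (p + q)) * (t - c) ^+ q.
have Qd t : cdiff Q t by apply: cdiff_sum => q; cd.
have tc t : s <= normc t -> t - c != 0.
  by move=> ts; apply: sub_neq0; rewrite lt_eqF// (lt_le_trans cs).
have tz t : s <= normc t -> t != z.
  by move=> ts; apply: normc_neq; rewrite gt_eqF// (lt_le_trans zs).
have split_pole t : t - c != 0 -> t ^+ n / (t - c) ^+ p =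
    \sum_(q < p) 'C(n, q)%:R * c ^+ (n - q) / (t - c) ^+ (p - q) + Q t.
  move=> t0; rewrite {1}(expr_taylor t c n p) mulrDl -/(Q t).
  rewrite [X in _ + X]mulrAC divff ?expf_neq0// mul1r; congr (_ + _).
  rewrite mulr_suml; apply: eq_bigr => q _; rewrite -!mulrA; congr (_ * (_ * _)).
  have -> : (t - c) ^+ p = (t - c) ^+ q * (t - c) ^+ (p - q).
    by rewrite -exprD subnKC// ltnW.
  by rewrite invfM mulrA divff ?mul1r// expf_neq0.
rewrite split_pole ?subr_eq0// addrAC subrr add0r.
pose U q t := 'C(n, q)%:R * c ^+ (n - q) / (t - c) ^+ (p - q) * (t / (t - z)).
have Uc q t : s <= normc t -> ccont (U q) t.
  move=> ts; apply: ccontM; last exact: ccont_kernel (tz _ ts).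
  by cc; rewrite expf_neq0// tc.
have kc : ccont_circle s (fun t => Q t * (t / (t - z))).
  move=> t ts; apply: ccontM; first exact: cdiff_cont.
  by apply: ccont_kernel; apply: tz; rewrite ts.
rewrite (@eq_cmean _ _ _ (fun t => \sum_(q < p) U q t + Q t * (t / (t - z))))//; last first.
  by move=> t ts; rewrite split_pole ?tc ?ts// mulrDl mulr_suml.
rewrite cmeanD//; last first.
  by move=> t ts; apply: ccont_sum => q; apply: Uc; rewrite ts.
rewrite (@cauchy_disk R [::] Q s z)//; first last.
- by move=> t _; apply: cdiff_cont.
rewrite cmean_sum//; last by move=> q t ts; apply: Uc; rewrite ts.
rewrite big1 ?add0r// => q _.
apply: (@cmean_ext R [::] s (U q) 0 s0); first exact: Uc.
- move=> t /ltW ts _; apply: cdiffM; last exact: cdiff_kernel (tz _ ts).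
  by cd; rewrite expf_neq0// tc.
- rewrite -[X in ctends _ X](mul0r 1); apply: ctendsM; last exact: ctends_kernel.
  rewrite -[X in ctends _ X](mulr0 ('C(n, q)%:R * c ^+ (n - q))).
  apply: ctendsM; first exact: ctends_cst.
  have pq : (p - q)%N = (p - q).-1.+1 by rewrite prednK// subn_gt0.
  apply: (@ctends_near R (fun t => (t^-1 * (t / (t - c))) ^+ (p - q)) _ _ (s + 1)).
    move=> t ts; have ts' : s <= normc t by apply: le_trans ts; rewrite lerDl.
    have t0 : t != 0.
      by rewrite -normc_gt0; apply: lt_le_trans ts; rewrite ltr_wpDl.
    by rewrite mulrA mulVf// mul1r exprVn.
  have -> : (0 : C) = (0 * 1) ^+ (p - q) by rewrite mul0r pq exprS mul0r.
  apply: ctendsX; apply: ctendsM; [exact: ctends_inv|exact: ctends_kernel].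
Qed.

End Poles.

(** * Contribution of the poles *)

Section PoleAsymptotics.
Variable R : realType.
Local Notation C := R[i].
Implicit Types (s d : R) (z t : C).

Lemma bin_leq_exp n q : ('C(n, q) <= n ^ q)%N.
Proof.
elim: q n => [|q IH] n; first by rewrite bin0.
have h := mul_bin_left n q.
have h2 : (q.+1 * 'C(n, q.+1) <= n * n ^ q)%N by rewrite h; apply: leq_mul; rewrite ?leq_subr ?IH.
by rewrite expnS; apply: leq_trans h2; apply: leq_pmull.
Qed.

Lemma pole_term_bound rho (c z : C) n p q (e : nat) (eta : R) : 0 < rho < 1 -> normc c = rho ->
  (0 < n)%N -> (q < p)%N -> (e <= p.+1)%N -> 0 < eta <= 1 -> eta <= normc (z - c) ->
  normc ('C(n, q)%:R * c ^+ (n - q) / (z - c) ^+ e) <=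
    rho^-1 ^+ p * (n%:R ^+ p.-1 * rho ^+ n / eta ^+ p.+1).
Proof.
move=> /andP[rho0 rho1] cr n0 qp ep /andP[eta0 eta1] hz.
have rho10 : 0 <= rho by exact: ltW.
rewrite !normcM normcV !normcX cr normc_nat mulrA.
apply: ler_pM; rewrite ?mulr_ge0 ?exprn_ge0 ?invr_ge0 ?exprn_ge0 ?normc_ge0//; last first.
  rewrite lef_pV2 ?posrE ?exprn_gt0//; last by exact: lt_le_trans hz.
  apply: (@le_trans _ _ (eta ^+ e)).
    by apply: ler_wiXn2l => //; exact: ltW.
  by rewrite lerXn2r ?nnegrE ?normc_ge0 ?(ltW eta0).
have [qn|nq] := leqP q n; last first.
  by rewrite bin_small// mul0r !mulr_ge0 ?exprn_ge0 ?invr_ge0.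
rewrite mulrCA; apply: ler_pM; rewrite ?exprn_ge0//.
  rewrite -natrX ler_nat; apply: leq_trans (bin_leq_exp n q) _.
  by apply: leq_pexp2l => //; rewrite -ltnS prednK//; exact: leq_ltn_trans qp.
have -> : rho ^+ n = rho ^+ q * rho ^+ (n - q) by rewrite -exprD subnKC.
rewrite mulrA ler_peMl ?exprn_ge0//.
have -> : rho^-1 ^+ p = rho^-1 ^+ (p - q) * rho^-1 ^+ q by rewrite -exprD subnK// ltnW.
rewrite -mulrA -exprMn mulVf ?gt_eqF// expr1n mulr1.
by rewrite exprn_ege1// invf_ge1// ltW.
Qed.

Variables (rho rho' r : R) (De Gi : C -> C) (tau : C) (P : nat -> {poly C}).
Variables (a : nat -> C) (u p : nat) (g : nat -> C -> C).
Hypotheses (rho'0 : 0 <= rho') (rho'_rho : rho' < rho) (rho_r : rho < r) (r1 : r < 1).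
Hypothesis De_cdiff : forall z, rho' < normc z ->
  (forall k, (1 <= k <= u)%N -> z != a k) -> cdiff De z.
Hypothesis De_neq0 : forall z, 1 <= normc z -> De z != 0.
Hypothesis De_oo : ctends De tau.
Hypothesis Gi_cdiff : forall z, 0 < normc z < rho^-1 -> cdiff Gi z.
Hypothesis Gi_cont0 : ccont Gi 0.
Hypothesis Gi_neq0 : forall z, normc z <= 1 -> Gi z != 0.
Hypothesis tau_neq0 : tau != 0.
Hypothesis P_size : forall n, size (P n) = n.+1.
Hypothesis P_monic : forall n, (P n)`_n = 1.
Hypothesis P_orth : forall n j, (j < n)%N ->
  cmean 1 (fun t => (P n).[t] / (De t * Gi t) / t ^+ j) = 0.
Hypothesis a_rho : forall k, (1 <= k <= u)%N -> normc (a k) = rho.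
Hypothesis a_inj : forall j k, (1 <= j <= u)%N -> (1 <= k <= u)%N -> a j = a k -> j = k.
Hypothesis g_pole : forall k, (1 <= k <= u)%N -> exists2 d, 0 < d &
  forall z, normc (z - a k) < d ->
    cdiff (g k) z /\ (z != a k -> De z = g k z / (z - a k) ^+ p.+1).

Let rho0 : 0 < rho. Proof. exact: le_lt_trans rho'_rho. Qed.
Let rho1 : rho < 1. Proof. exact: lt_trans r1. Qed.
Let b k := g k (a k) / Gi (a k).
Let s := (1 + r) / 2.
Let rs : r < s. Proof. by have := r1; rewrite /s => h; lra. Qed.
Let s1 : s < 1. Proof. by have := r1; rewrite /s => h; lra. Qed.
Let rho_s : rho < s. Proof. exact: lt_trans rs. Qed.
Let s0 : 0 < s. Proof. exact: lt_trans rho_s. Qed.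

Let not_pole z : normc z != rho -> forall k, (1 <= k <= u)%N -> z != a k.
Proof. by move=> zr k hk; apply: normc_neq; rewrite a_rho. Qed.

Let De_cdiff_rho z : rho < normc z -> cdiff De z.
Proof.
move=> hz; apply: De_cdiff; first exact: lt_trans hz.
by apply: not_pole; rewrite gt_eqF.
Qed.

Let Gi_cont z : normc z < 1 -> ccont Gi z.
Proof.
move=> hz; have [->//|z0] := eqVneq z 0; apply: cdiff_cont; apply: Gi_cdiff.
by rewrite normc_gt0 z0 (lt_trans hz)// invf_gt1.
Qed.

Let F z := De z / Gi z.
Let dom := [set z | rho' < normc z < 1].

Let F_polar : exists gam : nat -> nat -> C, exists Freg : C -> C,
  [/\ forall k, (1 <= k <= u)%N -> gam k 0%N = b k,
      forall z, dom z -> ccont Freg z,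
      forall z, dom z -> (forall k, (1 <= k <= u)%N -> z != a k) -> cdiff Freg z &
      forall z, (forall k, (1 <= k <= u)%N -> z != a k) ->
        F z = \sum_(1 <= k < u.+1) \sum_(j < p.+1) gam k j / (z - a k) ^+ (p.+1 - j) + Freg z].
Proof.
apply: (@polar_decomposition _ F dom a u p.+1 (fun k z => g k z / Gi z)) => //.
- move=> z /andP[h1 h2] hz; apply: cdiffM; first exact: De_cdiff.
  apply: cdiffV; first by apply: Gi_neq0; exact: ltW.
  by apply: Gi_cdiff; rewrite (le_lt_trans rho'0)//= (lt_trans h2)// invf_gt1.
- move=> k hk; have [d d0 Hd] := g_pole hk.
  exists (Num.min d (Num.min rho (1 - rho))); first by rewrite !lt_min d0 rho0 subr_gt0.
  move=> z; rewrite !lt_min => /andP[h1 /andP[h2 h3]].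
  have z1 : normc z < 1.
    rewrite -(subrK (a k) z); apply: le_lt_trans (le_normcD _ _) _.
    by rewrite a_rho// -ltrBrDr.
  have z0 : 0 < normc z.
    rewrite normc_gt0; apply: contraTneq h2 => ->.
    by rewrite sub0r normcN a_rho// ltxx.
  have [gd ge] := Hd _ h1; split.
    apply: cdiffM => //; apply: cdiffV; first by apply: Gi_neq0; exact: ltW.
    by apply: Gi_cdiff; rewrite z0 (lt_trans z1)// invf_gt1.
  by move=> zk; rewrite /F ge// mulrAC.
Qed.

Let approx : exists2 c, 0 < c & forall n z, normc z <= r ->
  normc ((P n).[z] / Gi z - tau^-1 * cmean s (fun t => t ^+ n * F t * (t / (t - z))))
    <= c * (s * rho) ^+ n.
Proof.
have q1 : rho < Num.sqrt rho < 1.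
  have q0 : 0 < Num.sqrt rho by rewrite sqrtr_gt0.
  have E : Num.sqrt rho ^+ 2 = rho by rewrite sqr_sqrtr// ltW.
  have q1 : Num.sqrt rho < 1 by rewrite -[ltRHS]sqrtr1 ltr_sqrt.
  by rewrite q1 andbT -[X in X < _]E expr2 gtr_pMr.
have [|c c0 Hc] := @poly_cauchy_approx R rho De Gi tau P rho0 rho1 De_cdiff_rho De_neq0
    De_oo Gi_cdiff Gi_cont0 Gi_neq0 tau_neq0 P_size P_monic P_orth _ r s q1 _ rs.
  by rewrite rho_s s1.
by exists c => // n z /(Hc n); rewrite sqr_sqrtr// ltW.
Qed.

Let Gi_bounded : exists2 G, 0 < G & forall z, normc z <= r -> normc (Gi z) <= G.
Proof.
have Gc t : normc t = s -> ccont Gi t by move=> ts; apply: Gi_cont; rewrite ts.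
have [M M0 HM] : exists2 M, 0 < M & forall z, circle s z -> normc (Gi z) <= M.
  exact: compact_normc_bounded (@circle_compact R s) Gc.
have sr0 : 0 < s - r by rewrite subr_gt0.
exists (2 * (M * (s / (s - r)))).
  by apply: mulr_gt0 => //; apply: mulr_gt0 => //; exact: divr_gt0.
move=> z zr; have zs : normc z < s by exact: le_lt_trans rs.
have Gd t : t != 0 -> normc t < s -> cdiff Gi t.
  move=> t0 ts; apply: Gi_cdiff; rewrite normc_gt0 t0.
  by rewrite (lt_trans ts)// (lt_trans s1)// invf_gt1.
rewrite -(@cauchy_disk R [::] Gi s z)//; first last.
- by move=> z0; exact: Gd.
- by move=> t /andP[t0 ts] _; apply: Gd => //; rewrite -normc_gt0.
- by move=> t ts; apply: Gi_cont; exact: le_lt_trans s1.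
apply: le_trans (cauchy_bound (M := M) (ltW s0) _ Gc HM) _; first by rewrite lt_eqF.
apply: ler_wpM2l => //; apply: ler_wpM2l; first exact: ltW.
apply: ler_wpM2l; first exact: ltW.
have sz : s - r <= s - normc z by rewrite lerB.
have h : s - r <= `|normc z - s| by rewrite distrC ger0_norm// (le_trans (ltW sr0)).
by rewrite lef_pV2 ?posrE// (lt_le_trans sr0).
Qed.

Let term n k z : C := 'C(n, p)%:R * a k ^+ (n - p) * (b k / (a k - z)).

Let gam := sval (cid F_polar).
Let Freg := sval (cid (svalP (cid F_polar))).
Let F_spec := svalP (cid (svalP (cid F_polar))).

Let gam0 k : (1 <= k <= u)%N -> gam k 0%N = b k. Proof. by case: F_spec => h _ _ _; exact: h. Qed.
Let Freg_cont z : dom z -> ccont Freg z. Proof. by case: F_spec => _ h _ _; exact: h. Qed.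
Let Freg_cdiff z : dom z -> (forall k, (1 <= k <= u)%N -> z != a k) -> cdiff Freg z.
Proof. by case: F_spec => _ _ h _; exact: h. Qed.
Let FE z : (forall k, (1 <= k <= u)%N -> z != a k) ->
  F z = \sum_(1 <= k < u.+1) \sum_(j < p.+1) gam k j / (z - a k) ^+ (p.+1 - j) + Freg z.
Proof. by case: F_spec => _ _ _ h; exact: h. Qed.

Let T n k q (e : nat) z : C := 'C(n, q)%:R * a k ^+ (n - q) / (z - a k) ^+ e.
Let corr n z := \sum_(1 <= k < u.+1) \sum_(j < p.+1)
  gam k j * \sum_(q < p.+1 - j) T n k q (p.+1 - j - q) z.
Let rest n z := \sum_(1 <= k < u.+1)
  (gam k 0%N * \sum_(q < p) T n k q (p.+1 - q) z
   + \sum_(j < p) gam k j.+1 * \sum_(q < p - j) T n k q (p - j - q) z).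
Let sing n z := \sum_(1 <= k < u.+1) \sum_(j < p.+1)
  gam k j * (z ^+ n / (z - a k) ^+ (p.+1 - j)).

(* corr is the part of the Cauchy mean of the singular terms that is not z ^ n times them; its
   main contribution, -term, comes from j = 0 and q = p. *)
Let corrE n z : corr n z = - (\sum_(1 <= k < u.+1) term n k z) + rest n z.
Proof.
rewrite /corr /rest -sumrN -big_split /=; apply: eq_big_nat => k /andP[k1 ku].
rewrite big_ord_recl /= subn0 big_ord_recr /= mulrDr addrAC [LHS]addrC; congr (_ + _).
rewrite /T subSnn expr1 /term gam0; last by rewrite k1 -ltnS.
by rewrite -[a k - z]opprB invrN !mulrN; ring.
Qed.

Let circle_dom q : rho' < q -> q < 1 -> forall t, normc t = q -> dom t.
Proof. by move=> h1 h2 t tq; rewrite /dom /= tq h1 h2. Qed.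

Let cauchy_F n z : normc z < s -> (forall k, (1 <= k <= u)%N -> z != a k) ->
  cmean s (fun t => t ^+ n * F t * (t / (t - z))) =
  sing n z - corr n z + cmean s (fun t => t ^+ n * Freg t * (t / (t - z))).
Proof.
move=> zs hz.
have tz t : normc t = s -> t != z by move=> ts; apply: normc_neq; rewrite ts gt_eqF.
have tk t k : normc t = s -> (1 <= k <= u)%N -> t != a k.
  by move=> ts; apply: not_pole; rewrite ts gt_eqF.
have kc : ccont_circle s (fun t => t / (t - z)).
  by move=> t ts; apply: ccont_kernel; exact: tz.
pose V k j t : C := if (1 <= k <= u)%N then
   gam k j * (t ^+ n / (t - a k) ^+ (p.+1 - j) * (t / (t - z))) else 0.
have Vc k j : ccont_circle s (V k j).
  move=> t ts; rewrite /V; case: (boolP (1 <= k <= u)%N) => hk; last exact: ccont_cst.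
  apply: ccontM; first exact: ccont_cst.
  apply: ccontM; last exact: kc.
  by cc; rewrite expf_neq0// subr_eq0 tk.
have Fc : ccont_circle s Freg.
  by move=> t ts; apply: Freg_cont; apply: circle_dom ts => //; exact: lt_trans rho_s.
rewrite (@eq_cmean _ _ _ (fun t => \sum_(1 <= k < u.+1) \sum_(j < p.+1) V k j t
    + t ^+ n * Freg t * (t / (t - z)))); [|exact: ltW|]; last first.
  move=> t ts; rewrite FE; last by move=> k; exact: tk.
  rewrite mulrDr mulrDl; congr (_ + _).
  rewrite mulr_sumr mulr_suml; apply: eq_big_nat => k hk.
  rewrite mulr_sumr mulr_suml; apply: eq_bigr => j _.
  by rewrite /V -ltnS hk; ring.
rewrite cmeanD; [|exact: ltW| |]; first last.
- by move=> t ts; apply: ccontM; [cc; exact: Fc|exact: kc].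
- by move=> t ts; apply: ccont_sum => k; apply: ccont_sum => j; exact: Vc.
congr (_ + _).
rewrite cmean_sum; [|exact: ltW|]; last first.
  by move=> k t ts; apply: ccont_sum => j; exact: Vc.
rewrite /sing /corr -sumrB; apply: eq_big_nat => k hk.
rewrite cmean_sum; [|exact: ltW|by move=> j; exact: Vc].
rewrite -sumrB; apply: eq_bigr => j _.
have hk' : (1 <= k <= u)%N by rewrite -ltnS.
rewrite /V hk' cmeanZ; [|exact: ltW|]; last first.
  move=> t ts; apply: ccontM; last exact: kc.
  by cc; rewrite expf_neq0// subr_eq0 tk.
by rewrite cmean_power_pole ?a_rho ?hz// mulrBr.
Qed.

Let reg_cont n t : dom t -> ccont (fun t => t ^+ n * Freg t) t.
Proof. by move=> ht; cc; exact: Freg_cont. Qed.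

Let reg_cdiff n t : dom t -> normc t \notin [:: rho] -> cdiff (fun t => t ^+ n * Freg t) t.
Proof.
by move=> ht; rewrite inE => tr; cd; apply: Freg_cdiff => //; exact: not_pole.
Qed.

Let reg_outer n q z : rho' < q -> q < rho -> q < normc z < s ->
  (forall k, (1 <= k <= u)%N -> z != a k) ->
  cmean s (fun t => t ^+ n * Freg t * (t / (t - z))) =
  z ^+ n * Freg z + cmean q (fun t => t ^+ n * Freg t * (t / (t - z))).
Proof.
move=> q1 q2 hz hzk; have [z1 z2] := andP hz.
have q0 : 0 <= q by exact/ltW/(le_lt_trans rho'0).
rewrite -(@cauchy_annulus R [:: rho] (fun t => t ^+ n * Freg t) q s z) ?subrK//.
- move=> t /andP[t1 t2]; apply: reg_cont.
  by rewrite /dom /= (lt_le_trans q1)//= (le_lt_trans t2).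
- move=> t /andP[t1 t2]; apply: reg_cdiff.
  by rewrite /dom /= (lt_trans q1)//= (lt_trans t2).
- cd; apply: Freg_cdiff => //.
  by rewrite /dom /= (lt_trans q1)//= (lt_trans z2).
Qed.

Let reg_inner n q z : rho' < q -> q < rho -> normc z < q ->
  cmean s (fun t => t ^+ n * Freg t * (t / (t - z))) =
  cmean q (fun t => t ^+ n * Freg t * (t / (t - z))).
Proof.
move=> q1 q2 hz; have q0 : 0 <= q by exact/ltW/(le_lt_trans rho'0).
rewrite -(@cmean_eq R [:: rho] q s)//.
- by apply: ltW; exact: lt_trans rho_s.
- move=> t /andP[t1 t2]; apply: ccontM.
    by apply: reg_cont; rewrite /dom /= (lt_le_trans q1)//= (le_lt_trans t2).
  by apply: ccont_kernel; apply: normc_neq; rewrite gt_eqF// (lt_le_trans hz).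
- move=> t /andP[t1 t2] tr; apply: cdiffM.
    by apply: reg_cdiff => //; rewrite /dom /= (lt_trans q1)//= (lt_trans t2).
  by apply: cdiff_kernel; apply: normc_neq; rewrite gt_eqF// (lt_trans hz).
Qed.

Let reg_bound q : rho' < q -> q < rho -> exists2 M, 0 < M & forall n z d, 0 < d ->
  d <= `|normc z - q| ->
  normc (cmean q (fun t => t ^+ n * Freg t * (t / (t - z)))) <= M / d * q ^+ n.
Proof.
move=> q1 q2; have q0 : 0 < q by exact: le_lt_trans q1.
have qdom t : normc t = q -> dom t by apply: circle_dom => //; exact: lt_trans rho1.
have [M M0 HM] : exists2 M, 0 < M & forall z, circle q z -> normc (Freg z) <= M.
  by apply: compact_normc_bounded (@circle_compact R q) _ => z /qdom /Freg_cont.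
exists (2 * (M * q)); first by rewrite !mulr_gt0.
move=> n z d d0 hd; have zq : normc z != q.
  by rewrite -subr_eq0 -normr_gt0; exact: lt_le_trans hd.
apply: le_trans (cauchy_bound (M := q ^+ n * M) _ zq _ _) _; first exact: ltW.
- by move=> t /qdom; exact: reg_cont.
- move=> t tq; rewrite normcM normcX tq ler_wpM2l ?exprn_ge0 ?(ltW q0)//.
  exact: HM.
rewrite (_ : 2 * (M * q) / d * q ^+ n = 2 * (q ^+ n * M * (q / d))); last by ring.
apply: ler_wpM2l => //; apply: ler_wpM2l; first by rewrite mulr_ge0 ?exprn_ge0 ?(ltW q0) ?(ltW M0).
apply: ler_wpM2l; first exact: ltW.
by rewrite lef_pV2 ?posrE// (lt_le_trans d0).
Qed.

Let rest_bound : exists2 c, 0 < c & forall n z (eta : R), (0 < n)%N -> 0 < eta <= 1 ->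
  (forall k, (1 <= k <= u)%N -> eta <= normc (z - a k)) ->
  normc (rest n z) <= c * ((0 < p)%:R * (n%:R ^+ p.-1 * rho ^+ n / eta ^+ p.+1)).
Proof.
pose c0 := \sum_(1 <= k < u.+1) (normc (gam k 0%N) * p%:R
   + \sum_(j < p) normc (gam k j.+1) * p%:R) * rho^-1 ^+ p.
have c00 : 0 <= c0.
  apply: sumr_ge0 => k _; apply: mulr_ge0; last by rewrite exprn_ge0// invr_ge0 ltW.
  apply: addr_ge0; first by rewrite mulr_ge0 ?normc_ge0.
  by apply: sumr_ge0 => j _; rewrite mulr_ge0 ?normc_ge0.
exists (c0 + 1); first by rewrite ltr_wpDl.
move=> n z eta n0 heta hz.
have [p0|p0] := posnP p.
  rewrite {1}/rest p0 big1_seq ?normc0 ?mul0r ?mulr0// => k _.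
  by rewrite !big_ord0 mulr0 addr0.
rewrite mul1r; set B := _ / eta ^+ _.
have B0 : 0 <= B.
  case/andP: heta => e0 _.
  by rewrite /B !mulr_ge0 ?exprn_ge0 ?invr_ge0 ?exprn_ge0 ?(ltW rho0) ?(ltW e0).
apply: (@le_trans _ _ (c0 * B)); last by rewrite ler_wpM2r// lerDl.
apply: le_trans (ler_sum_normc _ _ _) _.
rewrite mulr_suml !big_nat; apply: ler_sum => k hk.
have hk' : (1 <= k <= u)%N by rewrite -ltnS.
have TB q e : (q < p)%N -> (e <= p.+1)%N -> normc (T n k q e z) <= rho^-1 ^+ p * B.
  by move=> qp ep; apply: pole_term_bound => //; rewrite ?rho0 ?a_rho ?hz.
have TS N (f : nat -> nat) : (N <= p)%N -> (forall q, (f q <= p.+1)%N) ->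
    normc (\sum_(q < N) T n k q (f q) z) <= p%:R * (rho^-1 ^+ p * B).
  move=> Np hf; apply: le_trans (ler_sum_normc _ _ _) _.
  apply: (@le_trans _ _ (\sum_(q < N) rho^-1 ^+ p * B)).
    by apply: ler_sum => q _; apply: TB => //; exact: leq_trans (ltn_ord q) Np.
  rewrite sumr_const card_ord -[leLHS]mulr_natl ler_wpM2r ?ler_nat//.
  by rewrite mulr_ge0 ?exprn_ge0 ?invr_ge0 ?(ltW rho0).
apply: le_trans (le_normcD _ _) _.
rewrite -mulrA mulrDl; apply: lerD.
  rewrite normcM -mulrA ler_wpM2l ?normc_ge0//.
  by apply: (TS p (fun q => p.+1 - q)%N) => // q; exact: leq_subr.
apply: le_trans (ler_sum_normc _ _ _) _; rewrite mulr_suml; apply: ler_sum => j _.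
rewrite normcM -mulrA ler_wpM2l ?normc_ge0//.
apply: (TS (p - j)%N (fun q => p - j - q)%N); first exact: leq_subr.
by move=> q; apply: leq_trans (leq_subr _ _) _; apply: leq_trans (leq_subr _ _) _.
Qed.

Let sing_bound kap : 0 <= kap -> kap < rho -> exists2 c, 0 < c &
  forall n z, normc z <= kap -> normc (sing n z) <= c * kap ^+ n.
Proof.
move=> kap0 kap_rho; have d0 : 0 < rho - kap by rewrite subr_gt0.
pose c0 := \sum_(1 <= k < u.+1) \sum_(j < p.+1) normc (gam k j) / (rho - kap) ^+ (p.+1 - j).
have c00 : 0 <= c0.
  apply: sumr_ge0 => k _; apply: sumr_ge0 => j _.
  by rewrite divr_ge0 ?normc_ge0// exprn_ge0// ltW.
exists (c0 + 1); first by rewrite ltr_wpDl.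
move=> n z zk; apply: (@le_trans _ _ (c0 * kap ^+ n)); last first.
  by rewrite ler_wpM2r ?exprn_ge0// lerDl.
apply: le_trans (ler_sum_normc _ _ _) _; rewrite mulr_suml !big_nat.
apply: ler_sum => k hk; apply: le_trans (ler_sum_normc _ _ _) _.
rewrite mulr_suml; apply: ler_sum => j _.
rewrite !normcM normcV !normcX mulrCA [leRHS]mulrC.
have hk' : (1 <= k <= u)%N by rewrite -ltnS.
have hd : rho - kap <= normc (z - a k).
  rewrite -(a_rho hk') normcB; apply: le_trans (ler_dist_normc _ _); rewrite lerB//.
apply: ler_pM; rewrite ?exprn_ge0 ?normc_ge0 ?mulr_ge0 ?invr_ge0 ?exprn_ge0 ?normc_ge0//.
  by rewrite lerXn2r ?nnegrE ?normc_ge0.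
rewrite ler_wpM2l ?normc_ge0// lef_pV2 ?posrE ?exprn_gt0//; last exact: lt_le_trans hd.
by rewrite lerXn2r ?nnegrE ?normc_ge0 ?(ltW d0).
Qed.

Let expansion q : rho' < q -> q < rho -> exists c d : R, [/\ 0 < c, 0 < d < 1 &
  forall n z eta e, (0 < n)%N -> normc z <= r -> 0 < eta <= 1 ->
  (forall k, (1 <= k <= u)%N -> eta <= normc (z - a k)) -> 0 < e <= 1 -> e <= `|normc z - q| ->
  normc ((P n).[z] - Gi z / tau * (\sum_(1 <= k < u.+1) term n k z +
      if q < normc z then z ^+ n * F z else sing n z)) <=
  c * (rho ^+ n * d ^+ n / e + (0 < p)%:R * (n%:R ^+ p.-1 * rho ^+ n / eta ^+ p.+1))].
Proof.
move=> qr qrho; have q0 : 0 < q by exact: le_lt_trans rho'0 qr.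
have [ca ca0 Ha] := approx.
have [cr cr0 Hr] := rest_bound.
have [M M0 HM] := reg_bound qr qrho.
have [G G0 HG] := Gi_bounded.
pose d := Num.max s (q / rho).
have d1 : 0 < d < 1 by rewrite lt_max s0 /= gt_max s1 ltr_pdivrMr// mul1r.
have d0 : 0 <= d by apply: ltW; case/andP: d1.
pose ct := normc tau^-1.
have c2 : 0 <= ct * M by apply: mulr_ge0; [exact: normc_ge0|exact: ltW].
have c3 : 0 <= ct * cr by apply: mulr_ge0; [exact: normc_ge0|exact: ltW].
exists (G * (ca + ct * M + ct * cr)), d; split => //.
  by apply: mulr_gt0 => //; rewrite ltr_wpDr// ltr_wpDr.
move=> n z eta e n0 z2 heta hz /andP[e0 e1] he.
have hzk k : (1 <= k <= u)%N -> z != a k.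
  move=> hk; rewrite -subr_eq0 -normc_gt0; apply: lt_le_trans (hz k hk).
  by case/andP: heta.
have zs : normc z < s by exact: le_lt_trans z2 rs.
have Gz : Gi z != 0 by apply: Gi_neq0; exact/ltW/(lt_trans zs).
set E := cmean q (fun t => t ^+ n * Freg t * (t / (t - z))).
set X := if _ then _ else _.
have key : tau^-1 * cmean s (fun t => t ^+ n * F t * (t / (t - z))) =
    tau^-1 * (\sum_(1 <= k < u.+1) term n k z + X) + tau^-1 * E - tau^-1 * rest n z.
  rewrite cauchy_F// corrE /X; case: ltP => zq.
    rewrite (reg_outer _ qr)// ?zq// -/E.
    have -> : z ^+ n * F z = sing n z + z ^+ n * Freg z.
      rewrite FE// mulrDr /sing mulr_sumr; congr (_ + _); apply: eq_bigr => k _.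
      by rewrite mulr_sumr; apply: eq_bigr => j _; rewrite mulrCA.
    by ring.
  rewrite (@reg_inner n q)// -/E; first by ring.
  rewrite lt_neqAle zq andbT; apply: contraTneq he => ->.
  by rewrite subrr normr0 -ltNge.
have -> : (P n).[z] - Gi z / tau * (\sum_(1 <= k < u.+1) term n k z + X) =
    Gi z * ((P n).[z] / Gi z - tau^-1 * cmean s (fun t => t ^+ n * F t * (t / (t - z)))
      + tau^-1 * E - tau^-1 * rest n z).
  by rewrite key; field; rewrite tau_neq0.
rewrite normcM -[leRHS]mulrA; apply: ler_pM; rewrite ?normc_ge0 ?HG//.
set A := rho ^+ n * d ^+ n; set B := (0 < p)%:R * _.
have B0 : 0 <= B.
  case/andP: heta => eta0 _.
  by rewrite /B !mulr_ge0 ?exprn_ge0 ?invr_ge0 ?exprn_ge0 ?(ltW rho0) ?(ltW eta0).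
have A0 : 0 <= A by rewrite /A mulr_ge0 ?exprn_ge0 ?(ltW rho0).
have A1 : A <= A / e by rewrite ler_peMr// invf_ge1.
have b1 : normc ((P n).[z] / Gi z - tau^-1 * cmean s (fun t => t ^+ n * F t * (t / (t - z)))) <= ca * (A / e).
  apply: le_trans (Ha n z z2) _; rewrite ler_wpM2l ?(ltW ca0)//; apply: le_trans A1.
  rewrite exprMn mulrC /A ler_wpM2l ?exprn_ge0 ?(ltW rho0)//.
  by rewrite lerXn2r ?nnegrE ?(ltW s0)// /d le_max lexx ?(ltW s0).
have qA : q ^+ n <= A.
  rewrite /A -exprMn lerXn2r ?nnegrE ?(ltW q0)//.
    by rewrite mulr_ge0 ?(ltW rho0).
  by rewrite mulrC -ler_pdivrMr// /d le_max lexx orbT.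
have b2 : normc (tau^-1 * E) <= ct * M * (A / e).
  rewrite normcM -mulrA ler_wpM2l ?normc_ge0//; apply: le_trans (HM n z e e0 he) _.
  by rewrite mulrAC -mulrA ler_wpM2l ?(ltW M0)// ler_wpM2r// invr_ge0 ltW.
have b3 : normc (tau^-1 * rest n z) <= ct * cr * B.
  by rewrite normcM -mulrA ler_wpM2l ?normc_ge0//; exact: Hr.
apply: le_trans (le_normcD _ _) _; rewrite normcN.
apply: le_trans (lerD (le_normcD _ _) (lexx _)) _.
apply: le_trans (lerD (lerD b1 b2) b3) _.
rewrite [leRHS]mulrDr [X in _ <= X + _]mulrDl; apply: lerD.
  by rewrite -!mulrDl ler_wpM2r ?lerDl// (le_trans A0).
by rewrite ler_wpM2r// lerDr addr_ge0// ltW.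
Qed.

Lemma expansion_outer kap : rho' < kap -> exists c d : R, [/\ 0 < c, 0 < d < 1 &
  forall n z eta, (0 < n)%N -> kap <= normc z <= r -> 0 < eta <= 1 ->
  (forall k, (1 <= k <= u)%N -> eta <= normc (z - a k)) ->
  normc ((P n).[z] - De z / tau * z ^+ n - Gi z / tau * \sum_(1 <= k < u.+1)
      'C(n, p)%:R * a k ^+ (n - p) * (g k (a k) / Gi (a k) / (a k - z))) <=
  c * (rho ^+ n * d ^+ n + (0 < p)%:R * (n%:R ^+ p.-1 * rho ^+ n / eta ^+ p.+1))].
Proof.
move=> hkap.
have hm : rho' < Num.min kap rho by rewrite lt_min hkap.
have [] := midf_lt hm; set q := _ / 2 => qr; rewrite lt_min => /andP[qk qrho].
have [c [d [c0 d1 H]]] := expansion qr qrho.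
pose e := Num.min (kap - q) 1.
have e0 : 0 < e by rewrite lt_min subr_gt0 qk ltr01.
have e1 : e <= 1 by rewrite ge_min lexx orbT.
exists (c / e), d; split => //; first exact: divr_gt0.
move=> n z eta n0 /andP[z1 z2] heta hz.
have zq : q < normc z by exact: lt_le_trans z1.
have he : e <= `|normc z - q| by rewrite gtr0_norm ?subr_gt0// ge_min lerB.
have := H n z eta e n0 z2 heta hz _ he; rewrite e0 e1 zq => /(_ isT) h.
have Gz : Gi z != 0 by apply: Gi_neq0; exact/ltW/(le_lt_trans z2 r1).
have -> : De z / tau * z ^+ n = Gi z / tau * (z ^+ n * F z).
  by rewrite /F; field; rewrite Gz tau_neq0.
rewrite -addrA -opprD -mulrDr [z ^+ n * _ + _]addrC; apply: le_trans h _.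
rewrite -[leRHS]mulrA ler_wpM2l ?(ltW c0)// [leRHS]mulrC mulrDl lerD2l ler_peMr ?invf_ge1//.
case/andP: heta => eta0 _.
by rewrite !mulr_ge0 ?exprn_ge0 ?invr_ge0 ?exprn_ge0 ?(ltW rho0) ?(ltW eta0).
Qed.

Lemma expansion_inner kap : 0 <= kap -> kap < rho -> exists c d : R, [/\ 0 < c, 0 < d < 1 &
  forall n z, (0 < n)%N -> normc z <= kap ->
  normc ((P n).[z] - Gi z / tau * \sum_(1 <= k < u.+1)
      'C(n, p)%:R * a k ^+ (n - p) * (g k (a k) / Gi (a k) / (a k - z))) <=
  c * (rho ^+ n * d ^+ n + (0 < p)%:R * (n%:R ^+ p.-1 * rho ^+ n))].
Proof.
move=> kap0 hkap.
have hm : Num.max kap rho' < rho by rewrite gt_max hkap.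
have [] := midf_lt hm; set q := _ / 2; rewrite gt_max => /andP[qk qr] qrho.
have [c [d [c0 /andP[d0 d1] H]]] := expansion qr qrho.
have [G G0 HG] := Gi_bounded.
have [cs cs0 Hs] := sing_bound kap0 hkap.
pose e := Num.min (q - kap) 1.
have e0 : 0 < e by rewrite lt_min subr_gt0 qk ltr01.
have e1 : e <= 1 by rewrite ge_min lexx orbT.
have eta0 : 0 < rho - kap by rewrite subr_gt0.
have eta1 : rho - kap <= 1 by rewrite lerBlDr (le_trans (ltW rho1))// lerDl.
pose d' := Num.max d (kap / rho).
have dd' : d <= d' by rewrite le_max lexx.
have d'0 : 0 <= d' by rewrite (le_trans _ dd')// ltW.
pose cG := G * normc tau^-1 * cs.
have cG0 : 0 <= cG by rewrite !mulr_ge0 ?normc_ge0// ltW.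
have ce0 : 0 <= c / e by rewrite divr_ge0// ltW.
have ceta0 : 0 <= c / (rho - kap) ^+ p.+1 by rewrite divr_ge0 ?exprn_ge0// ltW.
exists (c / e + cG + (c / (rho - kap) ^+ p.+1 + 1)), d'; split.
- by rewrite addrA ltr_wpDl// !addr_ge0.
- by rewrite lt_max d0 gt_max d1 ltr_pdivrMr// mul1r.
move=> n z n0 zk.
have hz k : (1 <= k <= u)%N -> rho - kap <= normc (z - a k).
  move=> hk; rewrite normcB; apply: le_trans (ler_dist_normc _ _).
  by rewrite (a_rho hk) lerB.
have zq : normc z < q by exact: le_lt_trans zk qk.
have z2 : normc z <= r by apply: (le_trans zk); exact/ltW/(lt_trans hkap).
have he : e <= `|normc z - q|.
  by rewrite distrC gtr0_norm ?subr_gt0// ge_min lerB.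
have := H n z (rho - kap) e n0 z2 _ hz _ he.
rewrite eta0 eta1 e0 e1 ltNge (ltW zq) /= => /(_ isT isT).
rewrite mulrDr opprD addrA; set S := \sum_(_ <= k < _) _; set Y := Gi z / tau * sing n z => h.
rewrite -[X in normc X](subrK Y); apply: le_trans (le_normcD _ _) _.
set A := rho ^+ n * d' ^+ n; set B := (0 < p)%:R * _.
have B0 : 0 <= B by rewrite /B !mulr_ge0 ?exprn_ge0 ?(ltW rho0).
have A0 : 0 <= A by rewrite /A mulr_ge0 ?exprn_ge0 ?(ltW rho0).
have hY : normc Y <= cG * A.
  rewrite !normcM -[leRHS]mulrA; apply: ler_pM; rewrite ?mulr_ge0 ?normc_ge0//.
    by rewrite ler_wpM2r ?normc_ge0 ?HG.
  apply: le_trans (Hs n z zk) _; rewrite ler_wpM2l ?(ltW cs0)// /A -exprMn lerXn2r ?nnegrE//.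
    by rewrite mulr_ge0 ?(ltW rho0).
  by rewrite mulrC -ler_pdivrMr// le_max lexx orbT.
have hX : c * (rho ^+ n * d ^+ n / e + (0 < p)%:R * (n%:R ^+ p.-1 * rho ^+ n / (rho - kap) ^+ p.+1)) <=
    c / e * A + c / (rho - kap) ^+ p.+1 * B.
  rewrite mulrDr; apply: lerD; last by rewrite /B le_eqVlt; apply/orP; left; apply/eqP; ring.
  rewrite -[leRHS]mulrA ler_wpM2l ?(ltW c0)// mulrC ler_wpM2l ?invr_ge0 ?(ltW e0)//.
  by rewrite ler_wpM2l ?exprn_ge0 ?(ltW rho0)// lerXn2r ?nnegrE// ltW.
apply: le_trans (lerD (le_trans h hX) hY) _.
rewrite addrAC -mulrDl [leRHS]mulrDr; apply: lerD; rewrite ler_wpM2r//.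
  by rewrite lerDl addr_ge0.
by rewrite [c / _ ^+ _ + 1]addrC addrA lerDr !addr_ge0.
Qed.

End PoleAsymptotics.

(** * Reflection of the Szego function *)

Section CompactDistance.
Variable R : realType.
Local Notation C := R[i].
Implicit Types (s e d : R) (z t : C) (K : set C).

Lemma compact_real_bounded K (f : C -> R) : compact (K : set C^o) ->
  (forall z, K z -> 0 < f z /\ ccont (fun t => (f t)%:C) z) ->
  exists2 d, 0 < d & forall z, K z -> d <= f z.
Proof.
move=> cK hf; have [|M M0 HM] := @compact_normc_bounded _ K (fun t => (f t)%:C^-1) cK.
  move=> z /hf[f0 fc]; apply: ccontV => //.
  by rewrite -normc_gt0 normc_real normr_gt0 gt_eqF.
exists M^-1; first by rewrite invr_gt0.
move=> z Kz; have [f0 _] := hf z Kz; have := HM z Kz.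
rewrite normcV normc_real gtr0_norm// => h.
by rewrite -[leRHS]invrK lef_pV2 ?posrE ?invr_gt0.
Qed.

Lemma compact_exterior K s : compact (K : set C^o) -> K `<=` exterior s ->
  exists2 s', s < s' & forall z, K z -> s' <= normc z.
Proof.
move=> cK Ks; have [|d d0 H] := @compact_real_bounded K (fun z => normc z - s) cK.
  move=> z /Ks zs; split; first by rewrite subr_gt0.
  under eq_fun do rewrite rmorphB; apply: ccontB; [exact: ccont_normc|exact: ccont_cst].
exists (s + d); first by rewrite ltrDl.
by move=> z /H; rewrite lerBrDl.
Qed.

Lemma compact_disk K s : 0 < s -> compact (K : set C^o) -> K `<=` disk s ->
  exists2 s', 0 <= s' < s & forall z, K z -> normc z <= s'.
Proof.
move=> s0 cK Ks; have [|d d0 H] := @compact_real_bounded K (fun z => s - normc z) cK.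
  move=> z /Ks zs; split; first by rewrite subr_gt0.
  under eq_fun do rewrite rmorphB; apply: ccontB; [exact: ccont_cst|exact: ccont_normc].
exists (Num.max 0 (s - d)); first by rewrite le_max lexx gt_max s0 ltrBlDr ltrDl.
by move=> z /H h; rewrite le_max; apply/orP; right; rewrite lerBrDr addrC -lerBrDr.
Qed.

Lemma compact_separation K (a : nat -> C) u : compact (K : set C^o) ->
  (forall k, (1 <= k <= u)%N -> ~ K (a k)) ->
  exists2 d, 0 < d & forall z k, K z -> (1 <= k <= u)%N -> d <= normc (z - a k).
Proof.
move=> cK; elim: u => [|u IH] hK.
  by exists 1 => // z k _ /andP[k1 k0]; have := leq_trans k1 k0.
have [|d d0 H] := IH; first by move=> k /andP[k1 ku]; apply: hK; rewrite k1 ltnW.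
have [|d' d'0 H'] := @compact_real_bounded K (fun z => normc (z - a u.+1)) cK.
  move=> z Kz; split.
    rewrite normc_gt0 subr_eq0; apply: contra_notN (hK u.+1 _) => [/eqP <- //|].
    by rewrite /= leqnn.
  apply: (@ccont_comp _ (fun t => t - a u.+1) (fun t => (normc t)%:C)); first by cc.
  exact: ccont_normc.
exists (Num.min d d'); first by rewrite lt_min d0.
move=> z k Kz /andP[k1]; rewrite leq_eqVlt ge_min => /predU1P[-> |ku].
  by rewrite H' ?orbT.
by rewrite H// k1.
Qed.

Lemma open_ball_normc z e : open ([set t | normc (t - z) < e] : set C^o).
Proof.
rewrite openE => t ht; apply/nbhs_normc; exists (e - normc (t - z)); first by rewrite subr_gt0.
move=> y hy; rewrite /= -(subrK t y) -addrA; apply: le_lt_trans (le_normcD _ _) _.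
by rewrite -ltrBrDr.
Qed.

End CompactDistance.

Section PoleTheory.
Variable R : realType.
Local Notation C := R[i].
Implicit Types (s e d : R) (z t a b : C) (f g : C -> C).

Lemma pole_coefE f m a g d : 0 < d -> ccont g a ->
  (forall z, normc (z - a) < d -> z != a -> f z * (z - a) ^+ m = g z) ->
  pole_coef f m a = g a.
Proof.
move=> d0 gc H; apply: (@cvg_lim C^o); first exact: norm_hausdorff.
have /ccontP gc' := gc.
apply: (@cvg_trans _ ((g z : C^o) @[z --> (a : C^o)^'])); last exact: cvg_within_filter gc'.
apply: near_eq_cvg; apply/nbhs_normc; exists d => // z hz za; rewrite /= H//.
Qed.

Lemma poleP f a m : pole f a m -> exists2 g : C -> C, g a != 0 & exists2 d, 0 < d &
  forall z, normc (z - a) < d -> cdiff g z /\ (z != a -> f z = g z / (z - a) ^+ m).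
Proof.
move=> [_ [U [g [oU Ua hU ga HU]]]]; exists g => //.
have /nbhs_normc[d d0 Hd] : nbhs (a : C^o) U by exact: open_nbhs_nbhs.
exists d => // z /Hd Uz; split; first by apply/cdiffP; exact: hU.
exact: HU.
Qed.

Lemma pole_coef_eq f m a g d : 0 < d ->
  (forall z, normc (z - a) < d -> cdiff g z /\ (z != a -> f z = g z / (z - a) ^+ m)) ->
  pole_coef f m a = g a.
Proof.
move=> d0 H; apply: (pole_coefE d0).
  by apply: cdiff_cont; apply: (H a _).1; rewrite subrr normc0.
move=> z /H[_ h] za; rewrite h// mulfVK// expf_neq0// subr_eq0//.
Qed.

Lemma pole_coef_neq0 f m a : pole f a m -> pole_coef f m a != 0.
Proof.
by move=> /poleP[g ga [d d0 H]]; rewrite (pole_coef_eq d0 H).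
Qed.

Lemma pole_raise f a p m : pole f a p -> (p <= m)%N -> exists g : C -> C, exists2 d, 0 < d &
  forall z, normc (z - a) < d -> cdiff g z /\ (z != a -> f z = g z / (z - a) ^+ m).
Proof.
move=> /poleP[g _ [d d0 H]] pm; exists (fun z => g z * (z - a) ^+ (m - p)), d => // z /H[h1 h2].
split; first by cd.
move=> za; rewrite h2// -{2}(subnK pm) exprD.
have z0 : z - a != 0 by rewrite subr_eq0.
rewrite invfM -!mulrA; congr (_ * _); rewrite mulrA divff ?mul1r// expf_neq0//.
Qed.

Lemma pole_coef_gt f a p m : pole f a p -> (p < m)%N -> pole_coef f m a = 0.
Proof.
move=> /poleP[g _ [d d0 H]] pm.
rewrite (@pole_coefE f m a (fun z => g z * (z - a) ^+ (m - p)) d d0).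
- by rewrite subrr expr0n subn_eq0 leqNgt pm mulr0.
- cc; apply: cdiff_cont; apply: (H a _).1; by rewrite subrr normc0.
- move=> z hz za; have z0 : z - a != 0 by rewrite subr_eq0.
  have -> : (z - a) ^+ m = (z - a) ^+ p * (z - a) ^+ (m - p).
    by rewrite -exprD subnKC// ltnW.
  by rewrite (H z hz).2// mulrA mulfVK// expf_neq0.
Qed.

Lemma pole_inj f a m p : pole f a m -> pole f a p -> m = p.
Proof.
move=> hm hp; case: (ltngtP m p) => // h.
  by have := pole_coef_neq0 hp; rewrite (pole_coef_gt hm h) eqxx.
by have := pole_coef_neq0 hm; rewrite (pole_coef_gt hp h) eqxx.
Qed.

Lemma pole_singularity f a m : pole f a m -> singularity f a.
Proof.
move=> hp [U [oU Ua hU]].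
have /eqP := pole_coef_neq0 hp; apply.
have fc : cdiff f a by apply/cdiffP; exact: hU.
rewrite (@pole_coefE f m a (fun z => f z * (z - a) ^+ m) 1) //; last first.
  by cc; exact: cdiff_cont.
by case: hp => m0 _; rewrite subrr expr0n eqn0Ngt m0 mulr0.
Qed.

End PoleTheory.

Section SzegoReflection.
Variable R : realType.
Local Notation C := R[i].
Implicit Types (s e d : R) (z t : C).
Variables (w : C -> R) (De : C -> C) (rho : R).
Hypothesis w_analytic : analytic_weight w.
Hypotheses (rho0 : 0 < rho) (rho1 : rho < 1).
Hypothesis De_cdiff : forall z, rho < normc z -> cdiff De z.
Hypothesis DeE : forall z, 1 < normc z -> De z = szego w z.

(* By reflection in the unit circle, the continuation of 1 / D_i from the disk; the value at 0
   is the limit of D_e at infinity. *)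
Definition szego_inner z : C := if z == 0 then szego_tau w else conjc (De (conjc z)^-1).

Lemma szego_tau_neq0 : szego_tau w != 0.
Proof. by rewrite invr_eq0 szego_neq0. Qed.

Lemma szego_outer_boundary t : normc t = 1 -> normc (De t) ^+ 2 * w t = 1.
Proof.
move=> t1; apply: szego_boundary => //.
by apply: cdiff_cont; apply: De_cdiff; rewrite t1.
Qed.

Lemma szego_outer_neq0 z : 1 <= normc z -> De z != 0.
Proof.
rewrite le_eqVlt => /predU1P[/esym z1|z1]; last by rewrite DeE// szego_neq0.
have := szego_outer_boundary z1; apply: contra_eq_neq => ->.
by rewrite normc0 expr0n mul0r eq_sym oner_neq0.
Qed.

Lemma szego_outer_oo : ctends De (szego_tau w).
Proof.
apply: (@ctends_near _ (szego w) _ _ 2); last exact: szego_oo.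
by move=> z z2; rewrite DeE// (lt_le_trans _ z2)// ltr1n.
Qed.

Lemma szego_innerE z : normc z < 1 -> szego_inner z = (szego w z)^-1.
Proof.
rewrite /szego_inner; have [->//|z0 z1] := eqVneq z 0.
have n0 : 0 < normc z by rewrite normc_gt0.
rewrite DeE; last by rewrite normcV normc_conj invf_gt1.
by rewrite szego_reflect// lt_eqF.
Qed.

Lemma szego_inner_circle z : normc z = 1 -> szego_inner z = conjc (De z).
Proof.
move=> z1; have z0 : z != 0 by rewrite -normc_gt0 z1.
rewrite /szego_inner (negPf z0); congr (conjc (De _)).
have := mulcJ z; rewrite z1 expr1n => h.
by apply: (mulIf (x := conjc z)); rewrite ?conjc_eq0// mulVf ?conjc_eq0// h.
Qed.

Lemma szego_inner_neq0 z : normc z <= 1 -> szego_inner z != 0.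
Proof.
rewrite le_eqVlt => /predU1P[z1|z1]; last by rewrite szego_innerE// invr_eq0 szego_neq0.
by rewrite szego_inner_circle// conjc_eq0 szego_outer_neq0// z1.
Qed.

Lemma szego_inner_cont0 : ccont szego_inner 0.
Proof.
apply: (@ccont_near _ (fun z => (szego w z)^-1) _ _ 1) => //.
  by move=> z; rewrite subr0 => z1; rewrite szego_innerE.
apply: ccontV; first exact: szego_neq0.
by apply: cdiff_cont; apply: szego_cdiff => //; rewrite normc0 lt_eqF.
Qed.

Lemma szego_inner_cdiff z : 0 < normc z < rho^-1 -> cdiff szego_inner z.
Proof.
move=> /andP[z0 z1]; apply: (@cdiff_near _ (fun t => conjc (De (conjc t)^-1)) _ _ (normc z)) => //.
  move=> t ht; rewrite /szego_inner; case: eqVneq => // t0; move: ht.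
  by rewrite t0 sub0r normcN ltxx.
apply: (cdiff_reflect (f := fun t => De t^-1)).
apply: (@cdiff_comp _ (fun t => t^-1) De).
  by cd; rewrite conjc_eq0 -normc_gt0.
by apply: De_cdiff; rewrite normcV normc_conj -[X in X < _]invrK ltf_pV2 ?posrE ?invr_gt0.
Qed.

Lemma weightE t : normc t = 1 -> (w t)%:C = (De t * szego_inner t)^-1.
Proof.
move=> t1; rewrite szego_inner_circle// mulcJ; apply: (mulrI (x := (normc (De t) ^+ 2)%:C)).
  by rewrite unitfE -mulcJ mulf_neq0 ?conjc_eq0 ?szego_outer_neq0// t1.
rewrite -rmorphM szego_outer_boundary// mulfV//.
by rewrite -mulcJ mulf_neq0 ?conjc_eq0 ?szego_outer_neq0// t1.
Qed.

Variable phi : nat -> {poly C}.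
Hypothesis phi_orth : orthonormal_polys w phi.

Lemma size_monic_poly n : size (monic_poly phi n) = n.+1.
Proof.
have [h1 h2] := phi_orth.1 n; rewrite /monic_poly size_scale//.
by rewrite invr_eq0 gt_eqF.
Qed.

Lemma lead_monic_poly n : (monic_poly phi n)`_n = 1.
Proof.
have [h1 h2] := phi_orth.1 n; rewrite /monic_poly coefZ.
by rewrite (_ : (phi n)`_n = lead_coef (phi n)) ?mulVf ?gt_eqF// lead_coefE h1.
Qed.

Lemma weight_cont t : normc t = 1 -> ccont (fun t => (De t * szego_inner t)^-1) t.
Proof.
move=> t1; apply: ccontV.
  by rewrite mulf_neq0 ?szego_outer_neq0 ?szego_inner_neq0// t1.
apply: ccontM; apply: cdiff_cont; first by apply: De_cdiff; rewrite t1.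
by apply: szego_inner_cdiff; rewrite t1 ltr01 invf_gt1.
Qed.

Lemma orth_poly n (q : {poly C}) : (size q <= n)%N ->
  cmean 1 (fun t => (monic_poly phi n).[t] / (De t * szego_inner t) * conjc q.[t]) = 0.
Proof.
pose I (q : {poly C}) t := (monic_poly phi n).[t] / (De t * szego_inner t) * conjc q.[t].
have Ic q' : ccont_circle 1 (I q').
  move=> t t1; apply: ccontM.
    by apply: ccontM; [exact: ccont_horner|exact: weight_cont].
  by apply: ccont_comp (ccont_conj _); exact: ccont_horner.
have Iphi k : (k < n)%N -> cmean 1 (I (phi k)) = 0.
  move=> kn; have := phi_orth.2 k n; rewrite /arcint (ltn_eqF kn) => h.
  have [_ l0] := phi_orth.1 n.
  rewrite (@eq_cmean _ _ _ (fun t => (lead_coef (phi n))^-1 *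
      ((phi n).[t] * conjc (phi k).[t] / (De t * szego_inner t))))//; last first.
    by move=> t t1; rewrite /I /monic_poly hornerZ; ring.
  rewrite cmeanZ//; last first.
    move=> t t1; apply: ccontM; last exact: weight_cont.
    apply: ccontM; first exact: ccont_horner.
    by apply: ccont_comp (ccont_conj _); exact: ccont_horner.
  apply/eqP; rewrite mulf_eq0; apply/orP; right; apply/eqP.
  rewrite -[RHS](mulr0 ((2 * pi)^-1)%:C) -[X in _ = _ * X]h.
  congr (_ * _); apply: eq_cint => x _.
  by rewrite mul1r weightE// normc_cis.
rewrite -[LHS]/(cmean 1 (I q)); elim: {-2}n (leqnn n) q => [_ q|N IH Nn q sq].
  rewrite leqn0 size_poly_eq0 => /eqP ->.
  rewrite -(cmean_cst 1 (0 : C)); apply: eq_cmean => // t _.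
  by rewrite /I horner0 conjc0 mulr0.
have [s1 l1] := phi_orth.1 N; pose c := q`_N / lead_coef (phi N).
have sq' : (size (q - c *: phi N)%R <= N)%N.
  apply/leq_sizeP => j; rewrite leq_eqVlt coefB coefZ => /predU1P[<-|Nj].
    have -> : (phi N)`_N = lead_coef (phi N) by rewrite lead_coefE s1.
    by rewrite /c mulfVK ?subrr// gt_eqF.
  rewrite (nth_default 0 (leq_trans sq Nj)) nth_default ?mulr0 ?subrr//.
  by rewrite s1.
rewrite (@eq_cmean _ _ _ (fun t => I (q - c *: phi N) t + conjc c * I (phi N) t))//; last first.
  have e x y : conjc (x - c * y) = conjc x - conjc c * conjc y by rewrite rmorphB rmorphM.
  by move=> t _; rewrite /I hornerD hornerN (hornerZ c) e; ring.
rewrite cmeanD ?cmeanZ ?Iphi ?(IH (ltnW Nn) _ sq') ?mulr0 ?addr0//.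
by move=> t t1; apply: ccontM; [exact: ccont_cst|exact: Ic].
Qed.

Lemma orth_monomial n j : (j < n)%N ->
  cmean 1 (fun t => (monic_poly phi n).[t] / (De t * szego_inner t) / t ^+ j) = 0.
Proof.
move=> jn; have := @orth_poly n 'X^j; rewrite size_polyXn => /(_ jn) h.
rewrite -[RHS]h; apply: eq_cmean => // t t1; congr (_ * _); rewrite hornerXn.
have t0 : t != 0 by rewrite -normc_gt0 t1.
apply: (mulIf (x := t ^+ j)); rewrite ?expf_neq0// mulVf ?expf_neq0//.
by rewrite mulrC mulcJ normcX t1 !expr1n.
Qed.

End SzegoReflection.

(** * Dominant poles *)

Section DominantPoles.
Variable R : realType.
Local Notation C := R[i].
Variables (w : C -> R) (phi : nat -> {poly C}) (rho' r : R) (De : C -> C).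
Variables (u l m : nat) (a : nat -> C).
Local Notation rho := (szego_rho w).
Local Notation Di := (szego w).
Local Notation tau := (szego_tau w).
Local Notation Phi := (monic_poly phi).
Local Notation hDe := (pole_coef De m).
Hypothesis w_analytic : analytic_weight w.
Hypothesis phi_orth : orthonormal_polys w phi.
Hypotheses (rho_r : rho < r) (r1 : r < 1) (rho'0 : 0 <= rho') (rho'_rho : rho' < rho).
Hypothesis DeE : forall z, exterior 1 z -> De z = szego w z.
Hypothesis a_pole : forall k, (1 <= k <= u)%N -> circle rho (a k) /\ exists p, pole De (a k) p.
Hypothesis a_inj : forall j k, (1 <= j <= u)%N -> (1 <= k <= u)%N -> a j = a k -> j = k.
Hypothesis De_holo : holomorphic_on
  [set z | exterior rho' z /\ forall k, (1 <= k <= u)%N -> z != a k] De.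
Hypothesis lu : (l <= u)%N.
Hypothesis a_dom : forall k, (1 <= k <= u)%N ->
  dominant_pole (exterior rho') De (a k) <-> (k <= l)%N.
Hypothesis a_mult : forall k, (1 <= k <= l)%N -> pole De (a k) m.

Let rho0 : 0 < rho. Proof. exact: le_lt_trans rho'_rho. Qed.
Let rho1 : rho < 1. Proof. exact: lt_trans r1. Qed.

Let leu k : (1 <= k <= l)%N -> (1 <= k <= u)%N.
Proof. by move=> /andP[-> kl]; exact: leq_trans kl lu. Qed.

Lemma outer_cdiff z : rho' < normc z -> (forall k, (1 <= k <= u)%N -> z != a k) -> cdiff De z.
Proof. by move=> h1 h2; apply/cdiffP; apply: De_holo. Qed.

Lemma pole_radius k : (1 <= k <= u)%N -> normc (a k) = rho.
Proof. by move=> /a_pole[]. Qed.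

(* Otherwise De would be holomorphic beyond the circle of radius rho. *)
Lemma exists_pole : (0 < u)%N.
Proof.
rewrite lt0n; apply/eqP => u0.
pose s := (rho' + rho) / 2; have [s1 s2] := midf_lt rho'_rho.
have : rho <= s.
  apply: ge_inf; first by exists 0 => x [/andP[/ltW]].
  split; first by rewrite (le_lt_trans rho'0 s1) (lt_trans s2).
  exists De; split; last exact: DeE.
  move=> z zs; apply: De_holo; split; first exact: lt_trans zs.
  by move=> k; rewrite u0 => /andP[k1 k0]; have := leq_trans k1 k0.
by rewrite leNgt s2.
Qed.

Lemma singularity_pole b : exterior rho' b -> singularity De b ->
  exists2 k, (1 <= k <= u)%N & b = a k.
Proof.
move=> hb sb; apply: contrapT => nk; apply: sb.
have [d d0 Hd] := finite_separation a u b.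
have e0 : 0 < Num.min d (normc b - rho') by rewrite lt_min d0 subr_gt0.
exists [set t | normc (t - b) < Num.min d (normc b - rho')]; split.
- exact: open_ball_normc.
- by rewrite /= subrr normc0.
- move=> z /=; rewrite lt_min => /andP[h1 h2]; apply: De_holo; split.
    rewrite /exterior /=; have := ler_dist_normc b z; rewrite normcB => h.
    by move: h2 h => *; lra.
  move=> k hk; apply: Hd => //; apply/eqP => ab; apply: nk; by exists k.
Qed.

Lemma dominant_poleI k p : (1 <= k <= u)%N -> pole De (a k) p ->
  (forall j, (1 <= j <= u)%N -> exists2 q, pole De (a j) q & (q <= p)%N) ->
  dominant_pole (exterior rho') De (a k).
Proof.
move=> hk hp H; exists p; split => //; first by rewrite /exterior /= pole_radius.
  by rewrite pole_radius.
move=> b hb _ /(singularity_pole hb)[j hj ->]; right; split; last exact: H.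
by rewrite !pole_radius.
Qed.

Lemma exists_dominant : (0 < l)%N.
Proof.
have ex k : exists p, (1 <= k <= u)%N -> pole De (a k) p.
  by case: (boolP (1 <= k <= u)%N) => [/a_pole[_ [p hp]]|]; [exists p|exists 0%N].
have [mu Hmu] := choice ex.
have [k hk kmax] : exists2 k, (1 <= k <= u)%N & forall j, (1 <= j <= u)%N -> (mu j <= mu k)%N.
  elim: (u) exists_pole => // v IH _; case: (posnP v) => [->|v0].
    exists 1%N => // j; by rewrite -eqn_leq => /eqP <-.
  have [k /andP[k1 kv] kmax] := IH v0.
  have [h|h] := leqP (mu v.+1) (mu k).
    exists k; first by rewrite k1 leqW.
    move=> j /andP[j1]; rewrite leq_eqVlt => /predU1P[->//|jv]; apply: kmax.
    by rewrite j1.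
  exists v.+1; first by rewrite /= leqnn.
  move=> j /andP[j1]; rewrite leq_eqVlt => /predU1P[->//|jv].
  by apply: leq_trans (ltnW h); apply: kmax; rewrite j1.
have : (k <= l)%N.
  apply/(a_dom hk); apply: (dominant_poleI hk (Hmu k hk)) => j hj.
  by exists (mu j); [exact: Hmu|exact: kmax].
by case/andP: hk => k1 _; exact: leq_trans.
Qed.

Let one_l : (1 <= 1 <= l)%N. Proof. by rewrite exists_dominant. Qed.

Lemma pole_mult_le k : (1 <= k <= u)%N -> exists2 p, pole De (a k) p & (p <= m)%N.
Proof.
move=> hk; have [->|k1] := eqVneq k 1%N; first by exists m => //; exact: a_mult.
have [mm [_ _ pm H]] : dominant_pole (exterior rho') De (a 1%N).
  by apply/(a_dom (leu one_l)); exact: exists_dominant.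
have [p hp] := (a_pole hk).2; exists p => //.
have [||||[_ [q hq]]] := H (a k); first by rewrite /exterior /= pole_radius.
- by apply: contra k1 => /eqP /a_inj ->//; exact: leu.
- exact: pole_singularity hp.
- by rewrite !pole_radius ?ltxx// leu.
- by rewrite (pole_inj hp hq) (pole_inj (a_mult one_l) pm).
Qed.

Lemma pole_mult_lt k p : (l < k <= u)%N -> pole De (a k) p -> (p < m)%N.
Proof.
move=> /andP[lk ku] hp; rewrite ltnNge; apply/negP => mp.
have hk : (1 <= k <= u)%N by rewrite ku andbT; exact: leq_ltn_trans lk.
have : (k <= l)%N.
  apply/(a_dom hk); apply: (dominant_poleI hk hp) => j /pole_mult_le[q hq qm].
  by exists q => //; exact: leq_trans mp.
by rewrite leqNgt lk.
Qed.

Lemma pole_order_gt0 : (0 < m)%N.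
Proof. by case: (a_mult one_l). Qed.

Lemma pole_numerators : exists g : nat -> C -> C, forall k, (1 <= k <= u)%N ->
  (exists2 d, 0 < d & forall z, normc (z - a k) < d ->
    cdiff (g k) z /\ (z != a k -> De z = g k z / (z - a k) ^+ m)) /\
  g k (a k) = if (k <= l)%N then hDe (a k) else 0.
Proof.
suff ex k : exists g : C -> C, (1 <= k <= u)%N ->
  (exists2 d, 0 < d & forall z, normc (z - a k) < d ->
    cdiff g z /\ (z != a k -> De z = g z / (z - a k) ^+ m)) /\
  g (a k) = if (k <= l)%N then hDe (a k) else 0.
  by have [g Hg] := choice ex; exists g.
case: (boolP (1 <= k <= u)%N) => hk; last by exists (fun=> 0).
have [p hp pm] := pole_mult_le hk; have [g [d d0 H]] := pole_raise hp pm.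
exists g => _; split; first by exists d.
rewrite -(pole_coef_eq d0 H); case: leqP => // lk.
by rewrite (pole_coef_gt hp)// (@pole_mult_lt k)// lk; case/andP: hk.
Qed.

Lemma dominant_sum (g : nat -> C -> C) n z :
  (forall k, (1 <= k <= u)%N -> g k (a k) = if (k <= l)%N then hDe (a k) else 0) ->
  \sum_(1 <= k < u.+1) 'C(n, m.-1)%:R * a k ^+ (n - m.-1) *
      (g k (a k) / szego_inner w De (a k) / (a k - z)) =
  \sum_(1 <= k < l.+1) 'C(n, m.-1)%:R * a k ^+ (n.+1 - m) * (Di (a k) * hDe (a k) / (a k - z)).
Proof.
move=> hg; rewrite (@big_cat_nat _ _ _ l.+1 1 u.+1)//= [X in _ + X]big1_seq ?addr0; last first.
  move=> k /=; rewrite mem_index_iota => /andP[lk ku].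
  rewrite hg ?(leq_ltn_trans _ lk)//= leqNgt lk /= !mul0r mulr0//.
apply: eq_big_nat => k; rewrite ltnS => hk; have hk' := leu hk.
have /andP[_ kl] := hk; rewrite hg// kl (szego_innerE w_analytic DeE)//; last by rewrite pole_radius.
rewrite invrK [hDe _ * _]mulrC; congr (_ * _ ^+ _ * _).
by rewrite -{2}(prednK pole_order_gt0) subSS.
Qed.

Let De_cdiff z : rho < normc z -> cdiff De z.
Proof.
move=> hz; apply: outer_cdiff; first exact: lt_trans hz.
by move=> k /pole_radius ak; apply: normc_neq; rewrite ak gt_eqF.
Qed.

Let inner_tau z : normc z < 1 -> szego_inner w De z / tau = (tau * Di z)^-1.
Proof. by move=> z1; rewrite (szego_innerE w_analytic DeE)// invfM mulrC. Qed.

Local Notation main_sum n z := (\sum_(1 <= k < l.+1)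
  'C(n, m.-1)%:R * a k ^+ (n.+1 - m) * (Di (a k) * hDe (a k) / (a k - z))).

Lemma asymptotics :
  (forall kap, rho' < kap -> exists c d : R, [/\ 0 < c, 0 < d < 1 &
    forall n z eta, (0 < n)%N -> kap <= normc z <= r -> 0 < eta <= 1 ->
    (forall k, (1 <= k <= u)%N -> eta <= normc (z - a k)) ->
    normc ((Phi n).[z] - De z / tau * z ^+ n - (tau * Di z)^-1 * main_sum n z) <=
    c * (rho ^+ n * d ^+ n + (1 < m)%:R * (n%:R ^+ (m - 2) * rho ^+ n / eta ^+ m))]) /\
  (forall kap, 0 <= kap -> kap < rho -> exists c d : R, [/\ 0 < c, 0 < d < 1 &
    forall n z, (0 < n)%N -> normc z <= kap ->
    normc ((Phi n).[z] - (tau * Di z)^-1 * main_sum n z) <=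
    c * (rho ^+ n * d ^+ n + (1 < m)%:R * (n%:R ^+ (m - 2) * rho ^+ n))]).
Proof.
have [g Hg] := pole_numerators; have m0 := pole_order_gt0.
have gp k : (1 <= k <= u)%N -> exists2 d, 0 < d & forall z, normc (z - a k) < d ->
    cdiff (g k) z /\ (z != a k -> De z = g k z / (z - a k) ^+ m.-1.+1).
  by move=> hk; rewrite prednK//; case: (Hg k hk).
have h1 := szego_outer_neq0 w_analytic rho1 De_cdiff DeE.
have h2 := szego_outer_oo w_analytic DeE.
have h3 := szego_inner_cdiff w rho0 De_cdiff.
have h4 := szego_inner_cont0 w_analytic DeE.
have h5 := szego_inner_neq0 w_analytic rho1 De_cdiff DeE.
have h6 := orth_monomial w_analytic rho0 rho1 De_cdiff DeE phi_orth.
split=> [kap hkap|kap kap0 hkap].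
- have [c [d [c0 d1 H]]] := expansion_outer rho'0 rho'_rho rho_r r1 outer_cdiff h1 h2 h3 h4 h5
    (szego_tau_neq0 w) (size_monic_poly phi_orth) (lead_monic_poly phi_orth) h6 pole_radius a_inj
    gp hkap.
  exists c, d; split => // n z eta n0 hz heta hzk.
  have := H n z eta n0 hz heta hzk; rewrite dominant_sum; last by move=> k /Hg[].
  rewrite inner_tau; last by case/andP: hz => _ h; exact: le_lt_trans r1.
  by rewrite -ltn_predRL subn2 prednK.
- have [c [d [c0 d1 H]]] := expansion_inner rho'0 rho'_rho rho_r r1 outer_cdiff h1 h2 h3 h4 h5
    (szego_tau_neq0 w) (size_monic_poly phi_orth) (lead_monic_poly phi_orth) h6 pole_radius a_inj
    gp kap0 hkap.
  exists c, d; split => // n z n0 hz.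
  have := H n z n0 hz; rewrite dominant_sum; last by move=> k /Hg[].
  rewrite inner_tau; last by apply: (le_lt_trans hz); exact: lt_trans rho1.
  by rewrite -ltn_predRL subn2.
Qed.

End DominantPoles.

(** * Uniform estimates and zeros *)

Section Estimates.
Variable R : realType.
Local Notation C := R[i].
Implicit Types (z t : C) (K : set C).

Lemma uniform_remainder (h : nat -> C -> C) (rho rho' r : R) (a : nat -> C) (u m : nat) :
  0 < rho -> 0 <= rho' -> 0 < r < 1 -> (0 < m)%N ->
  (forall kap, rho' < kap -> exists c d : R, [/\ 0 < c, 0 < d < 1 &
    forall n z eta, (0 < n)%N -> kap <= normc z <= r -> 0 < eta <= 1 ->
    (forall k, (1 <= k <= u)%N -> eta <= normc (z - a k)) ->
    normc (h n z) <= c * (rho ^+ n * d ^+ n + (1 < m)%:R * (n%:R ^+ (m - 2) * rho ^+ n / eta ^+ m))]) ->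
  forall K, compact (K : set C^o) -> K `<=` exterior rho' ->
  exists2 c : R, 0 < c & forall eps : R, 0 < eps -> exists2 delta : R, 0 < delta < 1 &
    forall (n : nat) z, (0 < n)%N -> K z -> normc z <= r - eps ->
      (forall k, (1 <= k <= u)%N -> eps <= normc (z - a k)) ->
      [/\ m = 1%N -> normc (h n z) <= c * (rho ^+ n * delta ^+ n + r ^+ (3 * n)),
          (2 <= m)%N -> (forall k, (1 <= k <= u)%N -> ~ K (a k)) ->
            normc (h n z) <= c / eps ^+ m.-1 * n%:R ^+ (m - 2) * rho ^+ n &
          (2 <= m)%N -> normc (h n z) <= c / eps ^+ m * n%:R ^+ (m - 2) * rho ^+ n].
Proof.
move=> rho0 rho'0 /andP[r0 r1] m0 H K cK Ke.
have [kap hkap Kk] := compact_exterior cK Ke.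
have [c0 [d [c00 d1 Hc]]] := H kap hkap.
have [e [e0 e1 He]] : exists e : R, [/\ 0 < e, e <= 1 &
    (forall k, (1 <= k <= u)%N -> ~ K (a k)) ->
    forall z k, K z -> (1 <= k <= u)%N -> e <= normc (z - a k)].
  case: (pselect (forall k, (1 <= k <= u)%N -> ~ K (a k))) => hK; last by exists 1.
  have [e e0 He] := compact_separation cK hK.
  exists (Num.min e 1); split; [by rewrite lt_min e0 ltr01|by rewrite ge_min lexx orbT|].
  by move=> _ z k Kz hk; rewrite ge_min He.
have d0 : 0 <= d by case/andP: d1 => /ltW.
pose c := 2 * c0 / e ^+ m.
have em0 : 0 < e ^+ m by exact: exprn_gt0.
have cc : 2 * c0 <= c.
  by rewrite /c ler_pdivlMr// ler_piMr// ?mulr_ge0 ?(ltW c00)// exprn_ile1// ltW.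
have c2 : c0 <= c by apply: le_trans cc; rewrite ler_peMl ?ler1n// ltW.
have cp : 0 < c by exact: lt_le_trans c2.
exists c => // eps eps0; exists d => // n z n0 Kz zr hz.
have zk : kap <= normc z <= r.
  by rewrite Kk//= (le_trans zr)// gerBl ltW.
have eps1 : eps <= 1.
  move: zr; rewrite lerBrDr => zr; apply: le_trans (ltW r1); apply: le_trans zr.
  by rewrite lerDr normc_ge0.
have rn0 : 0 <= rho ^+ n by rewrite exprn_ge0// ltW.
have rd : rho ^+ n * d ^+ n <= rho ^+ n.
  by rewrite ler_piMr// exprn_ile1//; case/andP: d1 => _ /ltW.
have nn1 : 1 <= n%:R ^+ (m - 2) :> R by rewrite exprn_ege1// ler1n.
have bound eta : 0 < eta <= 1 -> (forall k, (1 <= k <= u)%N -> eta <= normc (z - a k)) ->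
    (1 < m)%N -> normc (h n z) <= 2 * c0 / eta ^+ m * n%:R ^+ (m - 2) * rho ^+ n.
  move=> he hze m2; apply: le_trans (Hc n z eta n0 zk he hze) _.
  have /andP[he0 he1] := he.
  have B : rho ^+ n <= n%:R ^+ (m - 2) * rho ^+ n / eta ^+ m.
    apply: (@le_trans _ _ (n%:R ^+ (m - 2) * rho ^+ n)); first by rewrite ler_peMl.
    rewrite ler_peMr ?mulr_ge0 ?exprn_ge0 ?(ltW rho0)//.
    by rewrite invf_ge1 ?exprn_gt0// exprn_ile1// ltW.
  rewrite m2 mul1r.
  apply: (@le_trans _ _ (c0 * (2 * (n%:R ^+ (m - 2) * rho ^+ n / eta ^+ m)))).
    by rewrite ler_wpM2l ?(ltW c00)// mulr_natl mulr2n lerD2r (le_trans rd).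
  by rewrite le_eqVlt; apply/orP; left; apply/eqP; ring.
split.
- move=> m1; have he : 0 < eps <= 1 by rewrite eps0.
  apply: le_trans (Hc n z eps n0 zk he hz) _.
  rewrite m1 ltnn mul0r addr0; apply: ler_pM => //; [exact: ltW|by rewrite mulr_ge0 ?exprn_ge0 ?(ltW rho0)|].
  by rewrite lerDl exprn_ge0// ltW.
- move=> m2 hK; apply: le_trans (bound e _ _ m2) _; first by rewrite e0.
    by move=> k hk; exact: He.
  rewrite -/c; apply: ler_wpM2r => //; apply: ler_wpM2r; first exact: exprn_ge0.
  rewrite ler_peMr ?(ltW cp)//.
  by rewrite invf_ge1 ?exprn_gt0// exprn_ile1// ltW.
- move=> m2; apply: le_trans (bound eps _ hz m2) _; first by rewrite eps0.
  apply: ler_wpM2r => //; apply: ler_wpM2r; first exact: exprn_ge0.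
  by rewrite ler_wpM2r// invr_ge0 exprn_ge0// ltW.
Qed.

Lemma exp_le_bin n p : (p <= n)%N -> (n ^ p <= p ^ p * p`! * 'C(n, p))%N.
Proof.
move=> pn; rewrite -mulnA [(p`! * _)%N]mulnC bin_ffact.
have low q : (q <= n)%N -> ((n - q).+1 ^ q <= n ^_ q)%N.
  elim: q => [//|q IH] qn; rewrite ffactnSr expnSr leq_mul ?subnSK//.
  apply: leq_trans (IH (ltnW qn)); have [->|q0] := posnP q; first by rewrite !expn0.
  by rewrite leq_exp2r.
have [->|p0] := posnP p; first by rewrite !expn0.
apply: (@leq_trans ((p * (n - p).+1) ^ p)); last by rewrite expnMn leq_mul2l low ?orbT.
by rewrite leq_exp2r// mulnS -{1}(subnKC pn) leq_add2l leq_pmull.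
Qed.

Lemma unit_phase (x y : C) (th : R) n : normc x = normc y -> y != 0 ->
  th = (2 * pi)^-1 * (carg x - carg y) -> x ^+ n = y ^+ n * cis (2 * pi * n%:R * th).
Proof.
move=> xy y0 ->; have x0 : x != 0 by rewrite -normc_gt0 xy normc_gt0.
have polar t : t != 0 -> t ^+ n = (normc t)%:C ^+ n * cis (n%:R * carg t).
  by move=> t0; rewrite {1}(cargP t0) exprMn cisX.
rewrite (polar x)// (polar y)// xy -[RHS]mulrA -cisD; congr (_ * cis _).
have p0 : 2 * pi != 0 :> R by rewrite gt_eqF// twopi_gt0.
by rewrite mulrACA divff// mul1r mulrBr addrC subrK.
Qed.

Lemma relative_error (rho : R) (P : nat -> {poly C}) (Di : C -> C) (tau : C) (a B : nat -> C)
    (theta : nat -> R) (l m : nat) :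
  0 < rho < 1 -> (0 < l)%N -> (0 < m)%N -> tau != 0 ->
  (forall k, (1 <= k <= l)%N -> normc (a k) = rho) ->
  (forall z, normc z < 1 -> Di z != 0 /\ ccont Di z) ->
  theta 1%N = 1 ->
  (forall k, (2 <= k <= l)%N -> theta k = (2 * pi)^-1 * (carg (a k) - carg (a 1%N))) ->
  (forall kap, 0 <= kap -> kap < rho -> exists c d : R, [/\ 0 < c, 0 < d < 1 &
    forall n z, (0 < n)%N -> normc z <= kap ->
    normc ((P n).[z] - (tau * Di z)^-1 *
      \sum_(1 <= k < l.+1) 'C(n, m.-1)%:R * a k ^+ (n.+1 - m) * (B k / (a k - z))) <=
    c * (rho ^+ n * d ^+ n + (1 < m)%:R * (n%:R ^+ (m - 2) * rho ^+ n))]) ->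
  forall K, compact (K : set C^o) -> K `<=` disk rho ->
  exists c d : R, 0 < d < 1 /\ forall (n : nat) z,
    (0 < n)%N -> 'C(n, m.-1) != 0%N -> K z ->
    let err := normc (tau * Di z / a 1%N ^+ (n.+1 - m) * ('C(n, m.-1)%:R)^-1 * (P n).[z]
       - \sum_(1 <= k < l.+1) B k / (a k - z) * cis (2 * pi * (n.+1 - m)%:R * theta k)) in
    (m = 1%N -> err <= c * d ^+ n) /\ ((2 <= m)%N -> err <= c / n%:R).
Proof.
move=> /andP[rho0 rho1] l0 m0 tau0 ar hDi th1 th H K cK Kd.
have [kap /andP[kap0 kap1] Kk] := compact_disk rho0 cK Kd.
have [c0 [d [c00 d01 Hc]]] := H kap kap0 kap1.
have [d0 d1] := andP d01.
have [M M0 HM] : exists2 M, 0 < M & forall z, K z -> normc (Di z) <= M.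
  apply: compact_normc_bounded cK _ => z /Kd zr; apply: (hDi z _).2.
  exact: lt_trans rho1.
have a1r : normc (a 1%N) = rho by rewrite ar ?l0.
have a10 : a 1%N != 0 by rewrite -normc_gt0 a1r.
have phase k n : (1 <= k <= l)%N -> a k ^+ n = a 1%N ^+ n * cis (2 * pi * n%:R * theta k).
  move=> /andP[k1 kl]; have [->|k2] := eqVneq k 1%N.
    by rewrite th1 mulr1 cis_2pi_nat mulr1.
  have k2' : (2 <= k <= l)%N by rewrite kl ltn_neqAle eq_sym k2 k1.
  by apply: unit_phase => //; [rewrite a1r ar// k1|exact: th].
pose q : nat := (m.-1 ^ m.-1 * (m.-1)`!)%N.
pose c1 := normc tau * M * c0.
have c10 : 0 < c1 by rewrite !mulr_gt0// normc_gt0.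
have g0 : 0 < (1 - d)^-1 by rewrite invr_gt0 subr_gt0.
have g1 : 1 <= (1 - d)^-1.
  by rewrite invf_ge1 ?subr_gt0// gerBl ltW.
exists (c1 * ((1 - d)^-1 + q%:R)), d; split => // n z n0 bin0 Kz err.
pose N := (n.+1 - m)%N; pose b : R := 'C(n, m.-1)%:R.
have pn : (m.-1 <= n)%N.
  by rewrite leqNgt; apply: contra bin0 => /bin_small ->.
have b1 : 1 <= b by rewrite ler1n lt0n.
have b0 : 0 < b by exact: lt_le_trans b1.
have z1 : normc z < 1 by apply: le_lt_trans (Kk _ Kz) _; exact: lt_trans rho1.
have [Dz _] := hDi z z1.
have bC : ('C(n, m.-1)%:R : C) != 0.
  by rewrite -normc_gt0 normc_nat.
have aN : a 1%N ^+ N != 0 by rewrite expf_neq0.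
have errE : err = normc (tau * Di z / a 1%N ^+ N / 'C(n, m.-1)%:R * ((P n).[z] - (tau * Di z)^-1 *
      \sum_(1 <= k < l.+1) 'C(n, m.-1)%:R * a k ^+ N * (B k / (a k - z)))).
  rewrite /err -/N mulrBr; congr (normc (_ - _)).
  rewrite mulrA mulr_sumr; apply: eq_big_nat => k hk; rewrite (phase k)//.
  move: aN bC; move: (a 1%N ^+ N) ('C(n, m.-1)%:R : C) (B k / _) (cis _) => y1 y2 y3 y4 h1 h2.
  by field; rewrite h1 h2 tau0 Dz.
have n_pos : 0 < n%:R :> R by rewrite ltr0n.
have rN : 0 < rho ^+ N by exact: exprn_gt0.
have rhoN : rho ^+ n <= rho ^+ N.
  by apply: ler_wiXn2l; rewrite ?(ltW rho0) ?(ltW rho1)// /N leq_subLR -{1}(prednK m0) addSn ltnS leq_addl.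
have main : err <= c1 * (d ^+ n / b + (1 < m)%:R * (n%:R ^+ (m - 2) / b)).
  rewrite errE !normcM !normcV normcX a1r normc_nat -/b.
  apply: (@le_trans _ _ (normc tau * M / rho ^+ N / b *
      (c0 * (rho ^+ N * d ^+ n + (1 < m)%:R * (n%:R ^+ (m - 2) * rho ^+ N))))); last first.
    by rewrite le_eqVlt; apply/orP; left; apply/eqP; rewrite /c1; field; rewrite !gt_eqF.
  apply: ler_pM; rewrite ?normc_ge0//.
  - by rewrite !mulr_ge0 ?normc_ge0 ?invr_ge0 ?(ltW rN) ?(ltW b0).
  - rewrite !ler_wpM2r ?invr_ge0 ?(ltW b0) ?(ltW rN)// ler_wpM2l ?normc_ge0//.
    exact: HM.
  apply: le_trans (Hc n z n0 (Kk _ Kz)) _; apply: ler_wpM2l; first exact: ltW.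
  apply: lerD; first by apply: ler_wpM2r => //; rewrite exprn_ge0// ltW.
  by apply: ler_wpM2l => //; apply: ler_wpM2l => //; exact: exprn_ge0.
have db : d ^+ n / b <= d ^+ n.
  by rewrite ler_piMr ?exprn_ge0 ?(ltW d0)// invf_le1.
split => [m1|m2]; apply: le_trans main _.
  rewrite m1 ltnn mul0r addr0 -[leRHS]mulrA ler_wpM2l ?(ltW c10)//.
  apply: (le_trans db); rewrite ler_peMl ?exprn_ge0 ?(ltW d0)//.
  by apply: (le_trans g1); rewrite lerDl.
rewrite -[leRHS]mulrA ler_wpM2l ?(ltW c10)// [leRHS]mulrDl; apply: lerD.
  apply: (le_trans db); rewrite ler_pdivlMr// mulrC.
  by apply: natr_geom_bound => //; exact: ltW.
rewrite m2 mul1r ler_pdivrMr// mulrAC ler_pdivlMr// -exprSr.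
have -> : (m - 2).+1 = m.-1 by rewrite subn2 prednK// -ltnS prednK.
by rewrite -natrX -natrM ler_nat; exact: exp_le_bin.
Qed.

Lemma horner_prod_XsubC (zs : seq C) t :
  (\prod_(z <- zs) ('X - z%:P)).[t] = \prod_(z <- zs) (t - z).
Proof. by rewrite horner_prod; apply: eq_bigr => z _; rewrite hornerXsubC. Qed.

Lemma normc_prod_ge (zs : seq C) t d : 0 <= d -> (forall z, z \in zs -> d <= normc (t - z)) ->
  d ^+ size zs <= normc (\prod_(z <- zs) (t - z)).
Proof.
move=> d0; elim: zs => [_|z zs IH h]; first by rewrite big_nil normc1.
rewrite big_cons normcM exprS; apply: ler_pM; rewrite ?exprn_ge0//.
  by apply: h; rewrite inE eqxx.
by apply: IH => y yz; apply: h; rewrite inE yz orbT.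
Qed.

Lemma normc_prod_le (zs : seq C) t d : (forall z, z \in zs -> normc (t - z) <= d) ->
  normc (\prod_(z <- zs) (t - z)) <= d ^+ size zs.
Proof.
elim: zs => [_|z zs IH h]; first by rewrite big_nil normc1.
rewrite big_cons normcM exprS; apply: ler_pM; rewrite ?normc_ge0//.
  by apply: h; rewrite inE eqxx.
by apply: IH => y yz; apply: h; rewrite inE yz orbT.
Qed.

Lemma cmean_pole_sum (a c : nat -> C) (f : C -> C) l s : 0 <= s ->
  (forall k, (1 <= k <= l)%N -> s < normc (a k)) ->
  (forall t, s <= normc t -> cdiff f t) -> ctends f 0 ->
  cmean s (fun t => (\sum_(1 <= k < l.+1) c k / (a k - t)) * f t * t) =
  \sum_(1 <= k < l.+1) c k * f (a k).
Proof.
move=> s0 ha hf f0.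
pose V k t : C := if (1 <= k <= l)%N then - c k * (f t * (t / (t - a k))) else 0.
have ta k t : (1 <= k <= l)%N -> normc t = s -> t != a k.
  by move=> hk ts; apply: normc_neq; rewrite ts lt_eqF// ha.
have kc k t : (1 <= k <= l)%N -> normc t = s -> ccont (fun t => f t * (t / (t - a k))) t.
  move=> hk ts; apply: ccontM; first by apply: cdiff_cont; apply: hf; rewrite ts.
  by apply: ccont_kernel; exact: ta.
have Vc k : ccont_circle s (V k).
  move=> t ts; rewrite /V; case: (boolP (1 <= k <= l)%N) => hk; last exact: ccont_cst.
  by apply: ccontM; [exact: ccont_cst|exact: kc].
rewrite (@eq_cmean _ _ _ (fun t => \sum_(1 <= k < l.+1) V k t))//; last first.
  move=> t ts; rewrite -mulrA mulr_suml; apply: eq_big_nat => k; rewrite ltnS => hk.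
  by rewrite /V hk -[t - a k]opprB invrN; ring.
rewrite cmean_sum//; apply: eq_big_nat => k; rewrite ltnS => hk.
rewrite /V hk cmeanZ//; last by move=> t ts; exact: kc.
rewrite (@cauchy_ext _ [::])//.
- by rewrite mulrNN.
- exact: ha.
- by move=> t ts; apply: cdiff_cont; exact: hf.
- by move=> t /ltW ts _; exact: hf.
- by apply: hf; apply: ltW; exact: ha.
Qed.

Lemma ctends_quotient (T : {poly C}) (zs : seq C) : (size T <= size zs)%N ->
  ctends (fun t => T.[t] / (\prod_(z <- zs) ('X - z%:P)).[t]) 0.
Proof.
move=> sT; set W := \prod_(z <- zs) _; pose n := size zs.
have sW : size W = n.+1 by rewrite size_prod_XsubC.
have Wn : W`_n = 1.
  have : W \is monic by exact: monic_prod_XsubC.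
  by rewrite monicE lead_coefE sW => /eqP.
apply: (@ctends_near _ (fun t => T.[t] / t ^+ n * (W.[t] / t ^+ n)^-1) _ _ 1).
  move=> t t1; have t0 : t ^+ n != 0.
    by rewrite expf_neq0// -normc_gt0; apply: lt_le_trans t1.
  by rewrite invfM invrK mulrACA mulVf// mulr1.
rewrite -[X in ctends _ X](mul0r (1^-1 : C)); apply: ctendsM.
  by rewrite -(nth_default 0 sT); apply: ctends_poly_div; exact: leqW.
apply: ctendsV; first exact: oner_neq0.
by rewrite -Wn; apply: ctends_poly_div; rewrite sW.
Qed.

Lemma nb_zeros_factor (p : {poly C}) K l : (l <= nb_zeros p K)%N ->
  exists zs : seq C, exists q : {poly C},
    [/\ size zs = l, (forall z, z \in zs -> K z) & p = \prod_(z <- zs) ('X - z%:P) * q].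
Proof.
rewrite /nb_zeros; case: (closed_field_poly_normal p) => rs /= prs hl.
pose zs := [seq z <- rs | z \in K].
have szs : (l <= size zs)%N by rewrite size_filter.
exists (take l zs), ((lead_coef p) *: (\prod_(z <- drop l zs) ('X - z%:P) *
  \prod_(z <- rs | z \notin K) ('X - z%:P))); split.
- by rewrite size_takel.
- by move=> z /mem_take; rewrite mem_filter => /andP[]; rewrite inE.
rewrite {1}prs -scalerAr mulrA -big_cat cat_take_drop; congr (_ *: _).
by rewrite (bigID (fun z => z \in K)) /= big_filter.
Qed.

(* If l zeros of P n lay in K, dividing by their monic polynomial W keeps D n * P n holomorphic in
   the disk, so its mean over a circle against T t / W t is 0. The pole sum gives instead its
   residues: a fixed nonzero contribution of a 1, as T vanishes at the other a k. *)
Lemma few_zeros (rho : R) (P : nat -> {poly C}) (D : nat -> C -> C) (a : nat -> C)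
    (c : nat -> nat -> C) (beta : R) (l : nat) : 0 < rho -> (0 < l)%N -> 0 < beta ->
  (forall k, (1 <= k <= l)%N -> normc (a k) = rho) ->
  (forall j k, (1 <= j <= l)%N -> (1 <= k <= l)%N -> a j = a k -> j = k) ->
  (forall n, beta <= normc (c n 1%N)) ->
  (forall n z, normc z < rho -> cdiff (D n) z) ->
  (forall s e, 0 <= s < rho -> 0 < e -> exists N, forall n z, (N <= n)%N -> normc z = s ->
     normc (D n z * (P n).[z] - \sum_(1 <= k < l.+1) c n k / (a k - z)) <= e) ->
  forall K, compact (K : set C^o) -> K `<=` disk rho ->
  exists N : nat, forall n, (N <= n)%N -> (nb_zeros (P n) K <= l.-1)%N.
Proof.
move=> rho0 l0 beta0 ar ainj cb hD H K cK Kd.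
have [kap /andP[kap0 kap1] Kk] := compact_disk rho0 cK Kd.
pose s := (kap + rho) / 2; have [ks sr] := midf_lt kap1; rewrite -/s in ks sr.
have s0 : 0 < s by exact: le_lt_trans ks.
pose T : {poly C} := \prod_(2 <= k < l.+1) ('X - (a k)%:P).
have sT : (size T <= l)%N.
  rewrite /T -(big_map a xpredT (fun z => 'X - z%:P)) size_prod_XsubC size_map size_iota.
  by rewrite subSS subn1 prednK.
have T1 : T.[a 1%N] != 0.
  rewrite /T horner_prod prodf_seq_neq0; apply/allP => k.
  rewrite mem_index_iota => /andP[k2 kl] /=; rewrite hornerXsubC subr_eq0.
  apply/eqP => /ainj ak; have k1 : (1 <= k <= l)%N by rewrite (ltnW k2).
  by move: k2; rewrite -ak ?l0.
have Tk k : (2 <= k <= l)%N -> T.[a k] = 0.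
  move=> hk; apply/eqP; rewrite -[_ == 0]/(root T (a k)) /T.
  rewrite -(big_map a xpredT (fun z => 'X - z%:P)) root_prod_XsubC.
  by apply: map_f; rewrite mem_index_iota.
have [MT MT0 HT] : exists2 M, 0 < M & forall z, circle s z -> normc T.[z] <= M.
  by apply: compact_normc_bounded (@circle_compact R s) _ => z _; exact: ccont_horner.
have sk : 0 < s - kap by rewrite subr_gt0.
have rk : 0 < rho + kap by rewrite ltr_wpDr.
pose low := beta * (normc T.[a 1%N] / (rho + kap) ^+ l).
have low0 : 0 < low by apply: mulr_gt0 => //; apply: divr_gt0; rewrite ?normc_gt0// exprn_gt0.
pose up := 2 * (MT / (s - kap) ^+ l * s).
have up0 : 0 < up.
  apply: mulr_gt0 => //; apply: mulr_gt0 => //; apply: divr_gt0 => //; exact: exprn_gt0.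
have [||N HN] := H s (low / (up + up)).
- by rewrite (ltW s0).
- by rewrite divr_gt0// addr_gt0.
exists N => n Nn; rewrite leqNgt; apply/negP; rewrite prednK// => hz.
have [zs [q [szs zsK Pq]]] := nb_zeros_factor hz.
set W := \prod_(z <- zs) _ in Pq.
have zsk z : z \in zs -> normc z <= kap by move/zsK/Kk.
have Wge t : s <= normc t -> (s - kap) ^+ l <= normc W.[t].
  move=> ts; rewrite horner_prod_XsubC -szs; apply: normc_prod_ge; first exact: ltW.
  by move=> z /zsk zk; apply: le_trans (ler_dist_normc _ _); rewrite lerB.
have W0 t : s <= normc t -> W.[t] != 0.
  by move=> /Wge h; rewrite -normc_gt0; apply: lt_le_trans h; exact: exprn_gt0.
have Wle : normc W.[a 1%N] <= (rho + kap) ^+ l.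
  rewrite horner_prod_XsubC -szs; apply: normc_prod_le => z /zsk zk.
  by apply: le_trans (ler_normcB _ _) _; rewrite ar ?l0// lerD2l.
pose f t := T.[t] / W.[t].
have fd t : s <= normc t -> cdiff f t by move=> /W0 Wt; rewrite /f; cd.
have f0 : ctends f 0 by apply: ctends_quotient; rewrite szs.
pose S t := \sum_(1 <= k < l.+1) c n k / (a k - t).
have J : cmean s (fun t => S t * f t * t) = c n 1%N * f (a 1%N).
  rewrite (@cmean_pole_sum a (c n) f l s (ltW s0))//; last by move=> k /ar ->.
  rewrite big_ltn// big1_seq ?addr0// => k; rewrite mem_index_iota => /andP[_ hk].
  by rewrite /f Tk ?mul0r ?mulr0// -ltnS.
have I : cmean s (fun t => D n t * (P n).[t] * f t * t) = 0.
  rewrite (@eq_cmean _ _ _ (fun t => D n t * q.[t] * T.[t] * t)) ?(ltW s0)//; last first.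
    by move=> t ts; rewrite Pq hornerM /f; field; rewrite W0// ts.
  have dd t : normc t <= s -> cdiff (fun t => D n t * q.[t] * T.[t] * t) t.
    by move=> ts; cd; apply: hD; exact: le_lt_trans sr.
  rewrite -(@cmean_eq _ [::] 0 s) ?(ltW s0)// ?cmean0 ?mulr0//.
  - by move=> t /andP[_ ts]; apply: cdiff_cont; exact: dd.
  - by move=> t /andP[_ /ltW ts] _; exact: dd.
have Sc t : normc t = s -> ccont (fun t => S t * f t * t) t.
  move=> ts; apply: ccontM; last exact: ccont_id.
  apply: ccontM; last by apply: cdiff_cont; apply: fd; rewrite ts.
  rewrite /S; under eq_fun do rewrite big_nat_cond big_mkcond /=; apply: ccont_sum => k.
  case: (boolP ((0 < k < l.+1)%N && true)) => [/andP[hk _]|_]; last exact: ccont_cst.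
  by cc; apply: sub_neq0; rewrite ts ar// lt_eqF.
have Ic t : normc t = s -> ccont (fun t => D n t * (P n).[t] * f t * t) t.
  move=> ts; apply: ccontM; last exact: ccont_id.
  apply: ccontM; last by apply: cdiff_cont; apply: fd; rewrite ts.
  by apply: ccontM; [apply: cdiff_cont; apply: hD; rewrite ts|exact: ccont_horner].
have E : normc (c n 1%N * f (a 1%N)) <= 2 * (low / (up + up) * (MT / (s - kap) ^+ l) * s).
  rewrite -J -normcN -[- cmean _ _]add0r -I -cmeanB ?(ltW s0)//.
  apply: cmean_bound; first exact: ltW.
    by move=> t ts; apply: ccontB; [exact: Ic|exact: Sc].
  move=> t ts; rewrite -!mulrBl !normcM ts; apply: ler_wpM2r; first exact: ltW.
  apply: ler_pM; rewrite ?normc_ge0 ?HN//.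
    by rewrite mulr_ge0 ?normc_ge0.
  rewrite normcV; apply: ler_pM; rewrite ?normc_ge0 ?invr_ge0 ?normc_ge0 ?HT//.
  by rewrite lef_pV2 ?posrE ?exprn_gt0 ?normc_gt0 ?W0 ?Wge ?ts.
have L : low <= normc (c n 1%N * f (a 1%N)).
  rewrite normcM /low; apply: ler_pM; rewrite ?(ltW beta0) ?cb//.
    by rewrite divr_ge0 ?normc_ge0// exprn_ge0// ltW.
  rewrite /f normcM normcV ler_wpM2l ?normc_ge0// lef_pV2 ?posrE ?exprn_gt0//.
  by rewrite normc_gt0 W0// ar ?l0// ltW.
have := le_trans L E.
have -> : 2 * (low / (up + up) * (MT / (s - kap) ^+ l) * s) = low / 2.
  have e x : 2 * (low * x * (MT / (s - kap) ^+ l) * s) = low * x * up by rewrite /up; ring.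
  have up2 : up + up = 2 * up by rewrite mulr_natl mulr2n.
  have half x y : y != 0 -> x / (2 * y) * y = x / 2 :> R by move=> y0; field; rewrite y0.
  by rewrite e up2 half// gt_eqF.
by rewrite leNgt ltr_pdivrMr// ltr_pMr// ltr1n.
Qed.

End Estimates.

Theorem theorem3 (R : realType) (w : R[i] -> R) (phi : nat -> {poly R[i]})
    (rho' r : R) (De : R[i] -> R[i])
    (u l m : nat) (a : nat -> R[i]) (theta : nat -> R) :
  let rho := szego_rho w in
  let Di := szego w in
  let tau := szego_tau w in
  let Phi := monic_poly phi in
  let hDe := pole_coef De m in
  analytic_weight w ->
  orthonormal_polys w phi ->
  rho < r -> r < 1 ->
  0 <= rho' -> rho' < rho ->
  (forall z, exterior 1 z -> De z = szego w z) ->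
  (forall k, (1 <= k <= u)%N ->
     circle rho (a k) /\ exists p, pole De (a k) p) ->
  (forall j k, (1 <= j <= u)%N -> (1 <= k <= u)%N -> a j = a k -> j = k) ->
  holomorphic_on
    [set z | exterior rho' z /\ forall k, (1 <= k <= u)%N -> z != a k] De ->
  (l <= u)%N ->
  (forall k, (1 <= k <= u)%N ->
     dominant_pole (exterior rho') De (a k) <-> (k <= l)%N) ->
  (forall k, (1 <= k <= l)%N -> pole De (a k) m) ->
  theta 1%N = 1 ->
  (forall k, (2 <= k <= l)%N ->
     theta k = (2 * pi)^-1 * (carg (a k) - carg (a 1%N))) ->
  [/\ (* (i) *)
      exists h : nat -> R[i] -> R[i],
        (forall (eps : R) (n : nat) (z : R[i]),
           0 < eps -> rho' < normc z -> normc z <= r - eps ->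
           (forall k, (1 <= k <= u)%N -> eps <= normc (z - a k)) ->
           (Phi n).[z] =
             De z / tau * z ^+ n
             + (tau * Di z)^-1 *
               (\sum_(1 <= k < l.+1)
                  'C(n, m.-1)%:R * a k ^+ (n.+1 - m)
                  * (Di (a k) * hDe (a k) / (a k - z)))
             + h n z)
        /\
        (forall K : set R[i], compact (K : set R[i]^o) -> K `<=` exterior rho' ->
         exists2 c : R, 0 < c &
           forall eps : R, 0 < eps ->
           exists2 delta : R, 0 < delta < 1 &
             forall (n : nat) (z : R[i]),
               (0 < n)%N -> K z -> normc z <= r - eps ->
               (forall k, (1 <= k <= u)%N -> eps <= normc (z - a k)) ->
               [/\ m = 1%N ->
                     normc (h n z) <=
                       c * (rho ^+ n * delta ^+ n + r ^+ (3 * n)),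
                   (2 <= m)%N ->
                   (forall k, (1 <= k <= u)%N -> ~ K (a k)) ->
                     normc (h n z) <=
                       c / eps ^+ m.-1 * n%:R ^+ (m - 2) * rho ^+ n &
                   (2 <= m)%N ->
                     normc (h n z) <=
                       c / eps ^+ m * n%:R ^+ (m - 2) * rho ^+ n]),
      (* (ii) *)
      forall K : set R[i], compact (K : set R[i]^o) -> K `<=` disk rho ->
        exists c delta : R, 0 < delta < 1 /\
          forall (n : nat) (z : R[i]),
            (0 < n)%N -> 'C(n, m.-1) != 0%N -> K z ->
            let err :=
              normc (tau * Di z / a 1%N ^+ (n.+1 - m)
                       * ('C(n, m.-1)%:R)^-1 * (Phi n).[z]
                     - \sum_(1 <= k < l.+1)
                         Di (a k) * hDe (a k) / (a k - z)
                         * cis (2 * pi * (n.+1 - m)%:R * theta k)) in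
            (m = 1%N -> err <= c * delta ^+ n) /\
            ((2 <= m)%N -> err <= c / n%:R)
    & (* (iii) *)
      forall K : set R[i], compact (K : set R[i]^o) -> K `<=` disk rho ->
        exists N : nat, forall n, (N <= n)%N ->
          (nb_zeros (Phi n) K <= l.-1)%N].
Proof.
move=> rho Di tau Phi hDe w_an phi_or rho_r r1 rho'0 rho'_rho DeE a_pole a_inj De_holo lu a_dom
  a_mult th1 th.
have rho0 : 0 < rho by exact: le_lt_trans rho'_rho.
have rho1 : rho < 1 by exact: lt_trans r1.
have l0 : (0 < l)%N.
  exact: (exists_dominant rho_r r1 rho'0 rho'_rho DeE a_pole De_holo a_dom).
have m0 : (0 < m)%N by case: (a_mult 1%N); rewrite ?l0.
have tau0 : tau != 0 by exact: szego_tau_neq0.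
have [outer inner] := asymptotics w_an phi_or rho_r r1 rho'0 rho'_rho DeE a_pole a_inj De_holo
  lu a_dom a_mult.
have ar k : (1 <= k <= l)%N -> normc (a k) = rho.
  by move=> /andP[k1 kl]; apply: (a_pole k _).1; rewrite k1 (leq_trans kl lu).
have Di_cdiff z : normc z < 1 -> cdiff Di z.
  by move=> z1; apply: szego_cdiff; rewrite // lt_eqF.
have DiP z : normc z < 1 -> Di z != 0 /\ ccont Di z.
  by move=> z1; split; [exact: szego_neq0|exact/cdiff_cont/Di_cdiff].
have rho01 : 0 < rho < 1 by rewrite rho0.
have relerr := @relative_error R rho Phi Di tau a (fun k => Di (a k) * hDe (a k)) theta l m
  rho01 l0 m0 tau0 ar DiP th1 th inner.
split => //.
- exists (fun n z => (Phi n).[z] - De z / tau * z ^+ n - (tau * Di z)^-1 *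
      \sum_(1 <= k < l.+1) 'C(n, m.-1)%:R * a k ^+ (n.+1 - m)
        * (Di (a k) * hDe (a k) / (a k - z))).
  split; first by move=> *; rewrite [RHS]addrC -[X in _ = X + _]addrA -opprD subrK.
  apply: (uniform_remainder rho0 rho'0 _ m0 outer).
  by rewrite r1 (lt_trans rho0).
- pose D n z := tau * Di z / a 1%N ^+ (n.+1 - m) * ('C(n, m.-1)%:R)^-1.
  pose c n k := Di (a k) * hDe (a k) * cis (2 * pi * (n.+1 - m)%:R * theta k).
  pose beta := normc (Di (a 1%N) * hDe (a 1%N)).
  have beta0 : 0 < beta.
    rewrite normc_gt0 mulf_neq0// ?szego_neq0//.
    by apply: pole_coef_neq0; apply: a_mult; rewrite l0.
  apply: (@few_zeros R rho Phi D a c beta l rho0 l0 beta0 ar).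
  + move=> j k /andP[j1 jl] /andP[k1 kl]; apply: a_inj; rewrite ?j1 ?k1 (leq_trans _ lu)//.
  + by move=> n; rewrite /c [normc (_ * cis _)]normcM normc_cis mulr1.
  + move=> n z zr; rewrite /D; cd; apply: Di_cdiff; exact: lt_trans rho1.
  + move=> s e /andP[s0 sr] e0.
    have Ks : circle s `<=` @disk R rho by move=> z; rewrite /circle /disk /= => ->.
    have [C [d [/andP[d0 d1] H]]] := relerr _ (@circle_compact R s) Ks.
    have C0 : 0 < `|C| + 1 by rewrite ltr_wpDl.
    have Ce n' : 0 <= n' -> n' <= e / (`|C| + 1) -> C * n' <= e.
      move=> n'0; rewrite ler_pdivlMr// mulrC; apply: le_trans; rewrite ler_wpM2r//.
      by apply: (le_trans (ler_norm _)); rewrite lerDl.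
    have [N1 HN1] := geom_small (ltW d0) d1 (divr_gt0 e0 C0).
    pose N2 := Num.bound ((`|C| + 1) / e).
    have HN2 : (`|C| + 1) / e < N2%:R by apply: archi_boundP; rewrite divr_ge0// ltW.
    exists (maxn N1 (maxn N2 m)) => n z; rewrite !geq_max => /and3P[n1 n2 nm] zs.
    have n0 : (0 < n)%N by exact: leq_trans m0 nm.
    have bin0 : 'C(n, m.-1) != 0%N.
      by rewrite -lt0n bin_gt0 (leq_trans (leq_pred m)).
    have [H1 H2] := H n z n0 bin0 zs.
    rewrite (eq_bigr (fun k => Di (a k) * hDe (a k) / (a k - z)
      * cis (2 * pi * (n.+1 - m)%:R * theta k))); last by move=> k _; rewrite /c mulrAC.
    have [m1|m1] := eqVneq m 1%N.
      by apply: (le_trans (H1 m1)); apply: Ce; [rewrite exprn_ge0// ltW|exact: HN1].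
    apply: le_trans (H2 _) _; first by rewrite ltn_neqAle eq_sym m1.
    apply: Ce; first by rewrite invr_ge0.
    have e1 : 0 < (`|C| + 1) / e by rewrite divr_gt0.
    rewrite -[leRHS]invrK invf_div lef_pV2 ?posrE ?ltr0n//.
    by apply: (le_trans (ltW HN2)); rewrite ler_nat.
Qed.
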